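(* Let $X\subset\mathbb{R}^N$ be a closed semialgebraic set with $0\in X$, and let $F=(f_1,\dots,f_m):(X,0)\to(\mathbb{R}^m,0)$ be an analytic mapping with an isolated zero at the origin. Let $\dim_{\mathbb{R},0}X=n$ and let $n\le k\le m$. Then for any $L\in\mathbf{L}^{\mathbb{R}}(m,k)$ such that the origin is an isolated zero of $L\circ F|X$, we have $$\mathcal{L}^{\mathbb{R}}_0(F|X)\le\mathcal{L}^{\mathbb{R}}_0(L\circ F|X).$$ Moreover, for the generic $L\in\mathbf{L}^{\mathbb{R}}(m,k)$ the origin is an isolated zero of $L\circ F|X$ and $$\mathcal{L}^{\mathbb{R}}_0(F|X)=\mathcal{L}^{\mathbb{R}}_0(L\circ F|X).$$ In particular, for the generic $L\in\Delta^{\mathbb{R}}(m,k)$ the origin is an isolated zero of $L\circ F|X$ and $\mathcal{L}^{\mathbb{R}}_0(F|X)=\mathcal{L}^{\mathbb{R}}_0(L\circ F|X)$.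
   Context: $F:(X,0)\to(\mathbb{R}^m,0)$ denotes a mapping of a neighbourhood of $0$ in $X$ into $\mathbb{R}^m$ with $F(0)=0$; analytic means that it is the restriction of an analytic mapping defined on a neighbourhood of $0$ in $\mathbb{R}^N$. It is assumed that $0$ is an accumulation point of $X$. Dimension: $\dim_{\mathbb{R},0}X$ is the infimum of the dimensions at $0$ of local analytic sets $V\ni 0$ in $\mathbb{R}^N$ such that $X\cap U\subset V$ for some neighbourhood $U\subset\mathbb{R}^N$ of $0$. Linear mappings: $\mathbf{L}^{\mathbb{R}}(m,k)$ is the set of all linear mappings $\mathbb{R}^m\to\mathbb{R}^k$ (with $\mathbb{R}^0=\{0\}$). For $m\ge k$, $\Delta^{\mathbb{R}}(m,k)$ is the set of those $L=(L_1,\dots,L_k)\in\mathbf{L}^{\mathbb{R}}(m,k)$ of the form $L_i(y_1,\dots,y_m)=y_i+\sum_{j=k+1}^m\alpha_{i,j}y_j$, $i=1,\dots,k$, with $\alpha_{i,j}\in\mathbb{R}$. Generic: ''for the generic $x\in A$'' means that there exists an algebraic set $V$ such that $A\setminus V$ is a dense subset of $A$ and the property holds for all $x\in A\setminus V$. Łojasiewicz exponent at $0$: $\mathcal{L}^{\mathbb{R}}_0(G|X)$ is the smallest exponent $\eta$ for which there exist $C,\varepsilon>0$ such that $|G(x)|\ge C\operatorname{dist}(x,G^{-1}(0)\cap X)^{\eta}$ for $x\in X$, $|x|<\varepsilon$ (Euclidean norm and distance); if $0$ is an isolated zero of $G|X$, the right-hand side equals $C|x|^\eta$ near $0$. *)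

(* Defs.v *)
From HB Require Import structures.
From mathcomp Require Import all_boot all_order all_algebra.
From mathcomp Require Import all_classical all_reals all_analysis.
(* Not imported: its notations clash with those of MathComp-Analysis. *)
From mathcomp Require mpoly.
Set Implicit Arguments.
Unset Strict Implicit.
Unset Printing Implicit Defensive.
Import Order.TTheory GRing.Theory Num.Theory.
Import numFieldNormedType.Exports.
Local Open Scope classical_set_scope.
Local Open Scope ring_scope.

(* Points of R^N are row vectors.  The library norm on 'rV[R]_N is the sup norm;
   it induces the usual topology, but the Lojasiewicz inequality below uses the
   Euclidean norm and distance. *)

Section Euclidean.
Context {R : realType}.

Definition enorm (N : nat) (x : 'rV[R]_N) : R :=
  Num.sqrt (\sum_(i < N) x 0 i ^+ 2).

Definition edist_set (N : nat) (x : 'rV[R]_N) (A : set 'rV[R]_N) : R :=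
  inf [set enorm (x - z) | z in A].

End Euclidean.

Section Algebraic.
Context {R : realType}.

Definition peval (N : nat) (p : mpoly.mpoly N R) (x : 'rV[R]_N) : R :=
  mpoly.meval (fun i => x 0 i) p.

(* finite unions of sets {p_1 = ... = p_r = 0, q_1 > 0, ..., q_s > 0} *)
Definition semialgebraic (N : nat) (X : set 'rV[R]_N) : Prop :=
  exists S : seq (seq (mpoly.mpoly N R) * seq (mpoly.mpoly N R)),
    X = [set x | has (fun pq => all (fun p => peval p x == 0) pq.1
                             && all (fun q => 0 < peval q x) pq.2) S].

(* algebraic subsets of the space of matrices, identified with R^(m * k) *)
Definition algebraic_set (m k : nat) (V : set 'M[R]_(m, k)) : Prop :=
  exists S : seq (mpoly.mpoly (m * k) R),
    V = [set A | all (fun p => peval p (mxvec A) == 0) S].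

Definition generic (m k : nat) (A : set 'M[R]_(m, k))
    (P : 'M[R]_(m, k) -> Prop) : Prop :=
  exists V : set 'M[R]_(m, k),
    [/\ algebraic_set V,
        A `<=` closure (A `\` V) &
        forall L, (A `\` V) L -> P L].

End Algebraic.

Section Analytic.
Context {R : realType}.

(* sum of an absolutely convergent power series in several variables:
   absolute convergence makes both sums below finite *)
Definition analytic_fun_at (N : nat) (f : 'rV[R]_N -> R) (a : 'rV[R]_N) : Prop :=
  exists c : {ffun 'I_N -> nat} -> R, \forall x \near a,
    let t e := (c e * \prod_(i < N) (x - a) 0 i ^+ e i)%:E in
    summable setT t /\
    (f x)%:E = (\esum_(e in setT) (t^\+ e) - \esum_(e in setT) (t^\- e))%E.

Definition analytic_on (N p : nat) (U : set 'rV[R]_N)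
    (f : 'rV[R]_N -> 'rV[R]_p) : Prop :=
  forall a, U a -> forall j, analytic_fun_at (fun x => f x 0 j) a.

(* A mapping of a neighbourhood of 0 in X is represented by a total function;
   its values off X, or away from 0, are irrelevant. *)
Definition analytic_germ_on (N p : nat) (X : set 'rV[R]_N)
    (F : 'rV[R]_N -> 'rV[R]_p) : Prop :=
  exists (U : set 'rV[R]_N) (G : 'rV[R]_N -> 'rV[R]_p),
    [/\ open U, U 0, analytic_on U G &
        forall x, U x -> X x -> F x = G x].

Definition local_analytic_set (N : nat) (V : set 'rV[R]_N) : Prop :=
  forall a, V a ->
  exists (U : set 'rV[R]_N) (s : nat) (g : 'rV[R]_N -> 'rV[R]_s),
    [/\ open U, U a, analytic_on U g & V `&` U = U `&` [set x | g x = 0]].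

(* d-dimensional analytic submanifolds of R^N (d <= N), through charts
   phi : U -> W straightening G `&` U to W `&` (R^d x {0}) *)
Definition analytic_submanifold (N d : nat) (G : set 'rV[R]_N) : Prop :=
  forall a, G a ->
  exists (U W : set 'rV[R]_N) (phi psi : 'rV[R]_N -> 'rV[R]_N),
    [/\ [/\ open U, U a & open W],
        analytic_on U phi /\ analytic_on W psi,
        (forall x, U x -> W (phi x) /\ psi (phi x) = x),
        (forall y, W y -> U (psi y) /\ phi (psi y) = y) &
        phi @` (G `&` U) =
          W `&` [set y | forall i : 'I_N, (d <= i)%N -> y 0 i = 0]].

(* dimension at 0 of a local analytic set V containing 0: the largest d such
   that V contains d-dimensional submanifolds arbitrarily close to 0 *)
Definition analytic_dim0 (N : nat) (V : set 'rV[R]_N) : nat :=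
  \max_(d < N.+1 | `[< forall U : set 'rV[R]_N, nbhs (0 : 'rV[R]_N) U ->
     exists G : set 'rV[R]_N,
       [/\ G !=set0, G `<=` V `&` U & analytic_submanifold d G] >]) d.

Definition analytic_hull0 (N : nat) (X V : set 'rV[R]_N) : Prop :=
  [/\ local_analytic_set V, V 0 &
      exists2 U : set 'rV[R]_N, nbhs (0 : 'rV[R]_N) U & X `&` U `<=` V].

(* dim_{R,0} X = n; the infimum of a set of naturals, nonempty because of
   V = setT, is its least element *)
Definition has_dim0 (N : nat) (X : set 'rV[R]_N) (n : nat) : Prop :=
  (exists2 V, analytic_hull0 X V & analytic_dim0 V = n) /\
  (forall V, analytic_hull0 X V -> (n <= analytic_dim0 V)%N).

End Analytic.

Section Lojasiewicz.
Context {R : realType}.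

Definition zeros_on (N p : nat) (X : set 'rV[R]_N) (G : 'rV[R]_N -> 'rV[R]_p) :
  set 'rV[R]_N := X `&` [set x | G x = 0].

Definition isolated_zero (N p : nat) (X : set 'rV[R]_N)
    (G : 'rV[R]_N -> 'rV[R]_p) : Prop := isolated (zeros_on X G) 0.

Definition lojasiewicz_ineq (N p : nat) (X : set 'rV[R]_N)
    (G : 'rV[R]_N -> 'rV[R]_p) (eta : R) : Prop :=
  exists C eps : R, [/\ 0 < C, 0 < eps &
    forall x, X x -> enorm x < eps ->
      C * edist_set x (zeros_on X G) `^ eta <= enorm (G x)].

Definition lojasiewicz_exponent (N p : nat) (X : set 'rV[R]_N)
    (G : 'rV[R]_N -> 'rV[R]_p) : \bar R :=
  ereal_inf [set eta%:E | eta in lojasiewicz_ineq X G].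

(* The infimum is the smallest exponent whenever there is a smallest one. *)
Lemma lojasiewicz_exponent_least (N p : nat) (X : set 'rV[R]_N)
    (G : 'rV[R]_N -> 'rV[R]_p) (eta : R) :
  lojasiewicz_ineq X G eta ->
  (forall eta', lojasiewicz_ineq X G eta' -> eta <= eta') ->
  lojasiewicz_exponent X G = eta%:E.
Proof.
move=> Heta Hmin; apply/eqP; rewrite eq_le; apply/andP; split.
  by apply: ereal_inf_lbound; exists eta.
by apply: le_ereal_inf_tmp => _ [e He <-]; rewrite lee_fin; exact: Hmin.
Qed.

End Lojasiewicz.

Section Linear.
Context {R : realType}.

(* The linear map R^m -> R^k of matrix L is y |-> y *m L. *)
Definition lin_comp (N m k : nat) (L : 'M[R]_(m, k))
    (F : 'rV[R]_N -> 'rV[R]_m) : 'rV[R]_N -> 'rV[R]_k := fun x => F x *m L.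

Definition Delta (m k : nat) (hkm : (k <= m)%N) : set 'M[R]_(m, k) :=
  [set L | exists alpha : 'I_k -> 'I_m -> R, forall (y : 'rV[R]_m) (i : 'I_k),
     (y *m L) 0 i = y 0 (widen_ord hkm i)
                    + \sum_(j < m | (k <= j)%N) alpha i j * y 0 j].

End Linear.

(* Main.v *)
(** Let D be the set of limits of F(x)/|F(x)| as x tends to 0 in X.  If u L <> 0
    for all u in D, then |F| <= C |L o F| near 0 on X by compactness, and since
    |L o F| <= c |F| always holds, L o F and F have the same exponent.  So it
    suffices to find a nonzero polynomial in the entries of L that vanishes
    whenever u L = 0 for some u in D; a translation by an element of GL_k then
    makes it nonzero somewhere on Delta.

    Such a polynomial exists because D is small.  Near 0, any n + 1 coordinates
    are algebraically dependent on X, so polynomials of degree <= Q span on X a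
    space of dimension O(Q^n).  A Lojasiewicz inequality |x|^s <= |F(x)|^2 shows
    that, modulo O(|F|^(2e)), a form of degree < 2e in F is determined on X by a
    Taylor polynomial of degree O(e).  Hence for some e' and j >= (k + 1) e' the
    forms of degree j span on D a space of dimension < e'^k.  Where u_i <> 0, the
    equation u L = 0 gives row i of L in terms of u and the other rows, so that a
    polynomial in row i with exponents < e' becomes a form of degree j in u; its
    e'^k coefficients can be chosen, as polynomials in the other rows, so that
    this form vanishes on D.

    Dependence of the coordinates: if n + 1 coordinates were independent on X, an
    ultrafilter on X avoiding all the zero sets of polynomials in a maximal
    independent family would, through pseudo-divisions modulo the polynomials
    vanishing almost everywhere, yield a triangular system whose zeros form a
    submanifold of dimension > n inside X.

    Existence of s: otherwise F is smaller than every power of |x| along some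
    ultrafilter converging to 0 in X.  Weierstrass division and the Euclidean
    algorithm modulo such flat functions move the points, by less than any power
    of |x|, to exact zeros of F at which the polynomials deciding the distance
    to X (quantifier elimination) keep their signs; these zeros then lie on X. *)

(* The exceptional set of L must be algebraic, so it would not be enough that the bad L are nowhere
   dense, and D is known only as a set of limits: F(X) need not be semialgebraic. A count replaces
   dimension theory for D. No prescribed degree j is shown to work. With E = (k + 1) e', if every
   degree E, ..., 2E - 1 carried e'^k independent forms on D, their composites with F would be E
   e'^k functions whose Taylor polynomials span only O(E^n) dimensions on X; as n <= k, the first
   number wins for large e'. A linear relation between the Taylor polynomials, read in its lowest
   degree along a limit direction, is then contradictory.

   Ultrafilters replace curve selection. Along an ultrafilter a function that is not flat exceeds a
   power of |x|, and one that does not vanish almost everywhere is nonzero almost everywhere; so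
   flat germs and almost everywhere vanishing polynomials behave as prime ideals. Modulo such an
   ideal a polynomial of least degree acts as a minimal polynomial in characteristic 0, with
   derivative outside the ideal. Hence one Euclidean algorithm serves both the approximation by
   zeros and the triangular systems. *)
Require Import Defs.
From HB Require Import structures.
From mathcomp Require Import all_boot all_order all_algebra.
From mathcomp Require Import all_classical all_reals all_analysis.
From mathcomp Require Import perm.
From mathcomp Require mpoly ordered_qelim qe_rcf polyrcf.
From mathcomp Require Import ring lra zify.
Set Implicit Arguments.
Unset Strict Implicit.
Unset Printing Implicit Defensive.
Import (canonicals) mpoly.
Import Order.TTheory GRing.Theory Num.Theory.
Import numFieldNormedType.Exports.
Local Open Scope classical_set_scope.
Local Open Scope ring_scope.

(** * Absolutely convergent series *)

Section Series.
Context {R : realType}.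
Implicit Types (a b : nat -> R) (C : R).

(** [C] is any bound, not the sum, so that estimates pass through sums, products and rearrangements
    without computing a limit. *)
Definition absb a C := forall n, \sum_(0 <= i < n) `|a i| <= C.

Definition rs a : R := limn (series a).

Lemma absb_ge0 a C : absb a C -> 0 <= C.
Proof. by move=> /(_ 0%N); rewrite big_geq. Qed.

Lemma absb_le a b C C' : absb b C -> (forall i, `|a i| <= `|b i|) -> C <= C' ->
  absb a C'.
Proof.
move=> hb hab hC n; apply: (le_trans _ (le_trans (hb n) hC)).
by apply: ler_sum => i _; exact: hab.
Qed.

Lemma absb_cvg a C : absb a C -> cvgn (series a).
Proof.
move=> h; apply: (@normed_cvg R R^o).
apply: nondecreasing_is_cvgn.
  move=> m n mn; rewrite -subr_ge0 sub_series_geq //; apply: sumr_ge0 => k _ /=; exact: normr_ge0.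
by exists C => _ [n _ <-]; exact: h.
Qed.

Lemma rs_tail a C n : absb a C ->
  `|rs a - \sum_(0 <= i < n) a i| <= C - \sum_(0 <= i < n) `|a i|.
Proof.
move=> h; have hc := absb_cvg h.
set s := \sum_(0 <= i < n) a i.
have -> : rs a - s = limn (fun k => series a k - s).
  by apply/esym/cvg_lim => //; apply: cvgB; [exact: hc|exact: cvg_cst].
have hc' : cvgn (fun k => series a k - s).
  by apply: is_cvgB; [exact: hc|exact: is_cvg_cst].
rewrite -lim_norm //; apply: limr_le; first exact: is_cvg_norm.
exists n => // k /= nk; rewrite /series /= (big_cat_nat (n := n)) //= addrAC subrr add0r.
apply: (le_trans (ler_norm_sum _ _ _)).
by rewrite lerBrDl -big_cat_nat.
Qed.

Lemma rs_le a C : absb a C -> `|rs a| <= C.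
Proof. by move=> /rs_tail - /(_ 0%N); rewrite !big_geq // !subr0. Qed.

Lemma rs_uniq a s :
  (forall e, 0 < e -> exists n0, forall n, (n0 <= n)%N ->
     `|s - \sum_(0 <= i < n) a i| <= e) -> rs a = s.
Proof.
move=> h; apply/cvg_lim => //; apply/cvgrPdist_le => e e0.
by have [n0 hn0] := h e e0; exists n0 => // n /= /hn0.
Qed.

Lemma rs_cvg a C e : absb a C -> 0 < e -> exists n0, forall n, (n0 <= n)%N ->
  `|rs a - \sum_(0 <= i < n) a i| <= e.
Proof.
move=> /absb_cvg hc e0; have /cvgrPdist_le /(_ e e0) [n0 _ hn0] := hc.
by exists n0 => n n0n; exact: hn0.
Qed.

Lemma absb_tail a C e : absb a C -> 0 < e -> exists n0, forall n m, (n0 <= n)%N ->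
  \sum_(n <= i < m) `|a i| <= e.
Proof.
move=> h e0; have h' : absb (fun i => `|a i|) C by move=> n; under eq_bigr do rewrite normr_id.
have [n0 hn0] := rs_cvg h' e0; exists n0 => n m n0n.
have [nm|mn] := leqP n m; last by rewrite big_geq ?ltW //; apply: ltnW.
have := hn0 n n0n; apply: le_trans.
have hm : \sum_(0 <= i < m) `|a i| <= rs (fun i => `|a i|).
  apply: limr_ge; first exact: absb_cvg h'.
  exists m => // k /= mk; rewrite /series /= (big_cat_nat (n := m) (p := k)) //=.
  by rewrite lerDl sumr_ge0.
have -> : \sum_(n <= i < m) `|a i| = \sum_(0 <= i < m) `|a i| - \sum_(0 <= i < n) `|a i|.
  by rewrite [X in _ = X - _](big_cat_nat (n := n) (p := m)) //= addrAC subrr add0r.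
by apply: le_trans (ler_norm _); rewrite lerD2r.
Qed.

Lemma absbD a b C C' : absb a C -> absb b C' -> absb (fun i => a i + b i) (C + C').
Proof.
move=> ha hb n; apply: (le_trans _ (lerD (ha n) (hb n))).
by rewrite -big_split; apply: ler_sum => i _; exact: ler_normD.
Qed.

Lemma absbZ a C k : absb a C -> absb (fun i => k * a i) (`|k| * C).
Proof.
move=> ha n; under eq_bigr do rewrite normrM.
by rewrite -mulr_sumr ler_wpM2l.
Qed.

Lemma rsD a b C C' : absb a C -> absb b C' ->
  rs (fun i => a i + b i) = rs a + rs b.
Proof. by move=> /absb_cvg ha /absb_cvg hb; rewrite /rs -lim_seriesD. Qed.

Lemma rsZ a C k : absb a C -> rs (fun i => k * a i) = k * rs a.
Proof. by move=> /absb_cvg ha; rewrite /rs -[RHS]lim_seriesZ. Qed.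

Lemma rsN a C : absb a C -> rs (fun i => - a i) = - rs a.
Proof.
by move=> ha; rewrite -mulN1r -(rsZ _ ha); congr rs; apply/funext => i; rewrite mulN1r.
Qed.

Lemma sum_fin a n m : (forall i, (n <= i)%N -> a i = 0) -> (n <= m)%N ->
  \sum_(0 <= i < m) a i = \sum_(0 <= i < n) a i.
Proof.
move=> h nm; rewrite (big_cat_nat (n := n)) //= [X in _ + X]big_nat_cond.
by rewrite [X in _ + X]big1 ?addr0 // => i /andP[/andP[ni _] _]; exact: h.
Qed.

Lemma rs_fin a n : (forall i, (n <= i)%N -> a i = 0) -> rs a = \sum_(0 <= i < n) a i.
Proof.
move=> h; apply: rs_uniq => e e0; exists n => m nm.
by rewrite (sum_fin h nm) subrr normr0 ltW.
Qed.

Lemma absb_fin a n : (forall i, (n <= i)%N -> a i = 0) ->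
  absb a (\sum_(0 <= i < n) `|a i|).
Proof.
move=> h m; have [nm|mn] := leqP n m.
  by rewrite (sum_fin _ nm) // => i /h ->; rewrite normr0.
by rewrite (big_cat_nat (n := m) (p := n)) //= ?(ltnW mn) // lerDl sumr_ge0.
Qed.

Lemma sum_shift (f : nat -> R) n k :
  \sum_(n <= i < k) f i = \sum_(0 <= i < k - n) f (n + i)%N.
Proof.
by rewrite -{1}[n]add0n big_addn; apply: eq_bigr => i _; rewrite addnC.
Qed.

Lemma absb_shift a C n : absb a C ->
  absb (fun i => a (n + i)%N) (C - \sum_(0 <= i < n) `|a i|).
Proof.
move=> h m; rewrite lerBrDl.
have := h (n + m)%N; rewrite (big_cat_nat (n := n)) //= ?leq_addr //.
by rewrite (sum_shift (fun i => `|a i|) n) addKn.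
Qed.

Lemma rs_split a C n : absb a C ->
  rs a = \sum_(0 <= i < n) a i + rs (fun i => a (n + i)%N).
Proof.
move=> h; apply: rs_uniq => e e0.
have [m0 hm0] := rs_cvg (absb_shift n h) e0; exists (n + m0)%N => k hk.
rewrite (big_cat_nat (n := n) (p := k)) //=; last by apply: leq_trans hk; rewrite leq_addr.
rewrite opprD addrACA subrr add0r (sum_shift _ n).
by apply: hm0; rewrite leq_subRL //; apply: leq_trans hk; rewrite leq_addr.
Qed.

Lemma rs_unshift a C n : absb a C ->
  absb (fun i => if (n <= i)%N then a (i - n)%N else 0) C /\
  rs (fun i => if (n <= i)%N then a (i - n)%N else 0) = rs a.
Proof.
move=> h; set b := fun i => _.
have b0 : \sum_(0 <= i < n) `|b i| = 0.
  by rewrite big_nat big1 // => i /andP[_ lt_in]; rewrite /b leqNgt lt_in normr0.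
have hb : absb b C.
  move=> m; have [mn|nm] := leqP m n.
    apply: le_trans (absb_ge0 h); rewrite -[X in _ <= X]b0 [leRHS](big_cat_nat (n := m) (p := n)) //=.
    by rewrite lerDl sumr_ge0.
  rewrite (big_cat_nat (n := n)) ?(ltnW nm) //= b0 add0r (sum_shift (fun i => `|b i|) n).
  apply: le_trans (h (m - n)%N); apply: ler_sum => i _.
  by rewrite /b leq_addr addKn.
split => //; rewrite (rs_split n hb) [X in X + _]big_nat big1 ?add0r.
  by congr rs; apply/funext => i; rewrite /b leq_addr addKn.
by move=> i /andP[_ lt_in]; rewrite /b leqNgt lt_in.
Qed.

(** Fubini for a double series whose rows have summable bounds [M k]. It is behind the closure of
    power series under sums, products and substitutions. *)
Lemma rs_exch (a : nat -> nat -> R) (M : nat -> R) C :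
  (forall k, absb (a k) (M k)) -> absb M C ->
  [/\ forall j, absb (fun k => a k j) C,
      absb (fun j => rs (fun k => a k j)) C &
      rs (fun k => rs (a k)) = rs (fun j => rs (fun k => a k j))].
Proof.
move=> ha hM.
have M0 k : 0 <= M k by exact: absb_ge0 (ha k).
have hMC n : \sum_(0 <= k < n) M k <= C.
  by apply: le_trans (hM n); apply: ler_sum => k _; rewrite ger0_norm.
have hcol j : absb (fun k => a k j) C.
  move=> n; apply: le_trans (hMC n); apply: ler_sum => k _.
  by apply: le_trans (ha k j.+1); rewrite big_nat_recr //= lerDr sumr_ge0.
have hrow : absb (fun k => rs (a k)) C.
  move=> n; apply: le_trans (hMC n); apply: ler_sum => k _; exact: rs_le.
have abs0 n : absb (fun k => \sum_(0 <= j < n) `|a k j|) C.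
  move=> m; apply: le_trans (hMC m); apply: ler_sum => k _.
  by rewrite ger0_norm ?sumr_ge0 //; exact: ha.
have rs_sum n : rs (fun k => \sum_(0 <= j < n) a k j)
              = \sum_(0 <= j < n) rs (fun k => a k j).
  have absn m : absb (fun k => \sum_(0 <= j < m) a k j) C.
    apply: (absb_le (abs0 m)) => // k; rewrite [leRHS]ger0_norm ?sumr_ge0 //.
    exact: ler_norm_sum.
  elim: n => [|n IH].
    by rewrite big_geq // (@rs_fin _ 0) ?big_geq // => i _; rewrite big_geq.
  rewrite big_nat_recr //= -IH -(rsD (absn n) (hcol n)); congr rs; apply/funext => k.
  by rewrite big_nat_recr.
have hout : absb (fun j => rs (fun k => a k j)) C.
  move=> n.
  (* The signs of the column sums turn a sum of absolute values into a single sum over the rows, to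
     which the row bounds apply. *)
  have h1 : \sum_(0 <= j < n) `|rs (fun k => a k j)|
      = rs (fun k => \sum_(0 <= j < n) Num.sg (rs (fun k => a k j)) * a k j).
    elim: n => [|n IH].
      by rewrite big_geq // (@rs_fin _ 0) ?big_geq // => i _; rewrite big_geq.
    rewrite big_nat_recr //= IH.
    have -> : `|rs (fun k => a k n)| = rs (fun k => Num.sg (rs (fun k => a k n)) * a k n).
      by rewrite (rsZ _ (hcol n)) [LHS]normrEsg.
    rewrite -(@rsD _ _ C (`|Num.sg (rs (fun k => a k n))| * C)).
    - by congr rs; apply/funext => k; rewrite big_nat_recr.
    - apply: (absb_le (abs0 n)) => // k; rewrite [leRHS]ger0_norm ?sumr_ge0 //.
      apply: (le_trans (ler_norm_sum _ _ _)); apply: ler_sum => j _.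
      by rewrite normrM ler_piMl // normr_sg; case: eqP.
    - exact: absbZ.
  rewrite h1; apply: (le_trans (ler_norm _)); apply: rs_le.
  apply: (absb_le (abs0 n)) => // k; rewrite [leRHS]ger0_norm ?sumr_ge0 //.
  apply: (le_trans (ler_norm_sum _ _ _)); apply: ler_sum => j _.
  by rewrite normrM ler_piMl // normr_sg; case: eqP.
split => //; apply/esym/rs_uniq => e e0.
(* Rows from [K] on cost at most [e / 2] by the tail of [M]; the first [K] rows share the other
   half, and dividing by [K.+1] covers [K = 0]. *)
have e20 : 0 < e / 2 by lra.
have [K hK] := absb_tail hM e20.
have e3 : 0 < e / 2 / K.+1%:R by rewrite divr_gt0.
have [n0 hn0] : exists n0, forall n, (n0 <= n)%N -> forall k, (k < K)%N ->
    `|rs (a k) - \sum_(0 <= j < n) a k j| <= e / 2 / K.+1%:R.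
  have H k : exists n0, forall n, (n0 <= n)%N ->
    `|rs (a k) - \sum_(0 <= j < n) a k j| <= e / 2 / K.+1%:R := rs_cvg (ha k) e3.
  have [N hN] := choice H; exists (\max_(k < K) N k)%N => n hn k kK.
  by apply: hN; apply: leq_trans hn; rewrite (leq_bigmax (Ordinal kK)).
exists n0 => n hn; rewrite -rs_sum.
have hD k : `|rs (a k) - \sum_(0 <= j < n) a k j| <= M k.
  by apply: (le_trans (rs_tail n (ha k))); rewrite lerBlDr lerDl sumr_ge0.
have absn : absb (fun k => - \sum_(0 <= j < n) a k j) C.
  apply: (absb_le (abs0 n)) => // k; rewrite [leRHS]ger0_norm ?sumr_ge0 // normrN.
  exact: ler_norm_sum.
have absn' : absb (fun k => \sum_(0 <= j < n) a k j) C.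
  by apply: (absb_le absn) => // k; rewrite normrN.
rewrite -(rsN absn') -(rsD hrow absn); apply: rs_le => m.
have [mK|Km] := leqP m K.
  apply: (@le_trans _ _ (\sum_(0 <= i < m) (e / 2 / K.+1%:R))).
    rewrite big_nat [leRHS]big_nat; apply: ler_sum => i /andP[_ im]; apply: hn0 => //.
    exact: leq_trans mK.
  rewrite sumr_const_nat subn0 -[leLHS]mulr_natr -mulrA.
  have : K.+1%:R^-1 * m%:R <= 1 :> R.
    by rewrite mulrC ler_pdivrMr // mul1r ler_nat leqW.
  by move=> h; apply: (@le_trans _ _ (e / 2)); [rewrite -[leRHS]mulr1 ler_wpM2l // ltW | lra].
rewrite (big_cat_nat (n := K)) ?(ltnW Km) //=.
have -> : e = e / 2 + e / 2 by lra.
apply: lerD.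
  apply: (@le_trans _ _ (\sum_(0 <= i < K) (e / 2 / K.+1%:R))).
    by rewrite big_nat [leRHS]big_nat; apply: ler_sum => i /andP[_ im]; apply: hn0.
  rewrite sumr_const_nat subn0 -[leLHS]mulr_natr -mulrA.
  have : K.+1%:R^-1 * K%:R <= 1 :> R.
    by rewrite mulrC ler_pdivrMr // mul1r ler_nat leqW.
  by move=> h; apply: (@le_trans _ _ (e / 2)); [rewrite -[leRHS]mulr1 ler_wpM2l // ltW | lra].
apply: le_trans (hK K m (leqnn K)); apply: ler_sum => k _.
by rewrite [leRHS]ger0_norm //; exact: hD.
Qed.

(** Row k is [a k] times [b] shifted by k places, so that the sum of column n is the n-th
    coefficient of the product and [rs_exch] applies. *)
Lemma rs_cauchy a b C C' : absb a C -> absb b C' ->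
  absb (fun n => \sum_(0 <= i < n.+1) a i * b (n - i)%N) (C * C') /\
  rs (fun n => \sum_(0 <= i < n.+1) a i * b (n - i)%N) = rs a * rs b.
Proof.
move=> ha hb.
pose c k n := a k * (if (k <= n)%N then b (n - k)%N else 0).
have hc k : absb (c k) (`|a k| * C') by apply: absbZ; have [] := rs_unshift k hb.
have hM : absb (fun k => `|a k| * C') (C * C').
  move=> n; have C'0 := absb_ge0 hb.
  rewrite (eq_bigr (fun i => `|a i| * C')); last by move=> i _; rewrite ger0_norm ?mulr_ge0.
  by rewrite -mulr_suml ler_wpM2r.
have [_ h2 h3] := rs_exch hc hM.
have E : (fun n => \sum_(0 <= i < n.+1) a i * b (n - i)%N) = (fun j => rs (fun k => c k j)).
  apply/funext => n; rewrite (@rs_fin _ n.+1); last first.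
    by move=> i ni; rewrite /c leqNgt ni mulr0.
  rewrite big_nat [RHS]big_nat; apply: eq_bigr => i /andP[_ ini].
  by rewrite /c -ltnS ini.
rewrite E; split => //; rewrite -h3 mulrC -(rsZ _ ha); congr rs; apply/funext => k.
have [u1 u2] := rs_unshift k hb.
by rewrite /c (rsZ _ u1) u2 mulrC.
Qed.

End Series.

(** * Convergent power series *)

Section AnalyticClass.
Context {R : realType}.
Implicit Types (f g : (nat -> R) -> R) (r x : nat -> R) (C : R) (N : nat).

(* Points are sequences, of which a function of N variables only reads the first
   N entries, so that inductions may change N without changing types. *)
Definition pd N r x := forall i, (i < N)%N -> `|x i| <= r i.

(* C bounds the sum of the absolute values of the terms on the polydisc of radii r;
   the expansion is in the last variable, with coefficients of the same kind. *)
Fixpoint An N r C f {struct N} : Prop :=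
  if N is n.+1 then
    exists (a : nat -> (nat -> R) -> R) (M : nat -> R),
      [/\ forall j, An n r (M j) (a j),
          absb (fun j => M j * r n ^+ j) C &
          forall x, pd n.+1 r x -> f x = rs (fun j => a j x * x n ^+ j)]
  else exists c, `|c| <= C /\ forall x, f x = c.

Lemma AnS N r C f : An N.+1 r C f ->
  exists (a : nat -> (nat -> R) -> R) (M : nat -> R),
    [/\ forall j, An N r (M j) (a j), absb (fun j => M j * r N ^+ j) C &
        forall x, pd N.+1 r x -> f x = rs (fun j => a j x * x N ^+ j)].
Proof. by []. Qed.

Lemma absb_rs (a : nat -> R) C : absb a C -> (forall i, 0 <= a i) -> absb a (rs a).
Proof.
move=> h a0 n; rewrite (eq_bigr a); last by move=> i _; rewrite ger0_norm.
rewrite (rs_split n h) lerDl; apply: limr_ge; first exact: absb_cvg (absb_shift n h).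
by exists 0%N => // m _; apply: sumr_ge0 => i _.
Qed.

Lemma pdS N r x : pd N.+1 r x -> pd N r x.
Proof. by move=> h i iN; apply: h; apply: ltnW. Qed.

Lemma An_ge0 N r C f : An N r C f -> 0 <= C.
Proof.
case: N => [[c [h _]]|N [a [M [_ h _]]]]; first exact: le_trans h.
exact: absb_ge0 h.
Qed.

Lemma An_ext N r C f g : An N r C f -> (forall x, pd N r x -> f x = g x) -> An N r C g.
Proof.
case: N => [[c [h1 h2]]|N [a [M [h1 h2 h3]]]] h.
  by exists c; split => // x; rewrite -h.
by exists a, M; split => // x hx; rewrite -h // h3.
Qed.

Lemma An_le N r C C' f : An N r C f -> C <= C' -> An N r C' f.
Proof.
case: N => [[c [h1 h2]]|N [a [M [h1 h2 h3]]]] h.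
  by exists c; split => //; apply: le_trans h1 h.
by exists a, M; split => // n; apply: le_trans (h2 n) h.
Qed.

Section FixedRadius.
Context (r : nat -> R) (r0 : forall i, 0 < r i).

Lemma An_bound N C f x : An N r C f -> pd N r x -> `|f x| <= C.
Proof.
elim: N C f => [|N IH] C f; first by move=> [c [h1 h2]] _; rewrite h2.
move=> /AnS[a [M [h1 h2 h3]]] hx; rewrite h3 //; apply: rs_le.
apply: (absb_le h2) => // j; rewrite normrM [leRHS]normrM; apply: ler_pM => //.
  by apply: le_trans (ler_norm _); apply: IH => //; exact: pdS hx.
by rewrite !normrX; apply: lerXn2r; rewrite ?nnegrE //= (le_trans (hx N (ltnSn _))) // ler_norm.
Qed.

Lemma An_term N C (a : nat -> (nat -> R) -> R) (M : nat -> R) x :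
  (forall j, An N r (M j) (a j)) -> absb (fun j => M j * r N ^+ j) C ->
  pd N.+1 r x -> absb (fun j => a j x * x N ^+ j) C.
Proof.
move=> h1 h2 hx; apply: (absb_le h2) => // j.
rewrite normrM [leRHS]normrM; apply: ler_pM => //.
  by apply: le_trans (ler_norm _); apply: An_bound => //; exact: pdS hx.
by rewrite !normrX; apply: lerXn2r; rewrite ?nnegrE //= (le_trans (hx N (ltnSn _))) // ler_norm.
Qed.

(** The hypothesis on the zero function breaks a circularity: [An_0] is itself derived from this
    lemma, through [An_cst]. *)
Lemma An_low0 N C f : An N r C f -> An N r 0 (fun=> 0) -> An N.+1 r C f.
Proof.
move=> h h0; exists (fun j => if j is 0 then f else fun=> 0), (fun j => if j is 0 then C else 0).
have C0 := An_ge0 h.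
split; first by case.
  apply: (absb_le (b := fun j => if j is 0 then C else 0) (C := C)) => //.
    have := @absb_fin _ (fun j => if j is 0 then C else 0) 1.
    by rewrite big_nat1 ger0_norm //; apply; case.
  by case=> [|j]; rewrite ?expr0 ?mulr1 ?mul0r.
move=> x _; rewrite (@rs_fin _ _ 1); last by case=> // j _; rewrite mul0r.
by rewrite big_nat1 expr0 mulr1.
Qed.

Lemma An_cst N c : An N r `|c| (fun=> c).
Proof.
suff H d : An N r `|d| (fun=> d) by exact: H.
elim: N d => [|N IH] d; first by exists d.
by apply: An_low0 => //; have := IH 0; rewrite normr0.
Qed.

Lemma An_0 N : An N r 0 (fun=> 0).
Proof. by rewrite -[X in An _ _ X _](@normr0 _ R); exact: An_cst. Qed.

Lemma An_low N C f : An N r C f -> An N.+1 r C f.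
Proof. by move=> h; apply: An_low0 => //; exact: An_0. Qed.

Lemma An_shift N C f i : An N.+1 r C f ->
  An N.+1 r (r N ^+ i * C) (fun x => x N ^+ i * f x).
Proof.
move=> /AnS[a [M [h1 h2 h3]]].
exists (fun j => if (i <= j)%N then a (j - i)%N else fun=> 0),
       (fun j => if (i <= j)%N then M (j - i)%N else 0); split.
- by move=> j; case: leqP => _ //; exact: An_0.
- have h4 : absb (fun j => r N ^+ i * (M j * r N ^+ j)) (r N ^+ i * C).
    by have := absbZ (r N ^+ i) h2; rewrite ger0_norm // exprn_ge0 // ltW.
  have [h5 _] := rs_unshift i h4.
  apply: (absb_le h5) => // j; case: leqP => ij; last by rewrite mul0r.
  by rewrite mulrCA -exprD subnKC.
move=> x hx; rewrite h3 //.
have h4 := An_term h1 h2 hx.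
rewrite -(rsZ _ h4); have [_ <-] := rs_unshift i (absbZ (x N ^+ i) h4).
congr rs; apply/funext => j; case: leqP => ij; last by rewrite mul0r.
by rewrite mulrCA -exprD subnKC.
Qed.

(** Each coefficient of the sum is again a series of functions, of one variable less. The column
    bounds of [rs_exch], divided by [r N ^+ j], make the induction hypothesis apply to it. *)
Lemma An_sumn N (C : nat -> R) (f : nat -> (nat -> R) -> R) D :
  (forall k, An N r (C k) (f k)) -> absb C D ->
  An N r D (fun x => rs (fun k => f k x)).
Proof.
elim: N C f D => [|N IH] C f D h hC.
  have [c hc] := choice h; exists (rs c); split.
    apply: rs_le; apply: (absb_le hC) => // i.
    by apply: le_trans (ler_norm _); have [] := hc i.
  by move=> x; congr rs; apply/funext => k; have [_ ->] := hc k.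
have H k : exists aM : (nat -> (nat -> R) -> R) * (nat -> R),
   [/\ forall j, An N r (aM.2 j) (aM.1 j), absb (fun j => aM.2 j * r N ^+ j) (C k) &
       forall x, pd N.+1 r x -> f k x = rs (fun j => aM.1 j x * x N ^+ j)].
  by have [a [M hM]] := AnS (h k); exists (a, M).
have [aM haM] := choice H.
pose a k j := (aM k).1 j; pose M k j := (aM k).2 j.
have h1 k j : An N r (M k j) (a k j) by have [hh _ _] := haM k; exact: hh.
have h2 k : absb (fun j => M k j * r N ^+ j) (C k) by have [] := haM k.
have M0 k j : 0 <= M k j by exact: An_ge0 (h1 k j).
have [hcol hrow _] := rs_exch h2 hC.
have hMj j : absb (fun k => M k j) ((r N ^+ j)^-1 * D).
  have rj0 : 0 < r N ^+ j by rewrite exprn_gt0.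
  have := absbZ (r N ^+ j)^-1 (hcol j); rewrite gtr0_norm ?invr_gt0 // => hh.
  by apply: (absb_le hh) => // k; rewrite mulrC mulfK // gt_eqF.
exists (fun j x => rs (fun k => a k j x)), (fun j => rs (fun k => M k j)); split.
- by move=> j; apply: IH (h1 ^~ j) _; apply: absb_rs (hMj j) _.
- apply: (absb_le hrow) => // j; rewrite mulrC -(rsZ _ (hMj j)).
  by rewrite [X in _ <= `|X|](_ : _ = rs (fun k => r N ^+ j * M k j)) //; congr rs; apply/funext => k; rewrite mulrC.
move=> x hx.
have h4 k : absb (fun j => a k j x * x N ^+ j) (C k) := An_term (h1 k) (h2 k) hx.
have [_ _ h5] := rs_exch h4 hC.
transitivity (rs (fun k => rs (fun j => a k j x * x N ^+ j))).
  by congr rs; apply/funext => k; have [_ _ ->] := haM k.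
rewrite h5; congr rs; apply/funext => j.
have h6 : absb (fun k => a k j x) ((r N ^+ j)^-1 * D).
  apply: (absb_le (hMj j)) => // k; apply: le_trans (ler_norm _).
  by apply: An_bound => //; exact: pdS hx.
by rewrite [RHS]mulrC -(rsZ _ h6); congr rs; apply/funext => k; rewrite mulrC.
Qed.

Lemma An_add N C C' f g : An N r C f -> An N r C' g ->
  An N r (C + C') (fun x => f x + g x).
Proof.
move=> hf hg.
pose h k := if k is 0 then f else if k is 1 then g else fun=> 0.
pose D k := if k is 0 then C else if k is 1 then C' else 0.
have H : An N r (C + C') (fun x => rs (fun k => h k x)).
  apply: (@An_sumn N D); first by case=> [|[|k]] //; exact: An_0.
  have := @absb_fin _ D 2; rewrite big_nat_recr //= big_nat1 /=.
  by rewrite ger0_norm ?(An_ge0 hf) // ger0_norm ?(An_ge0 hg) //; apply; case=> [|[]].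
apply: (An_ext H) => x _; rewrite (@rs_fin _ _ 2); last by case=> [|[]].
by rewrite big_nat_recr //= big_nat1.
Qed.

Lemma An_mul N C C' f g : An N r C f -> An N r C' g ->
  An N r (C * C') (fun x => f x * g x).
Proof.
elim: N C C' f g => [|N IH] C C' f g.
  move=> [c [c1 c2]] [d [d1 d2]]; exists (c * d); split; last by move=> x; rewrite c2 d2.
  by rewrite normrM ler_pM.
move=> /AnS[a [M [h1 h2 h3]]] hg.
have low D D' u v : An N r D u -> An N.+1 r D' v -> An N.+1 r (D * D') (fun x => u x * v x).
  move=> hu /AnS[b [L [k1 k2 k3]]]; exists (fun j x => u x * b j x), (fun j => D * L j); split.
  - by move=> j; exact: IH.
  - have := absbZ D k2; rewrite ger0_norm ?(An_ge0 hu) // => hh.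
    by apply: (absb_le hh) => // j; rewrite mulrA.
  by move=> x hx; rewrite k3 // -(rsZ _ (An_term k1 k2 hx)); congr rs; apply/funext => j; rewrite mulrA.
have C'0 := An_ge0 hg.
have H : An N.+1 r (C * C') (fun x => rs (fun i => x N ^+ i * (a i x * g x))).
  apply: (@An_sumn N.+1 (fun i => r N ^+ i * (M i * C'))).
    by move=> i; apply: An_shift; exact: low.
  have := absbZ C' h2; rewrite ger0_norm // mulrC => hh.
  by apply: (absb_le hh) => // j; rewrite !normrM; nra.
apply: (An_ext H) => x hx; rewrite h3 // mulrC -(rsZ _ (An_term h1 h2 hx)).
by congr rs; apply/funext => i; ring.
Qed.

Lemma An_opp N C f : An N r C f -> An N r C (fun x => - f x).
Proof.
move=> h; have := An_mul (An_cst N (-1)) h; rewrite normrN1 mul1r => hh.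
by apply: (An_ext hh) => x _; rewrite mulN1r.
Qed.

Lemma An_exp N C f j : An N r C f -> An N r (C ^+ j) (fun x => f x ^+ j).
Proof.
move=> h; elim: j => [|j IH].
  by have := An_cst N 1; rewrite normr1 expr0 => hh; apply: (An_ext hh) => x _; rewrite expr0.
by rewrite exprS; apply: (An_ext (An_mul h IH)) => x _; rewrite exprS.
Qed.

Lemma An_proj N i : (i < N)%N -> An N r (r i) (fun x => x i).
Proof.
elim: N => // N IH; rewrite ltnS leq_eqVlt => /orP[/eqP ->|iN]; last exact/An_low/IH.
have := An_shift 1 (An_cst N.+1 1); rewrite expr1 normr1 mulr1 => hh.
by apply: (An_ext hh) => x _; rewrite expr1 mulr1.
Qed.

Lemma An_sum (I : Type) (s : seq I) N (C : I -> R) (f : I -> (nat -> R) -> R) :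
  (forall i, An N r (C i) (f i)) ->
  An N r (\sum_(i <- s) C i) (fun x => \sum_(i <- s) f i x).
Proof.
move=> h; elim: s => [|i s IH].
  by rewrite big_nil; apply: (An_ext (An_0 N)) => x _; rewrite big_nil.
by rewrite big_cons; apply: (An_ext (An_add (h i) IH)) => x _; rewrite big_cons.
Qed.

End FixedRadius.

(** Since [C] bounds the sum of the absolute values of all terms, it survives the replacement of
    each variable by a series whose bound is the old radius. *)
Lemma An_comp N N' r r' C f (l : nat -> (nat -> R) -> R) :
  (forall i, 0 < r i) -> (forall i, 0 < r' i) -> An N r C f ->
  (forall i, (i < N)%N -> An N' r' (r i) (l i)) ->
  An N' r' C (fun x => f (fun i => l i x)).
Proof.
move=> r0 r'0; elim: N C f => [|N IH] C f.
  by move=> [c [h1 h2]] _; apply: (An_ext (An_le (An_cst r' N' c) h1)) => x _; rewrite h2.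
move=> /AnS[a [M [h1 h2 h3]]] hl.
have H : An N' r' C (fun x => rs (fun j => a j (fun i => l i x) * l N x ^+ j)).
  apply: (@An_sumn _ r'0 N' (fun j => M j * r N ^+ j)) => // j.
  apply: An_mul => //; last by apply: An_exp => //; exact: hl.
  by apply: IH => // i iN; apply: hl; exact: ltnW.
apply: (An_ext H) => x hx; rewrite h3 // => i iN.
by exact: An_bound (hl i iN) hx.
Qed.

Lemma An_shrink N r r' C f : (forall i, 0 < r i) -> (forall i, 0 < r' i) ->
  (forall i, (i < N)%N -> r' i <= r i) -> An N r C f -> An N r' C f.
Proof.
move=> r0 r'0 hr hf.
apply: (An_ext (An_comp (l := fun i x => x i) r0 r'0 hf _)) => // i iN.
by apply: (An_le (An_proj r'0 iN)); exact: hr.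
Qed.

Lemma An_dep N r C f x y : An N r C f -> (forall i, (i < N)%N -> x i = y i) ->
  pd N r x -> f x = f y.
Proof.
elim: N C f => [|N IH] C f; first by move=> [c [_ h]] _ _; rewrite !h.
move=> /AnS[a [M [h1 h2 h3]]] hxy hx.
have hy : pd N.+1 r y by move=> i iN; rewrite -hxy //; exact: hx.
rewrite !h3 //; congr rs; apply/funext => j; rewrite hxy //.
by rewrite (IH _ _ (h1 j)) // => [i iN|]; [apply: hxy; exact: ltnW|exact: pdS hx].
Qed.

(** Without its constant term a series has only terms of positive degree, and each of them gains a
    factor [k] when the radii shrink. The smallness of germs vanishing at 0 comes from here. *)
Lemma An_shrink0 N r C f k : (forall i, 0 < r i) -> 0 < k <= 1 -> An N r C f ->
  An N (fun i => k * r i) (k * C) (fun x => f x - f (fun=> 0)).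
Proof.
move=> r0 /andP[k0 k1].
have r'0 i : 0 < k * r i by rewrite mulr_gt0.
have r'r i : k * r i <= r i by rewrite ler_piMl // ltW.
elim: N C f => [|N IH] C f.
  move=> [c [h1 h2]]; exists 0; split; last by move=> x; rewrite !h2 subrr.
  by rewrite normr0 mulr_ge0 ?(ltW k0) // (le_trans _ h1).
move=> /AnS[a [M [h1 h2 h3]]].
have M0 j : 0 <= M j by exact: An_ge0 (h1 j).
have f0 : f (fun=> 0) = a 0%N (fun=> 0).
  rewrite h3; last by move=> i _; rewrite normr0 ltW.
  rewrite (@rs_fin _ _ 1); last by case=> // j _; rewrite expr0n mulr0.
  by rewrite big_nat1 expr0 mulr1.
exists (fun j => if j is 0 then fun x => a 0%N x - a 0%N (fun=> 0) else a j),
       (fun j => if j is 0 then k * M 0%N else M j); split.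
- by case=> [|j]; [exact: IH|apply: (@An_shrink _ r)].
- have := absbZ k h2; rewrite gtr0_norm // => hh.
  apply: (absb_le hh) => // -[|j]; first by rewrite !expr0 !mulr1.
  rewrite !normrM !normrX !normrM (gtr0_norm k0) exprMn.
  have : k ^+ j.+1 <= k by rewrite exprS ler_piMr ?(ltW k0) // exprn_ile1 // ltW.
  have : 0 <= `|M j.+1| * `|r N| ^+ j.+1 by rewrite mulr_ge0 // exprn_ge0.
  set u := _ ^+ _; set v := k ^+ _; set w := `|M _| => hu hv; nra.
move=> x hx.
have hx' : pd N.+1 r x by move=> i iN; apply: le_trans (hx i iN) (r'r i).
rewrite f0 h3 //; have ha := An_term h1 h2 hx'.
set b := fun j => _.
have hb : absb (fun j => if j is 0 then - a 0%N (fun=> 0) else 0) `|a 0%N (fun=> 0)|.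
  have := @absb_fin _ (fun j => if j is 0 then - a 0%N (fun=> 0) else 0) 1.
  by rewrite big_nat1 normrN; apply; case.
transitivity (rs b + rs (fun j => if j is 0 then - a 0%N (fun=> 0) else 0)).
  by congr (_ + _); rewrite (@rs_fin _ _ 1) ?big_nat1 //; case.
rewrite -(rsD ha hb); congr rs; apply/funext => -[|j]; rewrite /b /= ?addr0 //.
by rewrite !expr0 !mulr1.
Qed.

End AnalyticClass.

(** * Weierstrass division *)

Section Weierstrass.
Context {R : realType}.
Implicit Types (r x : nat -> R) (C : R) (N b : nat).

Lemma rs_sumn (a : nat -> nat -> R) (C : nat -> R) n : (forall i, absb (a i) (C i)) ->
  absb (fun k => \sum_(0 <= i < n) a i k) (\sum_(0 <= i < n) C i) /\
  rs (fun k => \sum_(0 <= i < n) a i k) = \sum_(0 <= i < n) rs (a i).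
Proof.
move=> h; elim: n => [|n [IH1 IH2]].
  rewrite !big_geq // (_ : (fun k => _) = fun=> 0) /=; last first.
    by apply/funext => k; rewrite big_geq.
  split; first by move=> n; rewrite big1 // => i _; rewrite normr0.
  by rewrite (@rs_fin _ _ 0) // big_geq.
have E : (fun k => \sum_(0 <= i < n.+1) a i k)
       = (fun k => (\sum_(0 <= i < n) a i k) + a n k).
  by apply/funext => k; rewrite big_nat_recr.
rewrite E !big_nat_recr //=; split; first exact: absbD.
by rewrite (rsD IH1 (h n)) IH2.
Qed.

Lemma absb_geo4 C : 0 <= C -> absb (fun k => (1 / 4) ^+ k * C) (2 * C).
Proof.
move=> C0; suff H n : \sum_(0 <= k < n) `|(1 / 4) ^+ k * C| <= 2 * C - 2 * ((1 / 4) ^+ n * C).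
  by move=> n; apply: le_trans (H n) _; rewrite gerBl mulr_ge0 // mulr_ge0 // exprn_ge0.
elim: n => [|n IH]; first by rewrite big_geq // expr0 mul1r subrr.
rewrite big_nat_recr //= ger0_norm; last by rewrite mulr_ge0 // exprn_ge0.
rewrite exprS; set u := (1 / 4) ^+ n * C in IH *.
have u0 : 0 <= u by rewrite mulr_ge0 // exprn_ge0.
rewrite -mulrA -/u; lra.
Qed.

Lemma absb_shift' (a : nat -> R) C n : absb a C -> absb (fun i => a (n + i)%N) C.
Proof.
by move=> h m; apply: le_trans (absb_shift n h m) _; rewrite gerBl sumr_ge0.
Qed.

Section Core.
Context (N : nat) (r : nat -> R) (r0 : forall i, 0 < r i).

(** These are the coefficients of index at least [b] in the product of the series [q] and [h]: the
    product, without its low terms, divided by the [b]-th power of the variable. *)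
Lemma division_step b (q h : nat -> (nat -> R) -> R) (Q H : nat -> R) B B' :
  (forall j, An N r (Q j) (q j)) -> absb (fun j => Q j * r N ^+ j) B ->
  (forall j, An N r (H j) (h j)) -> absb (fun j => H j * r N ^+ j) B' ->
  (forall j, An N r (\sum_(0 <= i < (b + j).+1) Q i * H (b + j - i)%N)
      (fun x => \sum_(0 <= i < (b + j).+1) q i x * h (b + j - i)%N x)) /\
  absb (fun j => (\sum_(0 <= i < (b + j).+1) Q i * H (b + j - i)%N) * r N ^+ j)
    (r N ^- b * (B * B')).
Proof.
move=> hq hQ hh hH; split.
  move=> j; apply: (@An_sum _ r r0 nat (index_iota 0 (b + j).+1) N
    (fun i => Q i * H (b + j - i)%N) (fun i x => q i x * h (b + j - i)%N x)) => i.
  exact: An_mul.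
have rb0 : 0 < r N ^- b by rewrite invr_gt0 exprn_gt0.
have [hP _] := rs_cauchy hQ hH.
have := absbZ (r N ^- b) (absb_shift' b hP); rewrite gtr0_norm // => hE.
apply: (absb_le hE) => // j.
rewrite [leRHS](_ : _ = `|(\sum_(0 <= i < (b + j).+1) Q i * H (b + j - i)%N) * r N ^+ j|) //.
congr `|_|; rewrite mulr_suml mulr_sumr !big_nat; apply: eq_bigr => i /andP[_ ij].
have e : r N ^+ i * r N ^+ (b + j - i) = r N ^+ b * r N ^+ j.
  by rewrite -!exprD subnKC // -ltnS.
rewrite mulrACA e [LHS](_ : _ = (r N ^+ b)^-1 * r N ^+ b * (Q i * H (b + j - i)%N * r N ^+ j)); last by ring.
by rewrite mulVf ?mul1r // expf_neq0 // gt_eqF.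
Qed.

(** The quotient solves q = S f - S (q h), where S drops the first b coefficients and shifts the
    others down. The bound on h makes q -> S (q h) a contraction of factor 1/4, so the Neumann
    series converges to a sum bounded by twice the bound of its first term. The last conclusion,
    closeness of q to S f, later keeps a quotient away from 0. *)
Lemma division_coefs b (h f : nat -> (nat -> R) -> R) (H Mf : nat -> R) Cf :
  (forall j, An N r (H j) (h j)) -> absb (fun j => H j * r N ^+ j) (r N ^+ b / 4) ->
  (forall j, An N r (Mf j) (f j)) -> absb (fun j => Mf j * r N ^+ j) Cf ->
  exists (q : nat -> (nat -> R) -> R) (Q : nat -> R),
    [/\ forall j, An N r (Q j) (q j),
        absb (fun j => Q j * r N ^+ j) (2 * (r N ^- b * Cf)),
        forall x, pd N r x -> forall j,
          f (b + j)%N x = q j x + \sum_(0 <= i < (b + j).+1) q i x * h (b + j - i)%N x &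
        forall x, pd N r x ->
          absb (fun j => (f (b + j)%N x - q j x) * r N ^+ j) (r N ^- b * Cf / 2)].
Proof.
move=> hh hH hf hMf.
have rb0 : 0 < r N ^- b by rewrite invr_gt0 exprn_gt0.
have rb1 : r N ^- b * r N ^+ b = 1 by rewrite mulVf // expf_neq0 // gt_eqF.
set B0 := r N ^- b * Cf.
have B00 : 0 <= B0 by rewrite mulr_ge0 ?(ltW rb0) // (absb_ge0 hMf).
pose step (p : (nat -> (nat -> R) -> R) * (nat -> R)) :=
  ((fun j x => - \sum_(0 <= i < (b + j).+1) p.1 i x * h (b + j - i)%N x),
   (fun j => \sum_(0 <= i < (b + j).+1) p.2 i * H (b + j - i)%N)).
(* [it k] is the k-th term of the Neumann series, together with the bounds of its coefficients. *)
pose it k := iter k step ((fun j => f (b + j)%N), (fun j => Mf (b + j)%N)).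
have itP k : (forall j, An N r ((it k).2 j) ((it k).1 j)) /\
    absb (fun j => (it k).2 j * r N ^+ j) ((1 / 4) ^+ k * B0).
  elim: k => [|k [IH1 IH2]]; first split => [j|]; first exact: hf.
    rewrite expr0 mul1r; have := absbZ (r N ^- b) (absb_shift' b hMf).
    rewrite gtr0_norm // => hE; apply: (absb_le hE) => // j /=.
    rewrite [X in _ <= `|X|](_ : _ = Mf (b + j)%N * r N ^+ j) // exprD.
    rewrite [LHS](_ : _ = (r N ^- b * r N ^+ b) * (Mf (b + j)%N * r N ^+ j)); last by ring.
    by rewrite rb1 mul1r.
  have [s1 s2] := division_step b IH1 IH2 hh hH.
  split => [j|]; first exact: (An_opp r0 (s1 j)).
  apply: (absb_le s2) => //; rewrite exprS; set u := (1 / 4) ^+ k.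
  rewrite [leLHS](_ : _ = (r N ^- b * r N ^+ b) * (1 / 4 * u * B0)); last by ring.
  by rewrite rb1 mul1r.
have it1 k j : An N r ((it k).2 j) ((it k).1 j) by have [+ _] := itP k.
have it2 k : absb (fun j => (it k).2 j * r N ^+ j) ((1 / 4) ^+ k * B0) by have [_ +] := itP k.
have M0 k j : 0 <= (it k).2 j by exact: An_ge0 (it1 k j).
have [hcol hrow _] := rs_exch it2 (absb_geo4 B00).
have hMj j : absb (fun k => (it k).2 j) ((r N ^+ j)^-1 * (2 * B0)).
  have rj0 : 0 < r N ^+ j by rewrite exprn_gt0.
  have := absbZ (r N ^+ j)^-1 (hcol j); rewrite gtr0_norm ?invr_gt0 // => hE.
  by apply: (absb_le hE) => // k; rewrite mulrC mulfK // gt_eqF.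
pose q j x := rs (fun k => (it k).1 j x).
pose Q j := rs (fun k => (it k).2 j).
have hq j : An N r (Q j) (q j).
  by apply: An_sumn => // [k|]; [exact: it1|exact: absb_rs (hMj j) _].
have hQ : absb (fun j => Q j * r N ^+ j) (2 * B0).
  apply: (absb_le hrow) => // j; rewrite /Q mulrC -(rsZ _ (hMj j)).
  by rewrite [leRHS](_ : _ = `|rs (fun k => r N ^+ j * (it k).2 j)|) //; congr `|rs _|; apply/funext => k; rewrite mulrC.
have key x : pd N r x -> forall j,
    f (b + j)%N x = q j x + \sum_(0 <= i < (b + j).+1) q i x * h (b + j - i)%N x.
  move=> hx j.
  have hqj i : absb (fun k => (it k).1 i x) ((r N ^+ i)^-1 * (2 * B0)).
    apply: (absb_le (hMj i)) => // k; apply: le_trans (ler_norm _).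
    exact: An_bound (it1 k i) hx.
  have ha i : absb (fun k => h (b + j - i)%N x * (it k).1 i x)
      (`|h (b + j - i)%N x| * ((r N ^+ i)^-1 * (2 * B0))) := absbZ _ (hqj i).
  have [_ e1] := rs_sumn (b + j).+1 ha.
  have -> : \sum_(0 <= i < (b + j).+1) q i x * h (b + j - i)%N x
          = \sum_(0 <= i < (b + j).+1) rs (fun k => h (b + j - i)%N x * (it k).1 i x).
    by apply: eq_bigr => i _; rewrite (rsZ _ (hqj i)) mulrC.
  rewrite -e1; have -> : (fun k => \sum_(0 <= i < (b + j).+1) h (b + j - i)%N x * (it k).1 i x)
      = (fun k => - (it (1 + k)%N).1 j x).
    apply/funext => k; rewrite /= opprK; apply: eq_bigr => i _; exact: mulrC.
  rewrite (rsN (absb_shift' 1 (hqj j))) /q (rs_split 1 (hqj j)) big_nat1 /=.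
  by rewrite addrK.
exists q, Q; split => // x hx.
have [s1 s2] := division_step b hq hQ hh hH.
apply: (absb_le s2).
  move=> j; rewrite normrM [leRHS]normrM ler_wpM2r //; apply: le_trans (ler_norm _).
  rewrite key // addrC addKr; exact: An_bound (s1 j) hx.
rewrite [leLHS](_ : _ = (r N ^- b * r N ^+ b) * (B0 / 2)); last by set u := r N ^- b; field.
by rewrite rb1 mul1r.
Qed.

(** From index b on, the coefficients of f and of q (x^b + h) agree by the last hypothesis; their
    difference below b is the remainder. *)
Lemma division_eval b (h f q : nat -> (nat -> R) -> R) (H Mf Q : nat -> R) Cf Ch Cq x :
  (forall j, An N r (H j) (h j)) -> absb (fun j => H j * r N ^+ j) Ch ->
  (forall j, An N r (Mf j) (f j)) -> absb (fun j => Mf j * r N ^+ j) Cf ->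
  (forall j, An N r (Q j) (q j)) -> absb (fun j => Q j * r N ^+ j) Cq ->
  pd N.+1 r x ->
  (forall j, f (b + j)%N x = q j x + \sum_(0 <= i < (b + j).+1) q i x * h (b + j - i)%N x) ->
  rs (fun j => f j x * x N ^+ j) =
  rs (fun j => q j x * x N ^+ j) * (x N ^+ b + rs (fun j => h j x * x N ^+ j)) +
  \sum_(0 <= n < b) (f n x - \sum_(0 <= i < n.+1) q i x * h (n - i)%N x) * x N ^+ n.
Proof.
move=> hh hH hf hMf hq hQ hx key.
have tf := An_term hf hMf hx; have tq := An_term hq hQ hx; have th := An_term hh hH hx.
have [hP eP] := rs_cauchy tq th.
have PE n : \sum_(0 <= i < n.+1) q i x * x N ^+ i * (h (n - i)%N x * x N ^+ (n - i))
          = (\sum_(0 <= i < n.+1) q i x * h (n - i)%N x) * x N ^+ n.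
  rewrite mulr_suml !big_nat; apply: eq_bigr => i /andP[_ ni].
  by rewrite mulrACA -exprD subnKC // -ltnS.
rewrite mulrDr -eP (rs_split b tf) (rs_split b hP).
have -> : rs (fun j => f (b + j)%N x * x N ^+ (b + j)) =
  rs (fun j => x N ^+ b * (q j x * x N ^+ j)) + rs (fun j => \sum_(0 <= i < (b + j).+1)
     q i x * x N ^+ i * (h (b + j - i)%N x * x N ^+ (b + j - i))).
  rewrite -(rsD (absbZ (x N ^+ b) tq) (absb_shift' b hP)); congr rs; apply/funext => j.
  by rewrite PE key exprD; ring.
rewrite (rsZ _ tq); set S := rs (fun j => \sum_(0 <= i < (b + j).+1) _).
have -> : \sum_(0 <= n < b) (f n x - \sum_(0 <= i < n.+1) q i x * h (n - i)%N x) * x N ^+ n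
  = \sum_(0 <= n < b) f n x * x N ^+ n - \sum_(0 <= n < b) \sum_(0 <= i < n.+1)
     q i x * x N ^+ i * (h (n - i)%N x * x N ^+ (n - i)).
  by rewrite -sumrB; apply: eq_bigr => n _; rewrite PE mulrBl.
by ring.
Qed.

End Core.

(** The radii [r'] are chosen before the function to be divided, so that finitely many germs can be
    divided on one polydisc. Dividing the power x_N^b itself gives the preparation theorem: its
    quotient stays away from 0, hence x_N^b minus its remainder has the same zeros as g on the
    polydisc. *)
Theorem weierstrass_division N r b (a : nat -> (nat -> R) -> R) (G : nat -> R) C g :
  (forall i, 0 < r i) -> (forall j, An N r (G j) (a j)) ->
  absb (fun j => G j * r N ^+ j) C ->
  (forall x, pd N.+1 r x -> g x = rs (fun j => a j x * x N ^+ j)) ->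
  (forall j, (j < b)%N -> a j (fun=> 0) = 0) -> a b (fun=> 0) != 0 ->
  exists r', [/\ forall i, 0 < r' i <= r i,
    exists (q : (nat -> R) -> R) (w : nat -> (nat -> R) -> R) d,
      [/\ 0 < d, exists C', An N.+1 r' C' q, forall j, exists C', An N r' C' (w j) &
          forall x, pd N.+1 r' x -> d <= `|q x| /\
            x N ^+ b = q x * g x + \sum_(0 <= j < b) w j x * x N ^+ j] &
    forall f Cf, An N.+1 r Cf f ->
      exists (q : (nat -> R) -> R) (w : nat -> (nat -> R) -> R),
      [/\ exists C', An N.+1 r' C' q, forall j, exists C', An N r' C' (w j) &
          forall x, pd N.+1 r' x ->
            f x = q x * g x + \sum_(0 <= j < b) w j x * x N ^+ j]].
Proof.
move=> r0 ha hG hg a0 ab0; set c := a b (fun=> 0) in ab0 *.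
have c0 : 0 < `|c| by rewrite normr_gt0.
have C0 := absb_ge0 hG.
have min1 (y : R) : 0 < y -> exists z, [/\ 0 < z, z <= 1 & z <= y].
  move=> y0; exists (Num.min 1 y); split; first by rewrite lt_min ltr01.
    by rewrite ge_min lexx.
  by rewrite ge_min lexx orbT.
have C8 : 0 < 8 * (C + 1) by lra.
(* Divided by c, g becomes x_N^b + h. Shrinking the last radius by [th] makes the terms of h of
   index above b small; once [th] is fixed, shrinking the other radii by [k] makes those of index at
   most b small, because their coefficients vanish at 0. The target is a quarter of the b-th power
   of the new last radius. *)
have [th [th0 th1 hth]] := min1 (`|c| * r N ^+ b / (8 * (C + 1)))
   (divr_gt0 (mulr_gt0 c0 (exprn_gt0 _ (r0 N))) C8).
have rho0 : 0 < th * r N by rewrite mulr_gt0.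
have [k [k0 k1 hk]] := min1 (`|c| * (th * r N) ^+ b / (8 * (C + 1)))
   (divr_gt0 (mulr_gt0 c0 (exprn_gt0 _ rho0)) C8).
pose r' i := if i == N then th * r N else k * r i.
have r'0 i : 0 < r' i by rewrite /r'; case: eqP => _; rewrite mulr_gt0.
have r'r i : r' i <= r i.
  by rewrite /r'; case: eqP => [->|_]; rewrite ler_piMl // ltW.
have rN : r' N = th * r N by rewrite /r' eqxx.
have rlow i : (i < N)%N -> r' i = k * r i by move=> iN; rewrite /r' ltn_eqF.
have G0 j : 0 <= G j by exact: An_ge0 (ha j).
pose h j x := c^-1 * (a j x - (j == b)%:R * c).
pose H j := `|c|^-1 * ((if (j <= b)%N then k else 1) * G j).
have hh j : An N r' (H j) (h j).
  rewrite /H -normfV; apply: (An_mul r'0 (An_cst r' N c^-1)).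
  case: (leqP j b) => jb.
    have k01 : 0 < k <= 1 by rewrite k0 k1.
    have kr0 i : 0 < k * r i by rewrite mulr_gt0.
    apply: (An_ext (An_shrink kr0 r'0 _ (An_shrink0 r0 k01 (ha j)))).
      by move=> i iN; rewrite rlow.
    move=> x _; congr (_ - _); case: (eqVneq j b) => [->|jnb]; first by rewrite mul1r.
    by rewrite mul0r a0 // ltn_neqAle jnb.
  rewrite mul1r gtn_eqF //; apply: (An_ext (An_shrink r0 r'0 _ (ha j))) => //.
  by move=> x _; rewrite mul0r subr0.
have hH : absb (fun j => H j * r' N ^+ j) (r' N ^+ b / 4).
  have kap0 : 0 <= (th * r N) ^+ b / (8 * (C + 1)).
    by rewrite divr_ge0 ?exprn_ge0 // ltW.
  have := absbZ ((th * r N) ^+ b / (8 * (C + 1))) hG; rewrite ger0_norm // => hE.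
  apply: (absb_le hE).
    move=> j; rewrite ger0_norm; last first.
      by rewrite mulr_ge0 ?(An_ge0 (hh j)) // exprn_ge0 // ltW.
    rewrite [leRHS]ger0_norm; last first.
      by rewrite mulr_ge0 // mulr_ge0 // exprn_ge0 // ltW.
    rewrite /H rN; set D := 8 * (C + 1) in C8 hk hth *.
    suff S : (if (j <= b)%N then k else 1) * th ^+ j <= `|c| * ((th * r N) ^+ b / D).
      have g1 : 0 <= G j * r N ^+ j by rewrite mulr_ge0 // exprn_ge0 // ltW.
      have -> : `|c|^-1 * ((if (j <= b)%N then k else 1) * G j) * (th * r N) ^+ j =
        `|c|^-1 * ((if (j <= b)%N then k else 1) * th ^+ j) * (G j * r N ^+ j).
        by rewrite exprMn; ring.
      by rewrite ler_wpM2r // [leLHS]mulrC ler_pdivrMr // [leRHS]mulrC.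
    rewrite mulrA; case: (leqP j b) => jb.
      by apply: le_trans hk; rewrite ler_piMr ?(ltW k0) // exprn_ile1 // ltW.
    rewrite mul1r; apply: (@le_trans _ _ (th ^+ b * (`|c| * r N ^+ b / D))).
      apply: (@le_trans _ _ (th ^+ b.+1)); last first.
        by rewrite exprSr ler_wpM2l // exprn_ge0 // ltW.
      by apply: ler_wiXn2l => //; exact: ltW.
    by rewrite exprMn le_eqVlt; apply/orP; left; apply/eqP; ring.
  rewrite rN -mulrA ler_wpM2l ?exprn_ge0 ?(ltW rho0) //.
  by rewrite mulrC ler_pdivrMr //; lra.
have gE x : pd N.+1 r' x -> g x = c * (x N ^+ b + rs (fun j => h j x * x N ^+ j)).
  move=> hx; have hx' : pd N.+1 r x by move=> i iN; apply: le_trans (hx i iN) (r'r i).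
  rewrite hg //; have th' := An_term hh hH hx.
  have hd : absb (fun j => (j == b)%:R * x N ^+ j) (\sum_(0 <= i < b.+1) `|(i == b)%:R * x N ^+ i|).
    by apply: absb_fin => i bi; rewrite gtn_eqF ?mul0r.
  have -> : x N ^+ b = rs (fun j => (j == b)%:R * x N ^+ j).
    rewrite (@rs_fin _ _ b.+1); last by move=> i bi; rewrite gtn_eqF ?mul0r.
    rewrite big_nat_recr //= big_nat big1 ?add0r ?eqxx ?mul1r //.
    by move=> i /andP[_ ib]; rewrite ltn_eqF // mul0r.
  rewrite -(rsD hd th') -(rsZ _ (absbD hd th')); congr rs; apply/funext => j.
  rewrite /h; set e := (j == b)%:R; set t := x N ^+ j.
  rewrite -[c^-1 * _ * t]mulrA mulrDr mulVKf //.
  by set u := a j x; ring.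
have main (f : nat -> (nat -> R) -> R) (Mf : nat -> R) Cf :
    (forall j, An N r' (Mf j) (f j)) -> absb (fun j => Mf j * r' N ^+ j) Cf ->
    exists (q : (nat -> R) -> R) (w : nat -> (nat -> R) -> R),
      [/\ exists C', An N.+1 r' C' q, forall j, exists C', An N r' C' (w j) &
          forall x, pd N.+1 r' x ->
            `|f b x - c * q x| <= `|f b x - c * q x| /\
            rs (fun j => f j x * x N ^+ j) = q x * g x + \sum_(0 <= j < b) w j x * x N ^+ j /\
            `|rs (fun j => f (b + j)%N x * x N ^+ j) - c * q x| <= r' N ^- b * Cf / 2].
  move=> hf hMf.
  have [q [Q [hq hQ key kb]]] := division_coefs r'0 hh hH hf hMf.
  have hqq : An N.+1 r' (2 * (r' N ^- b * Cf)) (fun x => rs (fun j => q j x * x N ^+ j)).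
    by exists q, Q.
  exists (fun x => c^-1 * rs (fun j => q j x * x N ^+ j)),
    (fun n x => f n x - \sum_(0 <= i < n.+1) q i x * h (n - i)%N x); split.
  - exists (`|c^-1| * (2 * (r' N ^- b * Cf))); exact: (An_mul r'0 (An_cst r' _ _) hqq).
  - move=> j; exists (Mf j + \sum_(0 <= i < j.+1) Q i * H (j - i)%N).
    apply: An_add => //; apply: An_opp => //.
    apply: (@An_sum _ r' r'0 nat (index_iota 0 j.+1) N
      (fun i => Q i * H (j - i)%N) (fun i x => q i x * h (j - i)%N x)) => i; exact: An_mul.
  move=> x hx; split=> //; split.
    rewrite gE // [c^-1 * _]mulrC mulrA mulfVK //.
    by apply: (division_eval hh hH hf hMf hq hQ hx) => j; apply: key; exact: pdS hx.
  rewrite mulVKf //.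
  have tq := An_term hq hQ hx.
  have kb' := kb x (pdS hx).
  have hfq : absb (fun j => (f (b + j)%N x - q j x) * x N ^+ j) (r' N ^- b * Cf / 2).
    apply: (absb_le kb') => // j; rewrite normrM [leRHS]normrM ler_wpM2l //.
    rewrite !normrX lerXn2r ?nnegrE //.
    by apply: le_trans (ler_norm _); apply: hx.
  have -> : rs (fun j => f (b + j)%N x * x N ^+ j) =
      rs (fun j => (f (b + j)%N x - q j x) * x N ^+ j) + rs (fun j => q j x * x N ^+ j).
    by rewrite -(rsD hfq tq); congr rs; apply/funext => j; ring.
  by rewrite addrK; exact: rs_le.
exists r'; split.
- by move=> i; rewrite r'0 r'r.
(* Division of x_N^b: the quotient satisfies |1 - c q| <= 1/2, whence its lower bound |c|^-1 / 2. *)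
- pose f j (x : nat -> R) : R := (j == b)%:R.
  have hf j : An N r' ((j == b)%:R) (f j).
    by have := An_cst r' N ((j == b)%:R); rewrite normr_nat.
  have hMf : absb (fun j => (j == b)%:R * r' N ^+ j) (r' N ^+ b).
    have := @absb_fin _ (fun j => (j == b)%:R * r' N ^+ j) b.+1.
    rewrite big_nat_recr //= eqxx mul1r big_nat big1 ?add0r; last first.
      by move=> i /andP[_ ib]; rewrite ltn_eqF // mul0r normr0.
    rewrite ger0_norm ?exprn_ge0 ?(ltW (r'0 _)) //; apply => i bi.
    by rewrite gtn_eqF // mul0r.
  have [q [w [hq hw hqw]]] := main f _ _ hf hMf.
  exists q, w, (`|c|^-1 / 2); split => //.
    by rewrite divr_gt0 // invr_gt0.
  move=> x hx; have [_ [e1 e2]] := hqw x hx; split; last first.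
    rewrite -e1 (@rs_fin _ _ b.+1); last by move=> i bi; rewrite /f gtn_eqF ?mul0r.
    rewrite big_nat_recr //= big_nat big1 ?add0r ?/f ?eqxx ?mul1r //.
    by move=> i /andP[_ ib]; rewrite ltn_eqF // mul0r.
  move: e2; rewrite (@rs_fin _ _ 1); last first.
    by case=> // i _; rewrite /f -[X in _ == X]addn0 eqn_add2l mul0r.
  rewrite big_nat1 /f addn0 eqxx mul1r expr0 mulVf; last first.
    by rewrite expf_neq0 // gt_eqF.
  move=> e2; rewrite mulrC ler_pdivrMr // -normrM [q x * c]mulrC.
  have := ler_norm (1 - c * q x); have := ler_norm (c * q x); lra.
move=> f Cf /AnS[af [Mf [h1 h2 h3]]].
have hf j : An N r' (Mf j) (af j) by apply: (An_shrink r0 r'0 _ (h1 j)).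
have hMf : absb (fun j => Mf j * r' N ^+ j) Cf.
  apply: (absb_le h2) => // j; rewrite normrM [leRHS]normrM ler_wpM2l //.
  by rewrite !ger0_norm ?exprn_ge0 ?(ltW (r'0 _)) ?(ltW (r0 _)) // lerXn2r ?nnegrE ?(ltW (r'0 _)) ?(ltW (r0 _)).
have [q [w [hq hw hqw]]] := main af _ _ hf hMf.
exists q, w; split => // x hx; have [_ [e1 _]] := hqw x hx.
by rewrite h3 // => i iN; apply: le_trans (hx i iN) (r'r i).
Qed.

End Weierstrass.

(** * Germs of analytic functions *)

Section AnalyticGerms.
Context {R : realType}.
Implicit Types (f g : (nat -> R) -> R) (x y : nat -> R) (N : nat) (rho : R).

Definition anal N f := exists rho C, 0 < rho /\ An N (fun=> rho) C f.

Lemma fin_min (P : nat -> R -> Prop) n :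
  (forall i rho rho', 0 < rho' <= rho -> P i rho -> P i rho') ->
  (forall i, (i < n)%N -> exists rho, 0 < rho /\ P i rho) ->
  exists rho, 0 < rho /\ forall i, (i < n)%N -> P i rho.
Proof.
move=> hP; elim: n => [|n IH] h; first by exists 1.
have [rho [rho0 h1]] : exists rho, 0 < rho /\ forall i, (i < n)%N -> P i rho.
  by apply: IH => i ni; apply: h; exact: ltnW.
have [rho' [rho'0 h2]] := h n (ltnSn n).
have m0 : 0 < Num.min rho rho' by rewrite lt_min rho0.
exists (Num.min rho rho'); split => // i; rewrite ltnS leq_eqVlt => /orP[/eqP ->|ni].
  by apply: hP h2; rewrite m0 ge_min lexx orbT.
by apply: hP (h1 i ni); rewrite m0 ge_min lexx.
Qed.

Lemma An_cst_shrink N C f rho rho' : 0 < rho' <= rho -> An N (fun=> rho) C f ->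
  An N (fun=> rho') C f.
Proof.
by move=> /andP[h0 h1] h; apply: (@An_shrink _ _ (fun=> rho)) => // _; apply: lt_le_trans h1.
Qed.

Lemma An_anal N r C f : (forall i, 0 < r i) -> An N r C f -> anal N f.
Proof.
move=> r0 hf.
have [rho [rho0 h]] : exists rho, 0 < rho /\ forall i, (i < N)%N -> rho <= r i.
  apply: (@fin_min (fun i rho => rho <= r i)) => [i rho rho' /andP[_ h1] h2|i _].
    exact: le_trans h2.
  by exists (r i).
by exists rho, C; split => //; apply: An_shrink hf.
Qed.

Lemma anal2 N f g : anal N f -> anal N g ->
  exists rho C C', [/\ 0 < rho, An N (fun=> rho) C f & An N (fun=> rho) C' g].
Proof.
move=> [r1 [C1 [p1 h1]]] [r2 [C2 [p2 h2]]].
have m0 : 0 < Num.min r1 r2 by rewrite lt_min p1.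
exists (Num.min r1 r2), C1, C2; split => //.
  by apply: An_cst_shrink h1; rewrite m0 ge_min lexx.
by apply: An_cst_shrink h2; rewrite m0 ge_min lexx orbT.
Qed.

Lemma anal_ext N f g rho : 0 < rho -> (forall x, pd N (fun=> rho) x -> f x = g x) ->
  anal N f -> anal N g.
Proof.
move=> r0 h [r1 [C1 [p1 h1]]].
have m0 : 0 < Num.min rho r1 by rewrite lt_min r0.
exists (Num.min rho r1), C1; split => //.
apply: (@An_ext _ _ _ _ f).
  by apply: An_cst_shrink h1; rewrite m0 ge_min lexx orbT.
by move=> x hx; apply: h => i /hx /le_trans -> //; rewrite ge_min lexx.
Qed.

Lemma anal_cst N c : anal N (fun=> c).
Proof. by exists 1, `|c|; split => //; exact: An_cst. Qed.

Lemma anal_proj N i : (i < N)%N -> anal N (fun x => x i).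
Proof. by move=> iN; exists 1, 1; split => //; apply: An_proj. Qed.

Lemma anal_low N f : anal N f -> anal N.+1 f.
Proof. by move=> [r [C [p h]]]; exists r, C; split => //; exact: An_low. Qed.

Lemma anal_add N f g : anal N f -> anal N g -> anal N (fun x => f x + g x).
Proof.
move=> hf hg; have [rho [C [C' [p h1 h2]]]] := anal2 hf hg.
by exists rho, (C + C'); split => //; apply: An_add.
Qed.

Lemma anal_mul N f g : anal N f -> anal N g -> anal N (fun x => f x * g x).
Proof.
move=> hf hg; have [rho [C [C' [p h1 h2]]]] := anal2 hf hg.
by exists rho, (C * C'); split => //; apply: An_mul.
Qed.

Lemma anal_opp N f : anal N f -> anal N (fun x => - f x).
Proof. by move=> [r [C [p h]]]; exists r, C; split => //; exact: An_opp. Qed.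

Lemma anal_sub N f g : anal N f -> anal N g -> anal N (fun x => f x - g x).
Proof. by move=> hf hg; apply: anal_add => //; exact: anal_opp. Qed.

Lemma anal_exp N f j : anal N f -> anal N (fun x => f x ^+ j).
Proof. by move=> [r [C [p h]]]; exists r, (C ^+ j); split => //; exact: An_exp. Qed.

Lemma anal_sum N (I : Type) (s : seq I) (P : pred I) (f : I -> (nat -> R) -> R) :
  (forall i, P i -> anal N (f i)) -> anal N (fun x => \sum_(i <- s | P i) f i x).
Proof.
move=> h; elim: s => [|i s IH].
  by apply: (anal_ext ltr01 _ (anal_cst N 0)) => x _; rewrite big_nil.
case Pi : (P i).
  by apply: (anal_ext ltr01 _ (anal_add (h i Pi) IH)) => x _; rewrite big_cons Pi.
by apply: (anal_ext ltr01 _ IH) => x _; rewrite big_cons Pi.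
Qed.

Lemma anal_small N f e : anal N f -> f (fun=> 0) = 0 -> 0 < e ->
  exists rho, 0 < rho /\ An N (fun=> rho) e f.
Proof.
move=> [r [C [p h]]] f0 e0; have C0 := An_ge0 h.
have C1 : 0 < C + 1 by lra.
set k := Num.min 1 (e / (C + 1)).
have k01 : 0 < k <= 1.
  by rewrite lt_min ltr01 ge_min lexx divr_gt0.
have kC : k * C <= e.
  apply: (@le_trans _ _ (e / (C + 1) * (C + 1))); last by rewrite divfK ?gt_eqF.
  by apply: ler_pM => //; [case/andP: k01 => /ltW|rewrite ge_min lexx orbT|lra].
have [k0 _] := andP k01.
exists (k * r); split; first by rewrite mulr_gt0.
apply: (An_le _ kC); apply: (An_ext (An_shrink0 _ k01 h)) => // x _.
by rewrite f0 subr0.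
Qed.

Lemma anal_comp N N' f (l : nat -> (nat -> R) -> R) : anal N f ->
  (forall i, (i < N)%N -> anal N' (l i) /\ l i (fun=> 0) = 0) ->
  anal N' (fun x => f (fun i => l i x)).
Proof.
move=> [r [C [p h]]] hl.
have [rho [rho0 hrho]] : exists rho, 0 < rho /\
    forall i, (i < N)%N -> An N' (fun=> rho) r (l i).
  apply: (@fin_min (fun i rho => An N' (fun=> rho) r (l i))).
    by move=> i r1 r2 h1; apply: An_cst_shrink.
  by move=> i iN; have [h1 h2] := hl i iN; exact: anal_small.
by exists rho, C; split => //; apply: (An_comp _ _ h).
Qed.

Lemma anal_dep N f : anal N f -> exists rho, 0 < rho /\
  forall x y, pd N (fun=> rho) x -> (forall i, (i < N)%N -> x i = y i) -> f x = f y.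
Proof.
move=> [r [C [p h]]]; exists r; split => // x y hx hxy.
exact: An_dep h hxy hx.
Qed.

Lemma anal_bounded N f : anal N f -> exists rho C, [/\ 0 < rho, 0 <= C &
  forall x, pd N (fun=> rho) x -> `|f x| <= C].
Proof.
move=> [r [C [p h]]]; exists r, C; split => //; first exact: An_ge0 h.
by move=> x; exact: An_bound h.
Qed.

Lemma power_diff (t s rho d : R) j : `|t| <= rho -> `|s| <= rho -> `|t - s| <= d ->
  `|t ^+ j - s ^+ j| <= j%:R * rho ^+ j.-1 * d.
Proof.
move=> ht hs hd; rewrite subrXX normrM mulrC.
have d0 : 0 <= d := le_trans (normr_ge0 _) hd.
have rho0 : 0 <= rho := le_trans (normr_ge0 _) ht.
apply: ler_pM => //; apply: (le_trans (ler_norm_sum _ _ _)).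
apply: (@le_trans _ _ (\sum_(i < j) rho ^+ j.-1)); last by rewrite sumr_const card_ord mulr_natl.
apply: ler_sum => i _; rewrite normrM !normrX.
have e : j.-1 = (j.-1 - i + i)%N by have := ltn_ord i; lia.
rewrite [X in _ <= _ ^+ X]e exprD; apply: ler_pM; rewrite ?exprn_ge0 //.
  by apply: lerXn2r; rewrite ?nnegrE.
by apply: lerXn2r; rewrite ?nnegrE.
Qed.

(** The constant depends only on [N] and the radius, because the induction applies it to infinitely
    many coefficient functions, each with its own bound. *)
Lemma An_lip N rho : 0 < rho -> exists k, 0 <= k /\ forall C f, An N (fun=> rho) C f ->
  forall x y d, pd N (fun=> rho / 2) x -> pd N (fun=> rho / 2) y ->
  (forall i, (i < N)%N -> `|x i - y i| <= d) -> 0 <= d -> `|f x - f y| <= k * C * d.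
Proof.
move=> p; elim: N => [|N [k [k0 IH]]].
  exists 0; split => // C f [c [_ h]] x y d _ _ _ _.
  by rewrite !h subrr normr0 !mul0r.
exists (k + 2 / rho); split; first by rewrite addr_ge0 // divr_ge0 // ltW.
move=> C f /AnS[a [M [h1 h2 h3]]] x y d hx hy hd d0.
have half : rho / 2 <= rho by lra.
have hx' : pd N.+1 (fun=> rho) x by move=> i /hx /le_trans; apply.
have hy' : pd N.+1 (fun=> rho) y by move=> i /hy /le_trans; apply.
have tx := An_term h1 h2 hx'; have ty := An_term h1 h2 hy'.
rewrite !h3 // -(rsN ty).
have tyn : absb (fun j => - (a j y * y N ^+ j)) C.
  by apply: (absb_le ty) => // j; rewrite normrN.
rewrite -(rsD tx tyn) -mulrA [C * d]mulrC mulrA.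
have := absbZ ((k + 2 / rho) * d) h2.
have kd0 : 0 <= (k + 2 / rho) * d by rewrite mulr_ge0 // addr_ge0 // divr_ge0 // ltW.
rewrite ger0_norm // => hE; apply: rs_le; apply: (absb_le hE) => // j.
have Mj := An_ge0 (h1 j).
rewrite [leRHS]ger0_norm; last by rewrite mulr_ge0 // mulr_ge0 // exprn_ge0 // ltW.
have -> : a j x * x N ^+ j - a j y * y N ^+ j =
  (a j x - a j y) * x N ^+ j + a j y * (x N ^+ j - y N ^+ j) by ring.
apply: (le_trans (ler_normD _ _)); rewrite !normrM.
have -> : (k + 2 / rho) * d * (M j * rho ^+ j) =
  (k * M j * d) * rho ^+ j + M j * (2 / rho * rho ^+ j * d) by ring.
apply: lerD; apply: ler_pM => //.
- by apply: (IH _ _ (h1 j)) => //; [exact: pdS hx|exact: pdS hy|move=> i iN; apply: hd; exact: ltnW].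
- rewrite normrX; apply: lerXn2r; rewrite ?nnegrE //; first exact: ltW.
  exact: hx'.
- by apply: An_bound (h1 j) (pdS hy').
(* Half the radius pays for the factor j: j (rho / 2)^(j - 1) <= (2 / rho) rho^j because j <=
   2^j. *)
apply: (le_trans (power_diff _ (hx N (ltnSn N)) (hy N (ltnSn N)) (hd N (ltnSn N)))).
rewrite ler_wpM2r //; case: j {Mj} => [|j].
  by rewrite mul0r mulr_ge0 // ?expr0 // divr_ge0 // ltW.
rewrite /= expr_div_n exprS.
have -> : 2 / rho * (rho * rho ^+ j) = 2 * rho ^+ j by field; rewrite gt_eqF.
rewrite mulrA mulrAC ler_wpM2r ?exprn_ge0 ?(ltW p) //.
rewrite ler_pdivrMr ?exprn_gt0 // -exprS -natrX ler_nat.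
exact: ltnW (ltn_expl _ _).
Qed.

Lemma anal_lip N f : anal N f -> exists rho K, [/\ 0 < rho, 0 <= K &
  forall x y d, pd N (fun=> rho) x -> pd N (fun=> rho) y ->
  (forall i, (i < N)%N -> `|x i - y i| <= d) -> 0 <= d -> `|f x - f y| <= K * d].
Proof.
move=> [r [C [p h]]]; have [k [k0 hk]] := @An_lip N r p.
exists (r / 2), (k * C); split; first by lra.
  by rewrite mulr_ge0 // (An_ge0 h).
by move=> x y d hx hy hd d0; exact: hk h _ _ _ hx hy hd d0.
Qed.

(** If the coefficients below j vanish, division by s^j leaves |c_j| <= s K for every small s > 0,
    with K independent of s. *)
Lemma power_series_zero (c : nat -> R) rho C e : 0 < rho -> 0 < e ->
  absb (fun j => c j * rho ^+ j) C ->
  (forall s, 0 < s <= e -> rs (fun j => c j * s ^+ j) = 0) -> forall j, c j = 0.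
Proof.
move=> p e0 hc hz j; elim/ltn_ind: j => j IH.
have C0 := absb_ge0 hc.
have hpow s i : 0 < s -> s <= rho -> `|s ^+ i| <= `|rho ^+ i|.
  by move=> s0 sr; rewrite !normrX lerXn2r ?nnegrE // !gtr0_norm.
have hs s : 0 < s -> s <= rho -> absb (fun j => c j * s ^+ j) C.
  move=> s0 sr; apply: (absb_le hc) => // i; rewrite !normrM ler_wpM2l //.
  exact: hpow.
have bound s : 0 < s -> s <= rho -> s <= e -> `|c j| <= s * (C / rho ^+ j.+1).
  move=> s0 sr se.
  have := hz s; rewrite s0 se => /(_ isT); rewrite (rs_split j (hs s s0 sr)).
  rewrite big_nat big1 ?add0r; last by move=> i /andP[_ ij]; rewrite IH // mul0r.
  rewrite (rs_split 1 (absb_shift' j (hs s s0 sr))) big_nat1 addn0 => /eqP.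
  rewrite addr_eq0 => /eqP E.
  have hD : absb (fun i => c (j + (1 + i))%N * s ^+ (j + (1 + i))) (s ^+ j.+1 / rho ^+ j.+1 * C).
    have h1 := absb_shift' 1 (absb_shift' j hc).
    have := absbZ (s ^+ j.+1 / rho ^+ j.+1) h1; rewrite ger0_norm; last first.
      by rewrite divr_ge0 // exprn_ge0 // ltW.
    move=> hE; apply: (absb_le hE) => // i; rewrite addnA addn1 !(exprD _ j.+1 i).
    set u := c _; set v := s ^+ j.+1; set w := rho ^+ j.+1.
    have w0 : w != 0 by rewrite expf_neq0 // gt_eqF.
    have -> : v / w * (u * (w * rho ^+ i)) = u * (v * rho ^+ i) by field.
    rewrite normrM [leRHS]normrM ler_wpM2l // normrM [leRHS]normrM ler_wpM2l //.
    exact: hpow.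
  have := rs_le hD; rewrite -normrN -E normrM [`|s ^+ j|]ger0_norm ?exprn_ge0 ?(ltW s0) //.
  rewrite -ler_pdivlMr ?exprn_gt0 // => /le_trans; apply.
  rewrite le_eqVlt; apply/orP; left; apply/eqP; rewrite exprS.
  by field; rewrite !expf_neq0 ?gt_eqF // ltW.
apply/eqP; rewrite -normr_le0; apply/ler_addgt0Pr => d d0; rewrite add0r.
set K := C / rho ^+ j.+1 in bound.
have K0 : 0 <= K by rewrite divr_ge0 // exprn_ge0 // ltW.
have K1 : 0 < K + 1 by lra.
set s := Num.min (Num.min rho e) (d / (K + 1)).
have s0 : 0 < s by rewrite !lt_min p e0 divr_gt0.
apply: (le_trans (bound s s0 _ _)); rewrite ?ge_min ?lexx ?orbT //.
apply: (@le_trans _ _ (d / (K + 1) * (K + 1))); last by rewrite divfK ?gt_eqF.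
by apply: ler_pM => //; [exact: ltW|rewrite ge_min lexx orbT|lra].
Qed.

Definition axis N (t : R) : nat -> R := fun i => if i == N then t else 0.

(** As z lies in half the polydisc, f restricted to the line through z is a power series of radius 2
    in the parameter. The parameter 1 lies inside, and the identity theorem carries the vanishing
    near 0 to z. *)
Lemma An_line N rho C f z : 0 < rho -> An N (fun=> rho) C f -> pd N (fun=> rho / 2) z ->
  (exists2 e, 0 < e & forall s, 0 < s <= e -> f (fun i => s * z i) = 0) -> f z = 0.
Proof.
move=> p hf hz [e e0 he].
have hl : An 1 (fun=> 2) C (fun x => f (fun i => x 0%N * z i)).
  apply: (An_comp (l := fun i x => x 0%N * z i) (fun=> p) (fun=> ltr0Sn _ 1) hf) => i iN.
  have := An_mul (fun=> ltr0Sn _ 1) (@An_proj _ (fun=> 2) (fun=> ltr0Sn _ 1) 1 0 isT)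
    (An_cst (fun=> 2) 1 (z i)) => h.
  by apply: (An_le h); have := hz i iN; lra.
have [a [M [h1 h2 h3]]] := AnS hl.
have c j : exists c, forall x, a j x = c by have [c [_ hc]] := h1 j; exists c.
have [cc hcc] := choice c.
have p2 : pd 1 (fun=> 2) (fun=> 2 : R) by move=> i _; rewrite ger0_norm.
have t2 := An_term h1 h2 p2.
have cc0 : forall j, cc j = 0.
  have t2' : absb (fun j => cc j * 2 ^+ j) C.
    by apply: (absb_le t2) => // j; rewrite hcc.
  have m0 : 0 < Num.min e 2 by rewrite lt_min e0 ltr0Sn.
  apply: (power_series_zero _ m0 t2') => // s /andP[s0]; rewrite le_min => /andP[se s2].
  have := h3 (fun=> s); rewrite he ?s0 // => ->; last first.
    by move=> i _; rewrite ger0_norm // ltW.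
  by congr rs; apply/funext => j; rewrite hcc.
have := h3 (fun=> 1); rewrite (_ : (fun i => 1 * z i) = z); last by apply/funext => i; rewrite mul1r.
move=> ->; last by move=> i _; rewrite normr1; lra.
by rewrite (@rs_fin _ _ 0) ?big_geq // => j _; rewrite hcc cc0 mul0r.
Qed.

Definition shear N (a x : nat -> R) : nat -> R := fun i => if (i < N)%N then x i + a i * x N else x i.

Lemma anal_shear N f a : anal N.+1 f -> anal N.+1 (fun x => f (shear N a x)).
Proof.
move=> hf; apply: (anal_comp (l := fun i x => shear N a x i)) hf _ => i iN.
rewrite /shear; case: ifP => h; last by split => //; exact: anal_proj.
split; last by rewrite mulr0 addr0.
apply: anal_add; first exact: anal_proj.
by apply: anal_mul; [exact: anal_cst|exact: anal_proj].
Qed.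

(** The shear turns the last axis into the line through a point z with both f z and z_N nonzero; by
    [An_line], f does not vanish on this line near 0. This is the regularity that Weierstrass
    division requires. *)
Lemma shear_regular N f : anal N.+1 f ->
  (forall rho, 0 < rho -> exists2 x, pd N.+1 (fun=> rho) x & f x != 0) ->
  exists a, forall rho, 0 < rho -> exists2 t, `|t| <= rho & f (shear N a (axis N t)) != 0.
Proof.
move=> [rho [C [p hf]]] hnz.
have r2 : 0 < rho / 2 by lra.
have [z hz hN] : exists2 z, pd N.+1 (fun=> rho / 2) z & f z != 0 /\ z N != 0.
  have [z hz fz] := hnz _ r2.
  have [zN|zN] := eqVneq (z N) 0; last by exists z.
  (* If f vanished at all points with nonzero last coordinate, its series in that coordinate would
     have zero coefficients, and f would vanish at z too. *)
  apply: contrapT => H; case/eqP: fz.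
  have [a [M [h1 h2 h3]]] := AnS hf.
  have hz' : pd N.+1 (fun=> rho) z by move=> i /hz; lra.
  have hzu u : `|u| <= rho -> pd N.+1 (fun=> rho) (fun i => if i == N then u else z i).
    by move=> hu i iN; case: eqP => // _; exact: hz'.
  have dep j u : a j (fun i => if i == N then u else z i) = a j z.
    apply/esym/(An_dep (h1 j)) => [i iN|]; first by rewrite ltn_eqF.
    exact: pdS hz'.
  have zr : `|rho| <= rho by rewrite ger0_norm // ltW.
  have t := An_term h1 h2 (hzu _ zr).
  have t' : absb (fun j => a j z * rho ^+ j) C.
    by apply: (absb_le t) => // j; rewrite dep eqxx.
  have c0 := power_series_zero p r2 t' _.
  rewrite h3 // (@rs_fin _ _ 0) ?big_geq // => j _; rewrite c0 ?mul0r // => s /andP[s0 sr].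
  have hs : `|s| <= rho by rewrite ger0_norm ?(ltW s0) //; lra.
  have := h3 _ (hzu s hs); rewrite eqxx.
  have -> : f (fun i => if i == N then s else z i) = 0.
    apply/eqP; apply: contra_notT H => fs; exists (fun i => if i == N then s else z i).
      by move=> i iN; case: eqP => _; [rewrite ger0_norm // ltW|exact: hz].
    by rewrite eqxx fs gt_eqF.
  by move=> ->; congr rs; apply/funext => k; rewrite dep.
have [fz zN] := hN.
exists (fun i => z i / z N) => d d0; apply: contrapT => H; case/eqP: fz.
apply: (An_line p hf hz); exists (Num.min 1 (d / `|z N|)).
  by rewrite lt_min ltr01 divr_gt0 // normr_gt0.
move=> s /andP[s0]; rewrite le_min => /andP[s1 sd].
have sz : `|s * z N| <= d.
  by rewrite normrM ger0_norm ?(ltW s0) // -ler_pdivlMr // normr_gt0.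
have : f (shear N (fun i => z i / z N) (axis N (s * z N))) = 0.
  by apply/eqP; apply: contra_notT H => h; exists (s * z N).
move=> <-; apply: (An_dep hf) => i iN.
  rewrite /shear /axis eqxx; case: ltnP => h.
    by rewrite ltn_eqF // add0r mulrCA divfK.
  by have -> : i = N by [apply/eqP; rewrite eqn_leq -ltnS iN h]; rewrite eqxx.
have /= := hz i iN; rewrite normrM ger0_norm ?(ltW s0) //.
by have := normr_ge0 (z i); nra.
Qed.

(** For a germ g of order 1, dividing the last variable gives x_N = q g + w_0 with q nonzero, so g
    vanishes where x_N = w_0: the implicit function is the remainder. *)
Lemma anal_ift N D (a : nat -> (nat -> R) -> R) : (1 < D)%N ->
  (forall j, anal N (a j)) -> a 0%N (fun=> 0) = 0 -> a 1%N (fun=> 0) != 0 ->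
  exists phi, [/\ anal N phi, phi (fun=> 0) = 0 &
    exists2 rho, 0 < rho & forall x, pd N (fun=> rho) x ->
      \sum_(0 <= j < D) a j x * phi x ^+ j = 0].
Proof.
move=> D1 ha a00 a10.
have [rho [p hrho]] : exists rho, 0 < rho /\
    forall j, (j < D)%N -> exists C, An N (fun=> rho) C (a j).
  apply: (@fin_min (fun j rho => exists C, An N (fun=> rho) C (a j))).
    by move=> j r1 r2 h [C hC]; exists C; apply: An_cst_shrink hC.
  by move=> j _; have [r [C [r0 hC]]] := ha j; exists r; split => //; exists C.
pose a' j := if (j < D)%N then a j else fun=> 0.
have ha' j : exists C, An N (fun=> rho) C (a' j).
  by rewrite /a'; case: ltnP => [/hrho|_] //; exists 0; exact: An_0.
have [G hG] := choice ha'.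
pose G' j := if (j < D)%N then G j else 0.
have hG' j : An N (fun=> rho) (G' j) (a' j).
  by rewrite /G' /a'; case: ltnP => h; [have := hG j; rewrite /a' h|exact: An_0].
have hb : absb (fun j => G' j * rho ^+ j) (\sum_(0 <= j < D) `|G' j * rho ^+ j|).
  by apply: absb_fin => j Dj; rewrite /G' ltnNge Dj mul0r.
pose g x := \sum_(0 <= j < D) a' j x * x N ^+ j.
have gE x : pd N.+1 (fun=> rho) x -> g x = rs (fun j => a' j x * x N ^+ j).
  by move=> _; rewrite (@rs_fin _ _ D) // => j Dj; rewrite /a' ltnNge Dj mul0r.
have a1' : a' 1%N (fun=> 0) != 0 by rewrite /a' D1.
have a0' j : (j < 1)%N -> a' j (fun=> 0) = 0.
  by case: j => // _; rewrite /a' (ltnW D1).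
have [r [hr [q [w [d [d0 hq hw hqw]]]] _]] :=
  @weierstrass_division _ N (fun=> rho) 1 a' G' _ g (fun=> p) hG' hb gE a0' a1'.
have r0 i : 0 < r i by have /andP[] := hr i.
have g0 : g (fun=> 0) = 0.
  rewrite /g big_nat big1 // => -[|j] _; first by rewrite a0' // mul0r.
  by rewrite expr0n mulr0.
have w0 : w 0%N (fun=> 0) = 0.
  have [|_] := hqw (fun=> 0); first by move=> i _; rewrite normr0 ltW.
  by rewrite g0 mulr0 add0r big_nat1 expr0 mulr1 expr1.
have aw : anal N (w 0%N) by have [C hC] := hw 0%N; exact: An_anal hC.
exists (w 0%N); split => //.
have [rho1 [rho10 h1]] := anal_small aw w0 (r0 N).
have [rho2 [rho20 h2]] : exists rho, 0 < rho /\ forall i, (i < N)%N -> rho <= r i.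
  apply: (@fin_min (fun i rho => rho <= r i)) => [i r1 r2 /andP[_ k1] k2|i _].
    exact: le_trans k2.
  by exists (r i).
exists (Num.min rho1 rho2); first by rewrite lt_min rho10.
move=> x hx; set t := w 0%N x.
have hx1 : pd N (fun=> rho1) x by move=> i /hx /le_trans; apply; rewrite ge_min lexx.
have hx2 : pd N r x.
  by move=> i iN; apply: le_trans (hx i iN) _; rewrite ge_min (h2 i iN) orbT.
pose y i := if i == N then t else x i.
have yx i : (i < N)%N -> x i = y i by move=> iN; rewrite /y ltn_eqF.
have hy : pd N.+1 r y.
  move=> i iN; rewrite /y; case: eqP => [->|/eqP iN']; first exact: An_bound h1 hx1.
  by apply: hx2; rewrite ltn_neqAle iN' -ltnS.
have wxy : w 0%N x = w 0%N y.
  by have [C hC] := hw 0%N; exact: An_dep hC yx hx2.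
have [dq E] := hqw y hy.
have gy : g y = 0.
  move: E; rewrite big_nat1 expr0 mulr1 expr1 -wxy {1}/y eqxx -/t => E.
  have /eqP : q y * g y = 0 by lra.
  rewrite mulf_eq0 => /orP[/eqP q0|/eqP //].
  by move: dq; rewrite q0 normr0 leNgt d0.
rewrite -[RHS]gy /g !big_nat; apply: eq_bigr => j /andP[_ jD].
rewrite {2}/y eqxx; congr (_ * _); rewrite -[a j]/(a j) /a' jD.
have [C hC] := hrho j jD; apply: (An_dep hC yx) => i iN.
by apply: le_trans (hx2 i iN) _; have /andP[] := hr i.
Qed.

End AnalyticGerms.

(** * Pseudo-division and the Euclidean algorithm *)

Section PseudoDivision.
(** [S] is the ring of coefficients, [S'] contains [S] and the variable [t], and [J] acts as a prime
    ideal of [S'] with residue characteristic 0. The two instances are germs modulo flat ones, and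
    polynomials modulo those vanishing almost everywhere. *)
Context (A : comNzRingType) (S S' J : A -> Prop) (t : A).
Context (S0 : S 0) (S1 : S 1) (SD : forall a b, S a -> S b -> S (a + b))
  (SN : forall a, S a -> S (- a)) (SM : forall a b, S a -> S b -> S (a * b)).
Context (SS' : forall a, S a -> S' a) (S't : S' t)
  (S'D : forall a b, S' a -> S' b -> S' (a + b))
  (S'M : forall a b, S' a -> S' b -> S' (a * b)).
Context (J0 : J 0) (JD : forall a b, J a -> J b -> J (a + b))
  (JM : forall a b, S' a -> J b -> J (a * b))
  (Jprime : forall a b, S' a -> S' b -> J (a * b) -> J a \/ J b)
  (Jnat : forall n, ~ J (n.+1%:R)).
Implicit Types p q P : {poly A}.

Definition coefs_in p := forall i, S p`_i.

Lemma coefs_in0 : coefs_in 0.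
Proof. by move=> i; rewrite coef0. Qed.

Lemma subring_sum (I : Type) (s : seq I) (f : I -> A) :
  (forall i, S (f i)) -> S (\sum_(i <- s) f i).
Proof. by move=> h; apply: big_ind. Qed.

Lemma subring_exp a n : S a -> S (a ^+ n).
Proof. by move=> h; elim: n => [|n IH]; rewrite ?expr0 // exprS; exact: SM. Qed.

Lemma coefs_inD p q : coefs_in p -> coefs_in q -> coefs_in (p + q).
Proof. by move=> hp hq i; rewrite coefD; exact: SD. Qed.

Lemma coefs_inN p : coefs_in p -> coefs_in (- p).
Proof. by move=> hp i; rewrite coefN; exact: SN. Qed.

Lemma coefs_inM p q : coefs_in p -> coefs_in q -> coefs_in (p * q).
Proof. by move=> hp hq i; rewrite coefM; apply: subring_sum => j; exact: SM. Qed.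

Lemma coefs_inZ a p : S a -> coefs_in p -> coefs_in (a *: p).
Proof. by move=> ha hp i; rewrite coefZ; exact: SM. Qed.

Lemma coefs_inXn n : coefs_in 'X^n.
Proof. by move=> i; rewrite coefXn; case: eqP. Qed.

Lemma subring_natmul a n : S a -> S (a *+ n).
Proof. by move=> h; elim: n => [|n IH]; rewrite ?mulr0n // mulrS; exact: SD. Qed.

Lemma coefs_in_deriv p : coefs_in p -> coefs_in p^`().
Proof. by move=> hp i; rewrite coef_deriv; exact: subring_natmul. Qed.

Lemma coefs_in_nderivn p n : coefs_in p -> coefs_in p^`N(n).
Proof. by move=> hp i; rewrite coef_nderivn; exact: subring_natmul. Qed.

Lemma horner_in p : coefs_in p -> S' p.[t].
Proof.
move=> hp; rewrite horner_coef; apply: big_ind => [|a b ha hb|i _]; [exact: SS'|exact: S'D|].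
apply: S'M; first exact: SS'.
by elim: (nat_of_ord i) => [|n IH]; rewrite ?expr0 ?exprS; [exact: SS'|exact: S'M].
Qed.

Lemma JN a : S a -> J a -> J (- a).
Proof. by move=> ha hJ; rewrite -mulN1r; apply: JM => //; apply/SS'/SN. Qed.

Lemma strip_lead p : coefs_in p -> J p.[t] -> (exists i, ~ J p`_i) ->
  exists p', [/\ coefs_in p', J p'.[t], ~ J (lead_coef p') & (size p' <= size p)%N].
Proof.
have [n] := ubnP (size p); elim: n p => // n IH p sn hp Jp [i hi].
have p0 : p != 0 by apply: contra_notN hi => /eqP ->; rewrite coef0.
have [Jl|Jl] := pselect (J (lead_coef p)); last by exists p.
pose q := p - lead_coef p *: 'X^((size p).-1).
have hl : S (lead_coef p) by exact: hp.
have hq : coefs_in q.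
  by apply: coefs_inD => //; apply: coefs_inN; apply: coefs_inZ => //; exact: coefs_inXn.
have sq : (size q < size p)%N.
  have sp0 : (0 < size p)%N by rewrite size_poly_gt0.
  rewrite -(prednK sp0) ltnS; apply/leq_sizeP => j hj.
  rewrite coefB coefZ coefXn; case: eqP => [->|/eqP jn]; first by rewrite mulr1 subrr.
  by rewrite mulr0 subr0 nth_default // -(prednK sp0) ltn_neqAle eq_sym jn.
have Jq : J q.[t].
  rewrite hornerD hornerN hornerZ hornerXn; apply: JD => //.
  rewrite -mulNr mulrC; apply: JM; last exact: JN.
  have -> : t ^+ (size p).-1 = ('X^((size p).-1) : {poly A}).[t] by rewrite hornerXn.
  exact/horner_in/coefs_inXn.
have hqi : exists i, ~ J q`_i.
  exists i; rewrite coefB coefZ coefXn; case: eqP => [ei|_]; last by rewrite mulr0 subr0.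
  by exfalso; apply: hi; rewrite ei.
have [p' [h1 h2 h3 h4]] := IH q (leq_trans sq sn) hq Jq hqi.
by exists p'; split => //; rewrite (leq_trans h4) // ltnW.
Qed.

Lemma pseudo_division P p : P != 0 -> coefs_in P -> coefs_in p ->
  exists k q r, [/\ coefs_in q, coefs_in r, (size r < size P)%N &
    lead_coef P ^+ k *: p = q * P + r].
Proof.
move=> P0 hP; have [n] := ubnP (size p); elim: n p => // n IH p sn hp.
have [lt|le] := ltnP (size p) (size P).
  by exists 0%N, 0, p; rewrite expr0 scale1r mul0r add0r; split => //; exact: coefs_in0.
have sP : (0 < size P)%N by rewrite size_poly_gt0.
have sp0 : (0 < size p)%N by exact: leq_trans le.
pose d := (size p - size P)%N.
have hX : coefs_in (lead_coef p *: ('X^d : {poly A})).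
  by apply: coefs_inZ; [exact: hp|exact: coefs_inXn].
pose p1 := lead_coef P *: p - lead_coef p *: 'X^d * P.
have hp1 : coefs_in p1.
  apply: coefs_inD; first by apply: coefs_inZ => //; exact: hP.
  by apply: coefs_inN; apply: coefs_inM.
have sp1 : (size p1 < size p)%N.
  rewrite -(prednK sp0) ltnS; apply/leq_sizeP => j hj.
  rewrite coefB coefZ -scalerAl coefZ coefXnM.
  have -> : (j < d)%N = false by rewrite /d; move: le sP hj; move: (size p) (size P) => u v; lia.
  have [e|/eqP jn] := eqVneq j (size p).-1.
    rewrite e /d -/(lead_coef p) (_ : ((size p).-1 - (size p - size P) = (size P).-1)%N); last first.
      by move: le sP; move: (size p) (size P) => u v; lia.
    by rewrite mulrC -/(lead_coef P) subrr.
  rewrite !nth_default ?mulr0 ?subrr //; rewrite /d; move: le sP hj jn; move: (size p) (size P) => u v; lia.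
have [k [q [r [hq hr sr E]]]] := IH p1 (leq_trans sp1 sn) hp1.
exists k.+1, (q + lead_coef P ^+ k *: (lead_coef p *: 'X^d)), r; split => //.
  by apply: coefs_inD => //; apply: coefs_inZ => //; apply: subring_exp; exact: hP.
rewrite exprSr -scalerA mulrDl addrAC -E /p1 scalerBr -scalerAl -!scalerAl subrK.
by [].
Qed.

(** [P] has least size among the polynomials that fall into [J] at [t] and have a leading
    coefficient outside [J]. By minimality the pseudo-remainders have all their coefficients in [J].
    The derivative is too short to fall into [J] at [t], since its top coefficient, a positive
    integer times that of [P], is outside [J]. *)
Lemma euclid (ps : seq {poly A}) : (forall p, p \in ps -> coefs_in p /\ J p.[t]) ->
  (forall p, p \in ps -> forall i, J p`_i) \/
  exists P, [/\ coefs_in P, J P.[t], ~ J (P^`()).[t], ~ J (lead_coef P) &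
    forall p, p \in ps -> exists k q r, [/\ coefs_in q, coefs_in r,
      forall i, J r`_i & lead_coef P ^+ k *: p = q * P + r]].
Proof.
move=> hps.
have [[P0 hP0]|none] := pselect (exists P, [/\ coefs_in P, J P.[t] & ~ J (lead_coef P)]); last first.
  left => p /hps [h1 h2] i; apply: contrapT => hi; apply: none.
  by have [|p' [k1 k2 k3 _]] := strip_lead h1 h2; [exists i|exists p'].
right.
pose Q n := `[< exists P, [/\ coefs_in P, J P.[t], ~ J (lead_coef P) & size P = n] >].
have exQ : exists n, Q n by exists (size P0); apply/asboolP; exists P0; case: hP0.
case: (ex_minnP exQ) => n /asboolP [P [hP JP Jl sP]] minQ.
have min p : coefs_in p -> J p.[t] -> (size p < size P)%N -> forall i, J p`_i.
  move=> h1 h2 h3 i; apply: contrapT => hi.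
  have [|p' [k1 k2 k3 k4]] := strip_lead h1 h2; first by exists i.
  have : (n <= size p')%N by apply: minQ; apply/asboolP; exists p'.
  by rewrite -sP leqNgt (leq_ltn_trans k4 h3).
have PN0 : P != 0 by apply: contra_notN Jl => /eqP ->; rewrite lead_coef0.
have sP1 : (1 < size P)%N.
  rewrite ltnNge; apply: contra_notN Jl => /size1_polyC e.
  by move: JP; rewrite e lead_coefC hornerC.
exists P; split => //.
  move=> JP'; apply: Jl.
  have := min _ (coefs_in_deriv hP) JP' (lt_size_deriv PN0) (size P).-2.
  rewrite coef_deriv (_ : (size P).-2.+1 = (size P).-1); last by move: sP1; move: (size P) => v; lia.
  rewrite -/(lead_coef P) -mulr_natr => /Jprime [] //.
  - by apply/SS'/hP.
  - by apply/SS'/subring_natmul.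
  by rewrite (_ : (size P).-1 = (size P).-2.+1) => [/Jnat|]; last by move: sP1; move: (size P) => v; lia.
move=> p /hps [h1 h2]; have [k [q [r [hq hr sr E]]]] := pseudo_division PN0 hP h1.
exists k, q, r; split => //; apply: min => //.
have -> : r = lead_coef P ^+ k *: p - q * P by rewrite E addrC addKr.
rewrite hornerD hornerN hornerZ hornerM; apply: JD.
  by apply: JM => //; apply/SS'/subring_exp/hP.
rewrite -mulNr; apply: JM => //; rewrite -hornerN; exact/horner_in/coefs_inN.
Qed.

End PseudoDivision.

(** * Approximate zeros along an ultrafilter *)

Section FlatFunctions.
Context {R : realType} (T : Type) (U : set_system T) {UU : UltraFilter U}
  (r : T -> R) (r_gt0 : \forall u \near U, 0 < r u)
  (r_lim : forall e : R, 0 < e -> \forall u \near U, r u < e).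
Local Notation A := ((nat -> R) -> R).

(** In the application [r] is the distance to 0 of points of X, and flatness is vanishing to
    infinite order along the ultrafilter. *)
Definition flat (a : T -> R) := forall s, \forall u \near U, `|a u| <= r u ^+ s.

Lemma near_small C s : 0 <= C -> \forall u \near U, C * r u ^+ s.+1 <= r u ^+ s.
Proof.
move=> C0; have C1 : 0 < (C + 1)^-1 by rewrite invr_gt0; lra.
near=> u.
have r0 : 0 < r u by near: u.
have rC : r u < (C + 1)^-1 by near: u; exact: r_lim.
rewrite exprS mulrA ler_piMl ?exprn_ge0 ?(ltW r0) //.
have : r u * (C + 1) <= 1 by rewrite -ler_pdivlMr ?mul1r ?ltW //; lra.
by nra.
Unshelve. all: by end_near. Qed.

Lemma flat_le a b : flat b -> (\forall u \near U, `|a u| <= `|b u|) -> flat a.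
Proof.
move=> hb hab s; near=> u; apply: (@le_trans _ _ `|b u|); near: u => //; exact: hb.
Unshelve. all: by end_near. Qed.

Lemma flat_bounded a b C : flat b -> (\forall u \near U, `|a u| <= C) ->
  flat (fun u => a u * b u).
Proof.
move=> hb ha s.
have C0 : 0 <= `|C| by [].
have h1 := near_small s C0; have h2 := hb s.+1.
near=> u; rewrite normrM; apply: (@le_trans _ _ (`|C| * r u ^+ s.+1)); last by near: u.
apply: ler_pM => //; last by near: u.
by apply: le_trans (ler_norm C); near: u.
Unshelve. all: by end_near. Qed.

Lemma flatD a b : flat a -> flat b -> flat (fun u => a u + b u).
Proof.
move=> ha hb s; have C0 : 0 <= 2 :> R by [].
have h1 := near_small s C0; have h2 := ha s.+1; have h3 := hb s.+1.
near=> u; apply: (le_trans (ler_normD _ _)).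
apply: (@le_trans _ _ (2 * r u ^+ s.+1)); last by near: u.
rewrite mulrDl mul1r; apply: lerD; by near: u.
Unshelve. all: by end_near. Qed.

Lemma not_flat a : ~ flat a -> exists s, \forall u \near U, r u ^+ s < `|a u|.
Proof.
move=> h; apply: contrapT => H; apply: h => s.
have [//|h] := in_ultra_setVsetC [set u | `|a u| <= r u ^+ s] UU.
exfalso; apply: H; exists s; apply: filterS h => u /=.
by move/negP; rewrite -ltNge.
Qed.

(** An ultrafilter decides every inequality, so a function that is not flat exceeds some power of
    [r]; a product of two such functions exceeds the product of the powers. *)
Lemma flat_prime a b : flat (fun u => a u * b u) -> flat a \/ flat b.
Proof.
move=> h; have [|ha] := pselect (flat a); first by left.
have [|hb] := pselect (flat b); first by right.
have [s hs] := not_flat ha; have [s' hs'] := not_flat hb.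
have hh := h (s + s')%N.
have [u] : exists u, `|a u * b u| <= r u ^+ (s + s') /\ (r u ^+ s < `|a u| /\ r u ^+ s' < `|b u|) /\ 0 < r u.
  apply: (@filter_ex _ U).
  by apply: filterI => //; apply: filterI => //; apply: filterI.
move=> [h1 [[h2 h3] h4]]; exfalso; move: h1; apply/negP; rewrite -ltNge exprD normrM.
by apply: ltr_pM; rewrite ?exprn_ge0 // ltW.
Qed.

Lemma flat_cst c : flat (fun=> c) -> c = 0.
Proof.
move=> h; apply/eqP; rewrite -normr_le0 leNgt; apply/negP => c0.
have [u] : exists u, `|c| <= r u ^+ 1 /\ r u < `|c|.
  by apply: (@filter_ex _ U); apply: filterI; [exact: h|exact: r_lim].
by rewrite expr1 => -[h1]; rewrite ltNge h1.
Qed.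

Lemma flat0 : flat (fun=> 0).
Proof.
by move=> s; near=> u; rewrite normr0 exprn_ge0 // ltW //; near: u.
Unshelve. all: by end_near. Qed.

Definition infinitesimal N (x : T -> nat -> R) :=
  forall e, 0 < e -> \forall u \near U, pd N (fun=> e) (x u).

Lemma infinitesimalS N x : infinitesimal N.+1 x -> infinitesimal N x.
Proof. by move=> h e /h; apply: filterS => u; exact: pdS. Qed.

Lemma near_bounded N x (f : A) : infinitesimal N x -> anal N f ->
  exists C, \forall u \near U, `|f (x u)| <= C.
Proof.
move=> hx /anal_bounded[rho [C [p _ h]]]; exists C.
by apply: filterS (hx _ p) => u; exact: h.
Qed.

Lemma add_at (f g : A) z : (f + g) z = f z + g z. Proof. by []. Qed.
Lemma mul_at (f g : A) z : (f * g) z = f z * g z. Proof. by []. Qed.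
Lemma exp_at (f : A) n z : (f ^+ n) z = f z ^+ n.
Proof. by elim: n => [|n IH]; rewrite ?expr0 // !exprS mul_at IH. Qed.
Lemma sum_at (I : Type) (s : seq I) (P : pred I) (f : I -> A) z :
  (\sum_(i <- s | P i) f i) z = \sum_(i <- s | P i) f i z.
Proof. by elim/big_rec2: _ => // i y1 y2 _ <-. Qed.

(** Polynomials in the last variable are elements of [{poly A}] over the ring [A] of all functions;
    evaluation at [coord N] turns them back into functions. *)
Definition coord N : A := fun z => z N.

Lemma horner_at (p : {poly A}) (t : A) z :
  p.[t] z = \sum_(i < size p) p`_i z * t z ^+ i.
Proof. by rewrite horner_coef sum_at; apply: eq_bigr => i _; rewrite mul_at exp_at. Qed.

Lemma euclid_flat N x (ps : seq {poly A}) : infinitesimal N.+1 x ->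
  (forall p, p \in ps -> coefs_in (anal N) p /\ flat (fun u => p.[coord N] (x u))) ->
  (forall p, p \in ps -> forall i, flat (fun u => p`_i (x u))) \/
  exists P : {poly A}, [/\ coefs_in (anal N) P, flat (fun u => P.[coord N] (x u)),
      ~ flat (fun u => P^`().[coord N] (x u)), ~ flat (fun u => lead_coef P (x u)) &
    forall p, p \in ps -> exists k q s, [/\ coefs_in (anal N) q, coefs_in (anal N) s,
      forall i, flat (fun u => s`_i (x u)) & lead_coef P ^+ k *: p = q * P + s]].
Proof.
move=> hx hps.
pose J (f : A) := flat (fun u => f (x u)).
apply: (@euclid A (anal N) (anal N.+1) J (coord N)) => //.
- exact: anal_cst.
- exact: anal_cst.
- by move=> a b; exact: anal_add.
- by move=> a; exact: anal_opp.
- by move=> a b; exact: anal_mul.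
- by move=> a; exact: anal_low.
- exact: anal_proj.
- by move=> a b; exact: anal_add.
- by move=> a b; exact: anal_mul.
- exact: flat0.
- by move=> a b; exact: flatD.
- by move=> a b /(near_bounded hx)[C hC] hb; exact: flat_bounded hC.
- by move=> a b _ _; exact: flat_prime.
- move=> n h; have /flat_cst /eqP : flat (fun=> n.+1%:R).
    apply: (flat_le h); near=> u.
    have -> : (n.+1%:R : A) (x u) = n.+1%:R.
      by rewrite -[n.+1]card_ord -!sumr_const sum_at.
    by [].
  by rewrite pnatr_eq0.
Unshelve. all: by end_near. Qed.

Definition setc N (z : nat -> R) t : nat -> R := fun i => if i == N then t else z i.

Lemma anal_setc N (f : A) : anal N f -> exists2 rho, 0 < rho &
  forall z t, pd N (fun=> rho) z -> f (setc N z t) = f z.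
Proof.
move=> /anal_dep[rho [p h]]; exists rho => // z t hz; apply/esym/h => // i iN.
by rewrite /setc ltn_eqF.
Qed.

Lemma seq_min (I : eqType) (s : seq I) (P : I -> R -> Prop) :
  (forall i rho rho', 0 < rho' <= rho -> P i rho -> P i rho') ->
  (forall i, i \in s -> exists2 rho, 0 < rho & P i rho) ->
  exists2 rho, 0 < rho & forall i, i \in s -> P i rho.
Proof.
move=> hP; elim: s => [|i s IH] h; first by exists 1.
have [|rho p h1] := IH; first by move=> j js; apply: h; rewrite inE js orbT.
have [rho' p' h2] := h i (mem_head _ _).
have m0 : 0 < Num.min rho rho' by rewrite lt_min p.
exists (Num.min rho rho') => // j; rewrite inE => /orP[/eqP ->|js].
  by apply: hP h2; rewrite m0 ge_min lexx orbT.
by apply: hP (h1 j js); rewrite m0 ge_min lexx.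
Qed.

Lemma coefs_setc N (p : {poly A}) : coefs_in (anal N) p -> exists2 rho, 0 < rho &
  forall z t i, pd N (fun=> rho) z -> p`_i (setc N z t) = p`_i z.
Proof.
move=> hp.
have [rho p0 h] : exists2 rho, 0 < rho & forall f, f \in (p : seq A) ->
    forall z t, pd N (fun=> rho) z -> f (setc N z t) = f z.
  apply: (@seq_min _ p (fun f rho => forall z t, pd N (fun=> rho) z -> f (setc N z t) = f z)).
    move=> f rho rho' /andP[_ h1] h2 z t hz; apply: h2 => i /hz /le_trans; exact.
  by move=> f /(nthP 0)[i _ <-]; have [rho p0 h] := anal_setc (hp i); exists rho.
exists rho => // z t i hz; have [ip|ip] := ltnP i (size p); last by rewrite nth_default.
by apply: h => //; exact: mem_nth.
Qed.

Lemma horner_setc N (p : {poly A}) : coefs_in (anal N) p -> exists2 rho, 0 < rho &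
  forall z h, pd N (fun=> rho) z -> p.[coord N] (setc N z (z N + h)) =
    \sum_(i < size p) p^`N(i).[coord N] z * h ^+ i.
Proof.
move=> hp; have [rho p0 hr] := coefs_setc hp; exists rho => // z h hz.
rewrite horner_at.
transitivity (p.[coord N + (fun=> h)] z).
  rewrite horner_at; apply: eq_bigr => i _; rewrite hr //.
  by congr (_ * _ ^+ _); rewrite add_at /coord /setc eqxx.
rewrite nderiv_taylor ?sum_at; last exact: mulrC.
by apply: eq_bigr => i _; rewrite mul_at exp_at.
Qed.

Lemma anal_horner N (p : {poly A}) : coefs_in (anal N) p -> anal N.+1 p.[coord N].
Proof.
move=> hp; apply: (@anal_ext _ _ (fun z => \sum_(i < size p) p`_i z * z N ^+ i) _ 1 ltr01).
  by move=> z _; rewrite horner_at.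
apply: anal_sum => i _; apply: anal_mul; first by apply: anal_low; exact: hp.
by apply: anal_exp; exact: anal_proj.
Qed.

(** At distance h from 0 the linear term outweighs the constant and the higher terms, so the values
    at h and -h have opposite signs. *)
Lemma poly_root_near (c : nat -> R) n (h B v : R) : (1 < n)%N -> 0 < h <= 1 ->
  (forall i, `|c i| <= B) -> `|c 0%N| <= v -> v + n%:R * B * h ^+ 2 < `|c 1%N| * h ->
  exists2 k, `|k| <= h & \sum_(i < n) c i * k ^+ i = 0.
Proof.
move=> n1 /andP[h0 h1] hB hv hh.
pose q := \poly_(i < n) c i.
have qE k : q.[k] = \sum_(i < n) c i * k ^+ i by rewrite horner_poly.
have B0 : 0 <= B by exact: le_trans (hB 0%N).
have est k : `|k| = h -> `|q.[k] - c 1%N * k| < `|c 1%N| * h.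
  move=> kh; apply: le_lt_trans hh; rewrite qE.
  rewrite -(big_mkord xpredT (fun i => c i * k ^+ i)) big_ltn ?(ltnW n1) // big_ltn //.
  rewrite expr0 mulr1 expr1 addrCA [c 1%N * k + _]addrC addrK.
  apply: (le_trans (ler_normD _ _)); apply: lerD => //.
  apply: (le_trans (ler_norm_sum _ _ _)).
  apply: (@le_trans _ _ (\sum_(2 <= i < n) B * h ^+ 2)).
    rewrite big_nat [leRHS]big_nat; apply: ler_sum => i /andP[i2 _].
    rewrite normrM normrX kh; apply: ler_pM => //; first by rewrite exprn_ge0 // ltW.
    by apply: ler_wiXn2l => //; exact: ltW.
  rewrite sumr_const_nat -[leLHS]mulr_natl -mulrA ler_wpM2r //.
    by rewrite mulr_ge0 // exprn_ge0 // ltW.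
  by rewrite ler_nat leq_subr.
have hk : `|h| = h by rewrite gtr0_norm.
have hk' : `|- h| = h by rewrite normrN.
have le : - h <= h by lra.
have [c1|c1] := leP 0 (c 1%N).
  have [|k /andP[k1 k2] /eqP qk] := poly_ivt (p := q) le.
    have := est h hk; have := est _ hk'; rewrite (ger0_norm c1) !ltr_norml.
    by move=> /andP[a1 a2] /andP[a3 a4]; apply/andP; split; lra.
  by exists k; [rewrite ler_norml k1|rewrite -qE].
have [|k /andP[k1 k2] /eqP qk] := poly_ivt (p := - q) le.
  have := est h hk; have := est _ hk'; rewrite (ltr0_norm c1) !hornerN !ltr_norml.
  by move=> /andP[a1 a2] /andP[a3 a4]; apply/andP; split; lra.
exists k; first by rewrite ler_norml k1.
by rewrite -qE; move: qk; rewrite hornerN => /eqP; rewrite oppr_eq0 => /eqP.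
Qed.

End FlatFunctions.

(** * Lifting approximate zeros through one more variable *)

Section ApproximateLifting.
Context {R : realType} (T : Type) (U : set_system T) {UU : UltraFilter U}
  (r : T -> R) (r_gt0 : \forall u \near U, 0 < r u)
  (r_lim : forall e : R, 0 < e -> \forall u \near U, r u < e).
Local Notation A := ((nat -> R) -> R).
Local Notation flat := (@flat R T U r).
Local Notation infinitesimal := (@infinitesimal R T U).

(** An approximation property of Artin type: points along which germs are flat can be moved to
    common exact zeros, by less than any prescribed power of [r]. *)
Definition approximable N := forall (x : T -> nat -> R) (fs : seq A),
  infinitesimal N x -> (forall f, f \in fs -> anal N f /\ flat (fun u => f (x u))) ->
  forall s, \forall u \near U, exists2 y : nat -> R,
    (forall i, (i < N)%N -> `|y i - x u i| <= r u ^+ s) & forall f, f \in fs -> f y = 0.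

Lemma coefs_setc_seq N (ps : seq {poly A}) : (forall p, p \in ps -> coefs_in (anal N) p) ->
  exists2 rho, 0 < rho & forall p, p \in ps ->
    forall z t i, pd N (fun=> rho) z -> p`_i (setc N z t) = p`_i z.
Proof.
move=> h; apply: (@seq_min _ _ ps (fun p rho =>
  forall z t i, pd N (fun=> rho) z -> p`_i (setc N z t) = p`_i z)).
  move=> p rho rho' /andP[_ h1] h2 z t i hz; apply: h2 => j /hz /le_trans; exact.
by move=> p /h hp; exact: coefs_setc.
Qed.

Lemma pd_near N rho (x : T -> nat -> R) : infinitesimal N x -> 0 < rho ->
  \forall u \near U, forall y : nat -> R, (forall i, (i < N)%N -> `|y i - x u i| <= r u) ->
    pd N (fun=> rho) y.
Proof.
move=> hx p; have p2 : 0 < rho / 2 by lra.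
have h1 := hx _ p2; have h2 := r_lim p2.
near=> u => y hy i iN.
have h3 : pd N (fun=> rho / 2) (x u) by near: u.
have h4 : r u < rho / 2 by near: u.
have := h3 i iN; have := hy i iN; rewrite -{2}[y i](subrK (x u i)).
have := ler_normD (y i - x u i) (x u i); lra.
Unshelve. all: by end_near. Qed.

(** If all coefficients are flat, they are made to vanish by moving the first N coordinates, and the
    last one is kept. Otherwise this is done for the coefficients of the remainders modulo [P], and
    then the last coordinate is moved to a nearby root of [P], which exists because the derivative
    exceeds a power of [r]. The leading coefficient is nonzero there, so all of [ps] vanish. *)
Lemma poly_lift N (x : T -> nat -> R) (ps : seq {poly A}) s : approximable N ->
  infinitesimal N.+1 x ->
  (forall p, p \in ps -> coefs_in (anal N) p /\ flat (fun u => p.[coord N] (x u))) ->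
  \forall u \near U, exists2 y : nat -> R,
    (forall i, (i < N.+1)%N -> `|y i - x u i| <= r u ^+ s) &
    forall p, p \in ps -> p.[coord N] y = 0.
Proof.
move=> app hx hps; have hxN : infinitesimal N x by exact: infinitesimalS hx.
have [case1|[P [hP flatP nflatP' nflatl hdiv]]] := euclid_flat r_gt0 r_lim hx hps.
  have [|rho p0 hset] := @coefs_setc_seq N ps; first by move=> p /hps[].
  have hfs f : f \in flatten [seq polyseq p | p <- ps] -> anal N f /\ flat (fun u => f (x u)).
    move=> /flattenP[_ /mapP[p pps ->] /(nthP 0)[i _ <-]].
    by split; [have [hp _] := hps _ pps; exact: hp|exact: case1].
  have h1 := app x _ hxN hfs s.+1; have h2 := pd_near hxN p0.
  have h3 := r_lim ltr01.
  near=> u.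
  have r0 : 0 < r u by near: u.
  have r1 : r u < 1 by near: u.
  have [y hy hf] : exists2 y : nat -> R,
    (forall i, (i < N)%N -> `|y i - x u i| <= r u ^+ s.+1) &
    forall f, f \in flatten [seq polyseq p | p <- ps] -> f y = 0 by near: u.
  have pdy : pd N (fun=> rho) y.
    suff h : forall y : nat -> R, (forall i, (i < N)%N -> `|y i - x u i| <= r u) ->
      pd N (fun=> rho) y.
      apply: h => i iN; apply: le_trans (hy i iN) _.
      by rewrite exprS ler_piMr ?(ltW r0) // exprn_ile1 // ltW.
    by near: u.
  exists (setc N y (x u N)).
    move=> i; rewrite ltnS leq_eqVlt /setc => /orP[/eqP ->|iN].
      by rewrite eqxx subrr normr0 exprn_ge0 // ltW.
    rewrite ltn_eqF //; apply: le_trans (hy i iN) _.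
    by rewrite exprS ler_piMl ?exprn_ge0 // ltW.
  move=> p pps; rewrite horner_at big1 // => i _.
  rewrite hset // hf ?mul0r //; apply/flattenP; exists (polyseq p); last exact: mem_nth.
  by apply/mapP; exists p.
have hdiv' p : exists kqs : nat * {poly A} * {poly A}, p \in ps ->
   [/\ coefs_in (anal N) kqs.1.2, coefs_in (anal N) kqs.2,
    forall i, flat (fun u => kqs.2`_i (x u)) &
    lead_coef P ^+ kqs.1.1 *: p = kqs.1.2 * P + kqs.2].
  have [pps|pps] := boolP (p \in ps); last by exists (0%N, 0, 0).
  by have [k [q [t ht]]] := hdiv p pps; exists (k, q, t).
have [D hD] := choice hdiv'.
have [tau htau] := not_flat nflatP'.
have [sg hsg] := not_flat nflatl.
have sP : (1 < size P)%N.
  rewrite ltnNge; apply: contra_notN nflatP' => /size1_polyC ->.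
  by rewrite derivC horner0; exact: flat0.
have [rho1 [K1 [p1 K10 lip1]]] := anal_lip (anal_horner hP).
have hP' : coefs_in (anal N) P^`().
  apply: coefs_in_deriv => //; first exact: anal_cst.
  by move=> a b; exact: anal_add.
have [rho2 [K2 [p2 K20 lip2]]] := anal_lip (anal_horner hP').
have hlead : anal N (lead_coef P) by exact: hP.
have [rho3 [K3 [p3 K30 lip3]]] := anal_lip hlead.
have [rho4 p4 hset] : exists2 rho, 0 < rho & forall p, p \in [seq (D p).2 | p <- ps] ->
    forall z t i, pd N (fun=> rho) z -> p`_i (setc N z t) = p`_i z.
  by apply: coefs_setc_seq => _ /mapP[p pps ->]; have [] := hD p pps.
have [rho5 p5 hh] := horner_setc hP.
have [rho6 [p6 hB]] : exists rho, 0 < rho /\ forall i, (i < size P)%N ->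
    exists B, forall z, pd N.+1 (fun=> rho) z -> `|P^`N(i).[coord N] z| <= B.
  apply: (@fin_min _ (fun i rho => exists B, forall z, pd N.+1 (fun=> rho) z -> `|P^`N(i).[coord N] z| <= B)).
    move=> i rho rho' /andP[_ le] [B h]; exists B => z hz; apply: h => j /hz /le_trans; exact.
  move=> i _; have : anal N.+1 P^`N(i).[coord N].
    apply: anal_horner; apply: coefs_in_nderivn => //; first exact: anal_cst.
    by move=> a b; exact: anal_add.
  by move=> /anal_bounded[rho [C [p _ h]]]; exists rho; split => //; exists C.
have hB' i : exists B, 0 <= B /\ ((i < size P)%N -> forall z, pd N.+1 (fun=> rho6) z -> `|P^`N(i).[coord N] z| <= B).
  have [/hB[B h]|h] := ltnP i (size P); last by exists 0.
  by exists `|B|; split => // _ z /h /le_trans; apply; exact: ler_norm.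
have [Bs hBs] := choice hB'.
pose B := \sum_(i < size P) Bs i.
have Bs0 i : 0 <= Bs i by have [] := hBs i.
have hBB i z : (i < size P)%N -> pd N.+1 (fun=> rho6) z -> `|P^`N(i).[coord N] z| <= B.
  move=> iP hz; have [_ h] := hBs i; apply: le_trans (h iP z hz) _.
  by rewrite /B (bigD1 (Ordinal iP)) //= lerDl sumr_ge0.
have B0 : 0 <= B by exact: sumr_ge0.
(* The root is moved by at most r^e. With a derivative above r^tau, the linear term r^(tau + e) must
   beat the quadratic r^(2e) and the errors of order r^s' made in the first N coordinates: both 2e
   and s' exceed e + tau. As s' also exceeds sg, the leading coefficient stays nonzero. *)
pose e := (s + tau + 2)%N; pose s' := (e + tau + sg + 1)%N.
pose KK := 1 + K1 + K2 + K3 + (size P)%:R * B.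
have nB0 : 0 <= (size P)%:R * B by rewrite mulr_ge0.
have KK0 : 0 < KK by rewrite /KK; lra.
have hfs f : f \in flatten [seq polyseq (D p).2 | p <- ps] -> anal N f /\ flat (fun u => f (x u)).
  move=> /flattenP[_ /mapP[p pps ->] /(nthP 0)[i _ <-]].
  by have [_ h1 h2 _] := hD _ pps; split; [exact: h1|exact: h2].
have n1 := app x _ hxN hfs s'.
have p_all : 0 < Num.min rho3 (Num.min rho4 rho5) by rewrite !lt_min p3 p4 p5.
have p_all' : 0 < Num.min rho1 (Num.min rho2 rho6) by rewrite !lt_min p1 p2 p6.
have n2 := pd_near hxN p_all; have n3 := pd_near hx p_all'.
have n4 : \forall u \near U, r u < KK^-1 by apply: r_lim; rewrite invr_gt0.
have n5 := r_lim ltr01.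
have n6 := flatP s'.
near=> u.
have r0 : 0 < r u by near: u.
have r1 : r u < 1 by near: u.
have rK : KK * r u < 1.
  have : r u < KK^-1 by near: u.
  by rewrite -[KK^-1]mul1r ltr_pdivlMr // mulrC.
have [y' hy' hf] : exists2 y : nat -> R,
    (forall i, (i < N)%N -> `|y i - x u i| <= r u ^+ s') &
    forall f, f \in flatten [seq polyseq (D p).2 | p <- ps] -> f y = 0 by near: u.
have N2 : forall y : nat -> R, (forall i, (i < N)%N -> `|y i - x u i| <= r u) ->
      pd N (fun=> Num.min rho3 (Num.min rho4 rho5)) y by near: u.
have N3 : forall y : nat -> R, (forall i, (i < N.+1)%N -> `|y i - x u i| <= r u) ->
      pd N.+1 (fun=> Num.min rho1 (Num.min rho2 rho6)) y by near: u.
have P0 : `|P.[coord N] (x u)| <= r u ^+ s' by near: u; exact: n6.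
have P1 : r u ^+ tau < `|P^`().[coord N] (x u)| by near: u.
have L1 : r u ^+ sg < `|lead_coef P (x u)| by near: u.
have rle a b : (a <= b)%N -> r u ^+ b <= r u ^+ a.
  by move=> ab; apply: ler_wiXn2l => //; exact: ltW.
have rge0 a : 0 <= r u ^+ a by rewrite exprn_ge0 // ltW.
have rgt0 a : 0 < r u ^+ a by rewrite exprn_gt0.
have r11 : r u ^+ 1 = r u by rewrite expr1.
have y1 i : (i < N)%N -> `|y' i - x u i| <= r u.
  by move=> iN; apply: le_trans (hy' i iN) _; rewrite -{2}r11; apply: rle; rewrite /s'; clear; lia.
have pdsub (rho rho' : R) n z : rho <= rho' -> pd n (fun=> rho) z -> pd n (fun=> rho') z.
  by move=> le h i /h /le_trans; apply.
pose y0 := setc N y' (x u N).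
have y0E i : (i < N)%N -> y0 i = y' i by move=> iN; rewrite /y0 /setc ltn_eqF.
have y0N : y0 N = x u N by rewrite /y0 /setc eqxx.
have hy0 i : (i < N.+1)%N -> `|y0 i - x u i| <= r u ^+ s'.
  rewrite ltnS leq_eqVlt => /orP[/eqP ->|iN]; first by rewrite y0N subrr normr0.
  by rewrite y0E // hy'.
have y01 i : (i < N.+1)%N -> `|y0 i - x u i| <= r u.
  by move=> iN; apply: le_trans (hy0 i iN) _; rewrite -{2}r11; apply: rle; rewrite /s'; clear; lia.
have x01 i : (i < N.+1)%N -> `|x u i - x u i| <= r u by move=> _; rewrite subrr normr0 ltW.
have pd0 := N3 _ y01; have pdx := N3 _ x01.
have m1 : Num.min rho1 (Num.min rho2 rho6) <= rho1 by rewrite ge_min lexx.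
have m2 : Num.min rho1 (Num.min rho2 rho6) <= rho2 by rewrite !ge_min lexx !orbT.
have m6 : Num.min rho1 (Num.min rho2 rho6) <= rho6 by rewrite !ge_min lexx !orbT.
have m3 : Num.min rho3 (Num.min rho4 rho5) <= rho3 by rewrite ge_min lexx.
have m4 : Num.min rho3 (Num.min rho4 rho5) <= rho4 by rewrite !ge_min lexx !orbT.
have m5 : Num.min rho3 (Num.min rho4 rho5) <= rho5 by rewrite !ge_min lexx !orbT.
have v0 : `|P.[coord N] y0| <= (1 + K1) * r u ^+ s'.
  have := lip1 _ _ _ (pdsub _ _ _ _ m1 pd0) (pdsub _ _ _ _ m1 pdx) hy0 (rge0 _).
  have := ler_normD (P.[coord N] y0 - P.[coord N] (x u)) (P.[coord N] (x u)).
  rewrite subrK mulrDl mul1r; lra.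
have v1 : r u ^+ tau - K2 * r u ^+ s' <= `|P^`().[coord N] y0|.
  have := lip2 _ _ _ (pdsub _ _ _ _ m2 pd0) (pdsub _ _ _ _ m2 pdx) hy0 (rge0 _).
  have := ler_normD (P^`().[coord N] y0 - P^`().[coord N] (x u)) (- P^`().[coord N] y0).
  rewrite addrAC subrr add0r !normrN; lra.
pose c i := if (i < size P)%N then P^`N(i).[coord N] y0 else 0.
have hcB i : `|c i| <= B.
  by rewrite /c; case: ltnP => iP; [exact: hBB (pdsub _ _ _ _ m6 pd0)|rewrite normr0].
have he01 : 0 < r u ^+ e <= 1 by rewrite rgt0 exprn_ile1 // ltW.
have c0 : `|c 0%N| <= (1 + K1) * r u ^+ s'.
  by rewrite /c (ltnW sP) nderivn0.
have c1 : (1 + K1) * r u ^+ s' + (size P)%:R * B * (r u ^+ e) ^+ 2 < `|c 1%N| * r u ^+ e.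
  rewrite /c sP nderivn1.
  apply: (@lt_le_trans _ _ ((r u ^+ tau - K2 * r u ^+ s') * r u ^+ e)); last first.
    by rewrite ler_wpM2r.
  have a1 : r u ^+ s' <= r u ^+ (e + tau) * r u by rewrite -exprSr; apply: rle; rewrite /s'; clear; lia.
  have a2 : (r u ^+ e) ^+ 2 <= r u ^+ (e + tau) * r u.
    by rewrite -exprSr -exprM; apply: rle; rewrite /e; clear; lia.
  have a3 : r u ^+ s' * r u ^+ e <= r u ^+ (e + tau) * r u.
    by rewrite -exprSr -exprD; apply: rle; rewrite /s'; clear; lia.
  have a4 : r u ^+ tau * r u ^+ e = r u ^+ (e + tau) by rewrite -exprD addnC.
  rewrite mulrBl a4 -[K2 * _ * _]mulrA; have := rgt0 (e + tau)%N.
  set w := r u ^+ (e + tau) in a1 a2 a3 *; set nB := (size P)%:R * B in rK KK0 nB0 *.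
  move=> w0.
  have b1 : (1 + K1) * r u ^+ s' <= (1 + K1) * (w * r u) by apply: ler_wpM2l => //; lra.
  have b2 : nB * (r u ^+ e) ^+ 2 <= nB * (w * r u) by apply: ler_wpM2l.
  have b3 : K2 * (r u ^+ s' * r u ^+ e) <= K2 * (w * r u) by apply: ler_wpM2l.
  have b4 : (1 + K1 + K2 + nB) * (w * r u) < w.
    have -> : (1 + K1 + K2 + nB) * (w * r u) = w * ((1 + K1 + K2 + nB) * r u) by ring.
    rewrite -[ltRHS]mulr1 ltr_pM2l //; apply: le_lt_trans rK.
    by rewrite ler_wpM2r ?(ltW r0) // /KK -/nB; lra.
  by lra.
have [k hk Ek] := poly_root_near sP he01 hcB c0 c1.
pose y := setc N y' (x u N + k).
have yE : y = setc N y0 (y0 N + k).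
  by apply/funext => i; rewrite /y y0N /y0 /setc; case: eqP.
have Py : P.[coord N] y = 0.
  rewrite yE hh; last first.
    by apply: (pdsub _ _ _ _ m5); apply: N2 => i iN; rewrite y0E // y1.
  by rewrite -[RHS]Ek; apply: eq_bigr => i _; rewrite /c ltn_ord.
exists y.
  move=> i; rewrite ltnS leq_eqVlt /y /setc => /orP[/eqP ->|iN].
    by rewrite eqxx addrAC subrr add0r; apply: le_trans hk _; apply: rle; rewrite /e; clear; lia.
  rewrite ltn_eqF //; apply: le_trans (hy' i iN) _; apply: rle; rewrite /s' /e; clear; lia.
have yy' i : (i < N)%N -> y i = y' i by move=> iN; rewrite /y /setc ltn_eqF.
have pdyy : pd N (fun=> Num.min rho3 (Num.min rho4 rho5)) y.
  by apply: N2 => i iN; rewrite yy' // y1.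
have pdxx : pd N (fun=> Num.min rho3 (Num.min rho4 rho5)) (x u).
  by apply: N2 => i iN; apply: x01; exact: ltnW.
have ly : lead_coef P y != 0.
  have hd i : (i < N)%N -> `|y i - x u i| <= r u ^+ s' by move=> iN; rewrite yy' // hy'.
  have := lip3 _ _ _ (pdsub _ _ _ _ m3 pdyy) (pdsub _ _ _ _ m3 pdxx) hd (rge0 _).
  apply: contraTN => /eqP ->; rewrite sub0r normrN -ltNge.
  apply: le_lt_trans L1.
  apply: (@le_trans _ _ (K3 * (r u ^+ sg * r u))).
    by apply: ler_wpM2l => //; rewrite -exprSr; apply: rle; rewrite /s'; clear; lia.
  rewrite mulrCA ler_piMr //; apply: le_trans (ltW rK).
  by rewrite ler_wpM2r ?(ltW r0) // /KK; lra.
move=> p pps; have [h1 h2 h3 h4] := hD p pps.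
have := congr1 (fun q : {poly A} => q.[coord N] y) h4.
rewrite hornerZ hornerD hornerM add_at !mul_at exp_at Py mulr0 add0r.
have Dp : (D p).2 \in [seq (D p).2 | p <- ps] by apply/mapP; exists p.
have -> : (D p).2.[coord N] y = 0.
  rewrite horner_at big1 // => i _.
  rewrite /y (hset _ Dp); last by apply: (pdsub _ _ _ _ m4); apply: N2.
  rewrite hf ?mul0r //; apply/flattenP; exists (polyseq (D p).2); last exact: mem_nth.
  by apply/mapP; exists p.
by move=> /eqP; rewrite mulf_eq0 expf_eq0 (negbTE ly) andbF /= => /eqP.
Unshelve. all: by end_near. Qed.

End ApproximateLifting.

(** * Approximation by zeros, by induction on the number of variables *)

Section ApproximateZerosInduction.
Context {R : realType} (T : Type) (U : set_system T) {UU : UltraFilter U}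
  (r : T -> R) (r_gt0 : \forall u \near U, 0 < r u)
  (r_lim : forall e : R, 0 < e -> \forall u \near U, r u < e).
Local Notation A := ((nat -> R) -> R).
Local Notation flat := (@flat R T U r).
Local Notation infinitesimal := (@infinitesimal R T U).
Local Notation approximable := (@approximable R T U r).

(** Division by the regular germ [f0] replaces it by a monic polynomial [W] and each germ f by its
    remainder [P f]; these are still flat, so [poly_lift] applies. At a zero of [W] the factor [q0],
    bounded away from 0, forces [f0] to vanish, and then every germ equals its remainder, which is
    0. *)
Lemma approximable_regular N (x : T -> nat -> R) (fs : seq A) (f0 : A) s : approximable N ->
  infinitesimal N.+1 x ->
  (forall f, f \in fs -> anal N.+1 f /\ flat (fun u => f (x u))) -> f0 \in fs ->
  (forall rho, 0 < rho -> exists2 t, `|t| <= rho & f0 (axis N t) != 0) ->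
  \forall u \near U, exists2 y : nat -> R,
    (forall i, (i < N.+1)%N -> `|y i - x u i| <= r u ^+ s) & forall f, f \in fs -> f y = 0.
Proof.
move=> app hx hfs f0fs reg.
have [rho p hrho] : exists2 rho, 0 < rho & forall f, f \in fs -> exists C, An N.+1 (fun=> rho) C f.
  apply: (@seq_min _ _ fs (fun f rho => exists C, An N.+1 (fun=> rho) C f)).
    by move=> f rho rho' h [C hC]; exists C; apply: An_cst_shrink hC.
  by move=> f /hfs[[rho [C [p h]]] _]; exists rho => //; exists C.
have [C0 /AnS[a [G [h1 h2 h3]]]] := hrho _ f0fs.
have p' : forall i : nat, 0 < (fun=> rho) i by [].
have exb : exists j, a j (fun=> 0) != 0.
  apply: contrapT => H; have [t ht /eqP] := reg _ p; apply.
  have pdt : pd N.+1 (fun=> rho) (axis N t).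
    by move=> i _; rewrite /axis; case: eqP => _ //; rewrite normr0 ltW.
  rewrite h3 // (@rs_fin _ _ 0) ?big_geq // => j _.
  have -> : a j (axis N t) = a j (fun=> 0).
    apply: (An_dep (h1 j)) (pdS pdt) => i iN; by rewrite /axis ltn_eqF.
  have [->|aj] := eqVneq (a j (fun=> 0)) 0; first by rewrite mul0r.
  by exfalso; apply: H; exists j.
case: (ex_minnP exb) => b ab bmin.
have a0 j : (j < b)%N -> a j (fun=> 0) = 0.
  by move=> jb; apply/eqP; apply: contraTT jb => /bmin; rewrite -leqNgt.
have [r' [hr' [q0 [w [d [d0 [Cq hq0] hw hqw]]]] hdiv]] :=
  weierstrass_division p' h1 h2 h3 a0 ab.
have r'0 i : 0 < r' i by have /andP[] := hr' i.
have hdiv' f : exists qw : A * (nat -> A), f \in fs ->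
   [/\ exists C', An N.+1 r' C' qw.1, forall j, exists C', An N r' C' (qw.2 j) &
          forall x, pd N.+1 r' x ->
            f x = qw.1 x * f0 x + \sum_(0 <= j < b) qw.2 j x * x N ^+ j].
  have [ffs|] := boolP (f \in fs); last by exists (0, fun=> 0).
  have [C hC] := hrho f ffs; have [q [v hv]] := hdiv f C hC; by exists (q, v).
have [D hD] := choice hdiv'.
pose W : {poly A} := 'X^b - \poly_(j < b) w j.
pose P f : {poly A} := \poly_(j < b) (D f).2 j.
have horner_poly_at (v : nat -> A) z : (\poly_(j < b) v j).[coord N] z = \sum_(0 <= j < b) v j z * z N ^+ j.
  by rewrite horner_poly sum_at big_mkord; apply: eq_bigr => j _; rewrite mul_at exp_at.
have WE z : pd N.+1 r' z -> W.[coord N] z = q0 z * f0 z.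
  move=> hz; have [_ E] := hqw z hz.
  rewrite hornerD hornerN add_at hornerXn exp_at /coord E -/(coord N).
  have -> : (- (\poly_(j < b) w j).[coord N]) z = - ((\poly_(j < b) w j).[coord N] z) by [].
  by rewrite horner_poly_at addrK.
have PE f z : f \in fs -> pd N.+1 r' z -> (P f).[coord N] z = f z - (D f).1 z * f0 z.
  by move=> ffs hz; have [_ _ h] := hD f ffs; rewrite horner_poly_at h // addrC addKr.
have [rho' [p'' hrho']] : exists rho, 0 < rho /\ forall i, (i < N.+1)%N -> rho <= r' i.
  apply: (@fin_min _ (fun i rho => rho <= r' i)) => [i r1 r2 /andP[_ k1] k2|i _].
    exact: le_trans k2.
  by exists (r' i).
have pdr z : pd N.+1 (fun=> rho') z -> pd N.+1 r' z.
  by move=> hz i iN; apply: le_trans (hz i iN) _; exact: hrho'.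
have nearx := hx _ p''.
have flatf0 : flat (fun u => f0 (x u)) by have [] := hfs _ f0fs.
have hps : forall p, p \in W :: [seq P f | f <- fs] ->
    coefs_in (anal N) p /\ flat (fun u => p.[coord N] (x u)).
  have cpoly (v : nat -> A) : (forall j, exists C', An N r' C' (v j)) ->
      coefs_in (anal N) (\poly_(j < b) v j).
    move=> hv i; rewrite coef_poly; case: ifP => _; last exact: anal_cst.
    by have [C hC] := hv i; exact: An_anal hC.
  move=> q; rewrite inE => /orP[/eqP ->|/mapP[f ffs ->]]; split.
  - apply: coefs_inD; first by move=> u v; exact: anal_add.
      by move=> i; rewrite coefXn; case: eqP => _; exact: anal_cst.
    by apply: coefs_inN; [move=> u; exact: anal_opp|exact: cpoly].
  - have h : flat (fun u => q0 (x u) * f0 (x u)).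
      apply: (@flat_bounded _ _ _ _ _ r_gt0 r_lim _ _ Cq) => //.
      by apply: filterS nearx => u hu; apply: An_bound hq0 _; exact: pdr.
    apply: (flat_le h); apply: filterS nearx => u hu.
    by rewrite WE //; exact: pdr.
  - by apply: cpoly; have [] := hD f ffs.
  have [[Cf hCf] _ _] := hD f ffs.
  have h : flat (fun u => f (x u) + (- (D f).1 (x u)) * f0 (x u)).
    apply: flatD => //; first by have [] := hfs f ffs.
    apply: (@flat_bounded _ _ _ _ _ r_gt0 r_lim _ _ Cf) => //.
    by apply: filterS nearx => u hu; rewrite normrN; apply: An_bound hCf _; exact: pdr.
  apply: (flat_le h); apply: filterS nearx => u hu.
  by rewrite PE ?mulNr //; exact: pdr.
have n1 := poly_lift (UU := UU) r_gt0 r_lim s.+1 app hx hps.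
have n2 := pd_near (UU := UU) r_lim hx p''; have n3 := r_lim ltr01.
near=> u.
have r0 : 0 < r u by near: u.
have r1 : r u < 1 by near: u.
have [y hy hf] : exists2 y : nat -> R,
    (forall i, (i < N.+1)%N -> `|y i - x u i| <= r u ^+ s.+1) &
    forall p, p \in W :: [seq P f | f <- fs] -> p.[coord N] y = 0 by near: u.
have N2 : forall y : nat -> R, (forall i, (i < N.+1)%N -> `|y i - x u i| <= r u) ->
      pd N.+1 (fun=> rho') y by near: u.
have pdy : pd N.+1 r' y.
  apply: pdr; apply: N2 => i iN; apply: le_trans (hy i iN) _.
  by rewrite exprS ler_piMr ?(ltW r0) // exprn_ile1 // ltW.
exists y.
  move=> i iN; apply: le_trans (hy i iN) _.
  by rewrite exprS ler_piMl ?exprn_ge0 // ltW.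
have f0y : f0 y = 0.
  have := WE y pdy; rewrite hf ?mem_head // => /esym/eqP.
  rewrite mulf_eq0 => /orP[/eqP q0y|/eqP //].
  by have [+ _] := hqw y pdy; rewrite q0y normr0 leNgt d0.
move=> f ffs; have := PE f y ffs pdy; rewrite hf; last first.
  by rewrite inE map_f // orbT.
by rewrite f0y mulr0 subr0.
Unshelve. all: by end_near. Qed.

Theorem approximate_zeros N : approximable N.
Proof.
elim: N => [|N IH] x fs hx hfs s.
  (* In no variables germs are constants, and a flat constant is 0. *)
  near=> u.
  have r0 : 0 < r u by near: u.
  exists (x u); first by [].
  move=> f /hfs[[rho [C [p [c [_ hc]]]]] hf].
  rewrite hc; apply: (flat_cst r_lim (c := c)).
  by apply: (flat_le hf); apply: filterE => v; rewrite hc.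
have [allz|] := pselect (forall f, f \in fs -> exists2 rho, 0 < rho &
    forall z, pd N.+1 (fun=> rho) z -> f z = 0).
  have [rho p h] : exists2 rho, 0 < rho & forall f, f \in fs ->
      forall z, pd N.+1 (fun=> rho) z -> f z = 0.
    apply: (@seq_min _ _ fs (fun f rho => forall z, pd N.+1 (fun=> rho) z -> f z = 0)) => //.
    move=> f rho rho' /andP[_ le] h z hz; apply: h => i /hz /le_trans; exact.
  have n1 := hx _ p; near=> u; exists (x u).
    by move=> i _; rewrite subrr normr0 exprn_ge0 // ltW //; near: u.
  by move=> f ffs; apply: h => //; near: u.
move=> /existsNP[f0 /not_implyP[f0fs nz]].
have [hf0 _] := hfs _ f0fs.
have nz' rho : 0 < rho -> exists2 z, pd N.+1 (fun=> rho) z & f0 z != 0.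
  move=> p; apply: contrapT => H; apply: nz; exists rho => // z hz.
  by apply/eqP; apply: contra_notT H => h; exists z.
have [a ha] := shear_regular hf0 nz'.
(* The inverse shear: the sheared germs take at [x'] the values of the original ones at [x], and
   shearing back costs a factor 1 + M in distances. *)
pose x' u i := if (i < N)%N then x u i - a i * x u N else x u i.
have shx u : shear N a (x' u) = x u.
  by apply/funext => i; rewrite /shear /x' ltnn; case: ltnP => // _; rewrite subrK.
have [M [M0 hM]] : exists M, 0 < M /\ forall i, (i < N)%N -> `|a i| <= M.
  exists (1 + \sum_(i < N) `|a i|); split; first by rewrite ltr_pwDl // sumr_ge0.
  move=> i iN; rewrite (bigD1 (Ordinal iN)) //=.
  by rewrite addrCA lerDl addr_ge0 // sumr_ge0.
have M1 : 0 < 1 + M by lra.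
have hx' : infinitesimal N.+1 x'.
  move=> e e0; have e1 : 0 < e / (1 + M) by rewrite divr_gt0.
  apply: filterS (hx _ e1) => u hu i iN; rewrite /x'.
  have hi := hu i iN; have hN := hu N (ltnSn N).
  have e2 : e / (1 + M) <= e by rewrite ler_pdivrMr //; nra.
  case: ltnP => h; last exact: le_trans e2.
  apply: (le_trans (ler_normB _ _)); rewrite normrM.
  have -> : e = e / (1 + M) + M * (e / (1 + M)) by field; lra.
  by apply: lerD => //; apply: ler_pM => //; exact: hM.
pose fs' : seq A := [seq (fun z => f (shear N a z)) : A | f <- fs].
have hfs' f : f \in fs' -> anal N.+1 f /\ flat (fun u => f (x' u)).
  move=> /mapP[g gfs ->]; have [h1 h2] := hfs g gfs; split; first exact: anal_shear.
  by apply: (flat_le h2); apply: filterE => u; rewrite shx.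
have f0fs' : ((fun z => f0 (shear N a z)) : A) \in fs' by apply/mapP; exists f0.
have n1 := approximable_regular s.+1 IH hx' hfs' f0fs' ha.
have M1' : 0 <= 1 + M by exact: ltW.
have n2 := near_small (UU := UU) r_gt0 r_lim s M1'.
near=> u.
have r0 : 0 < r u by near: u.
have [y hy hf] : exists2 y : nat -> R,
    (forall i, (i < N.+1)%N -> `|y i - x' u i| <= r u ^+ s.+1) &
    forall f, f \in fs' -> f y = 0 by near: u.
have small : (1 + M) * r u ^+ s.+1 <= r u ^+ s by near: u.
exists (shear N a y); last by move=> f ffs; apply: (hf (fun z => f (shear N a z))); apply/mapP; exists f.
move=> i iN; apply: le_trans small; rewrite -shx /shear.
have hi := hy i iN; have hN := hy N (ltnSn N).
have rs0 : 0 <= r u ^+ s.+1 by rewrite exprn_ge0 // ltW.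
case: ltnP => h; last by apply: (le_trans hi); rewrite ler_peMl //; lra.
have -> : y i + a i * y N - (x' u i + a i * x' u N) = (y i - x' u i) + a i * (y N - x' u N) by ring.
apply: (le_trans (ler_normD _ _)); rewrite mulrDl mul1r; apply: lerD => //.
by rewrite normrM; apply: ler_pM => //; exact: hM.
Unshelve. all: by end_near. Qed.

End ApproximateZerosInduction.

(** * Quantifier elimination *)

Module Q := ordered_qelim.ord.
Import (canonicals) Q.

Section QuantifierElimination.
Context {R : realType}.
Local Notation A := ((nat -> R) -> R).
Implicit Types (e : seq R) (P : seq R -> Prop).

Definition term_fun (f : seq R -> R) :=
  exists t : GRing.term R, GRing.rterm t /\ forall e, GRing.eval e t = f e.

Definition definable P :=
  exists f : Q.formula R, Q.rformula f /\ forall e, Q.holds e f <-> P e.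

Lemma term_var i : term_fun (fun e => e`_i).
Proof. by exists (GRing.Var R i). Qed.

Lemma term_const c : term_fun (fun=> c).
Proof. by exists (GRing.Const c). Qed.

Lemma term_add f g : term_fun f -> term_fun g -> term_fun (fun e => f e + g e).
Proof.
move=> [t [rt ht]] [u [ru hu]]; exists (GRing.Add t u); rewrite /= rt ru.
by split => // e; rewrite ht hu.
Qed.

Lemma term_opp f : term_fun f -> term_fun (fun e => - f e).
Proof. by move=> [t [rt ht]]; exists (GRing.Opp t); split => //= e; rewrite ht. Qed.

Lemma term_mul f g : term_fun f -> term_fun g -> term_fun (fun e => f e * g e).
Proof.
move=> [t [rt ht]] [u [ru hu]]; exists (GRing.Mul t u); rewrite /= rt ru.
by split => // e; rewrite ht hu.
Qed.

Lemma term_exp f n : term_fun f -> term_fun (fun e => f e ^+ n).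
Proof. by move=> [t [rt ht]]; exists (GRing.Exp t n); split => //= e; rewrite ht. Qed.

Lemma term_sum (I : Type) (s : seq I) (f : I -> seq R -> R) :
  (forall i, term_fun (f i)) -> term_fun (fun e => \sum_(i <- s) f i e).
Proof.
move=> h; elim: s => [|i s [t [rt ht]]].
  by have [t [rt ht]] := term_const 0; exists t; split => // e; rewrite ht big_nil.
have [u [ru hu]] := h i; exists (GRing.Add u t); rewrite /= ru rt.
by split => // e; rewrite hu ht big_cons.
Qed.

Lemma term_prod (I : Type) (s : seq I) (f : I -> seq R -> R) :
  (forall i, term_fun (f i)) -> term_fun (fun e => \prod_(i <- s) f i e).
Proof.
move=> h; elim: s => [|i s [t [rt ht]]].
  by have [t [rt ht]] := term_const 1; exists t; split => // e; rewrite ht big_nil.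
have [u [ru hu]] := h i; exists (GRing.Mul u t); rewrite /= ru rt.
by split => // e; rewrite hu ht big_cons.
Qed.

Lemma term_meval N (p : mpoly.mpoly N R) (v : 'I_N -> seq R -> R) :
  (forall i, term_fun (v i)) -> term_fun (fun e => mpoly.meval (fun i => v i e) p).
Proof.
move=> hv.
have [t [rt ht]] : term_fun (fun e => \sum_(m <- mpoly.msupp p)
    mpoly.mcoeff m p * \prod_(i <- index_enum 'I_N) v i e ^+ mpoly.fun_of_multinom m i).
  apply: (@term_sum _ (mpoly.msupp p)) => m; apply: term_mul; first exact: term_const.
  by apply: (@term_prod _ (index_enum 'I_N)) => i; exact: term_exp.
by exists t; split => // e; rewrite ht mpoly.mevalE.
Qed.

Lemma definable_eq0 f : term_fun f -> definable (fun e => f e = 0).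
Proof.
move=> [t [rt ht]]; exists (Q.Equal t (GRing.Const 0)); split; first by rewrite /= rt.
by move=> e /=; rewrite ht.
Qed.

Lemma definable_lt f g : term_fun f -> term_fun g -> definable (fun e => f e < g e).
Proof.
move=> [t [rt ht]] [u [ru hu]]; exists (Q.Lt t u); split; first by rewrite /= rt.
by move=> e /=; rewrite ht hu.
Qed.

Lemma definable_and P P' : definable P -> definable P' -> definable (fun e => P e /\ P' e).
Proof.
move=> [f [rf hf]] [g [rg hg]]; exists (Q.And f g); split; first by rewrite /= rf.
by move=> e /=; split => -[/hf h /hg h'].
Qed.

Lemma definable_or P P' : definable P -> definable P' -> definable (fun e => P e \/ P' e).
Proof.
move=> [f [rf hf]] [g [rg hg]]; exists (Q.Or f g); split; first by rewrite /= rf.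
by move=> e /=; split => -[/hf h|/hg h]; [left|right|left|right].
Qed.

Lemma definable_iff P P' : definable P -> (forall e, P e <-> P' e) -> definable P'.
Proof.
move=> [f [rf hf]] h; exists f; split => // e.
by split => [/hf/h|/h/hf].
Qed.

Lemma definable_bool (b : bool) : definable (fun=> b).
Proof. by exists (Q.Bool b); split. Qed.

Lemma definable_ex P i : definable P -> definable (fun e => exists x, P (set_nth 0 e i x)).
Proof.
move=> [f [rf hf]]; exists (Q.Exists i f); split => // e /=.
by split => -[x /hf h]; exists x.
Qed.

Lemma definable_exn n (P : (nat -> R) -> Prop) : definable (fun e => P (nth 0 e)) ->
  definable (fun e => exists z, P (fun i => if (i < n)%N then z i else e`_i)).
Proof.
move=> hP; elim: n => [|n IH].
  apply: (definable_iff hP) => e; split => [h|[z h]] //.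
  by exists (fun=> 0).
apply: (definable_iff (definable_ex n IH)) => e; split => [[x [z h]]|[z h]].
  exists (fun i => if i == n then x else z i); congr P: h; apply/funext => i.
  by rewrite nth_set_nth /= ltnS; case: (ltngtP i n) => // ->.
exists (z n), z; congr P: h; apply/funext => i.
by rewrite nth_set_nth /= ltnS; case: (ltngtP i n) => // ->.
Qed.

Lemma definable_has (I : Type) (s : seq I) (P : I -> seq R -> bool) :
  (forall i, definable (fun e => P i e)) -> definable (fun e => has (fun i => P i e) s).
Proof.
move=> h; elim: s => [|i s IH]; first exact: (definable_bool false).
apply: (definable_iff (definable_or (h i) IH)) => e /=.
by split => [[->|->]|/orP[h'|h']]; rewrite ?orbT //; [left|right].
Qed.

Lemma definable_all (I : Type) (s : seq I) (P : I -> seq R -> bool) :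
  (forall i, definable (fun e => P i e)) -> definable (fun e => all (fun i => P i e) s).
Proof.
move=> h; elim: s => [|i s IH]; first exact: (definable_bool true).
by apply: (definable_iff (definable_and (h i) IH)) => e /=; split => [[-> ->]|/andP[]].
Qed.

(** The quantifier-free equivalent is built from comparisons t = u, t < u and t <= u, each decided
    by the sign of t - u. *)
Lemma elim_sign P : definable P -> exists ts : seq (GRing.term R),
  (forall t, t \in ts -> GRing.rterm t) /\
  forall e e', (forall t, t \in ts -> Num.sg (GRing.eval e t) = Num.sg (GRing.eval e' t)) ->
    P e -> P e'.
Proof.
move=> [f [rf hf]].
pose g := Q.quantifier_elim (fun n c => qe_rcf.qfr_to_formula (@qe_rcf.wproj R n c)) f.
have /andP[qg rg] : Q.qf_form g && Q.rformula g.
  exact: (Q.quantifier_elim_wf (@qe_rcf.wf_QE_wproj R)).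
have hg e : reflect (P e) (Q.qf_eval e g).
  have h := Q.quantifier_elim_rformP (@qe_rcf.wf_QE_wproj R) (@qe_rcf.valid_QE_wproj R) e rf.
  by apply: (iffP h) => /hf.
suff [ts [h1 h2]] : exists ts : seq (GRing.term R),
  (forall t, t \in ts -> GRing.rterm t) /\
  forall e e', (forall t, t \in ts -> Num.sg (GRing.eval e t) = Num.sg (GRing.eval e' t)) ->
    Q.qf_eval e g = Q.qf_eval e' g.
  by exists ts; split => // e e' /h2 h /hg; rewrite h => /hg.
clear hg; move: qg rg; elim: {rf hf}g => //=.
- by move=> b _ _; exists [::].
- move=> t u _ /andP[rt ru]; exists [:: GRing.Add t (GRing.Opp u)]; split.
    by move=> v; rewrite inE => /eqP -> /=; rewrite rt.
  move=> e e' /(_ _ (mem_head _ _)) /= h.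
  by rewrite -subr_eq0 -sgr_eq0 h sgr_eq0 subr_eq0.
- move=> t u _ /andP[rt ru]; exists [:: GRing.Add t (GRing.Opp u)]; split.
    by move=> v; rewrite inE => /eqP -> /=; rewrite rt.
  move=> e e' /(_ _ (mem_head _ _)) /= h.
  by rewrite -subr_lt0 -sgr_lt0 h sgr_lt0 subr_lt0.
- move=> t u _ /andP[rt ru]; exists [:: GRing.Add t (GRing.Opp u)]; split.
    by move=> v; rewrite inE => /eqP -> /=; rewrite rt.
  move=> e e' /(_ _ (mem_head _ _)) /= h.
  by rewrite -subr_le0 -sgr_le0 h sgr_le0 subr_le0.
- move=> f1 IH1 f2 IH2 /andP[q1 q2] /andP[r1 r2].
  have [t1 [a1 b1]] := IH1 q1 r1; have [t2 [a2 b2]] := IH2 q2 r2.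
  exists (t1 ++ t2); split; first by move=> t; rewrite mem_cat => /orP[/a1|/a2].
  move=> e e' h; rewrite (b1 e e') ?(b2 e e') // => t ht; apply: h; rewrite mem_cat ht //.
  by rewrite orbT.
- move=> f1 IH1 f2 IH2 /andP[q1 q2] /andP[r1 r2].
  have [t1 [a1 b1]] := IH1 q1 r1; have [t2 [a2 b2]] := IH2 q2 r2.
  exists (t1 ++ t2); split; first by move=> t; rewrite mem_cat => /orP[/a1|/a2].
  move=> e e' h; rewrite (b1 e e') ?(b2 e e') // => t ht; apply: h; rewrite mem_cat ht //.
  by rewrite orbT.
- move=> f1 IH1 f2 IH2 /andP[q1 q2] /andP[r1 r2].
  have [t1 [a1 b1]] := IH1 q1 r1; have [t2 [a2 b2]] := IH2 q2 r2.
  exists (t1 ++ t2); split; first by move=> t; rewrite mem_cat => /orP[/a1|/a2].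
  move=> e e' h; rewrite (b1 e e') ?(b2 e e') // => t ht; apply: h; rewrite mem_cat ht //.
  by rewrite orbT.
- move=> f1 IH1 q1 r1; have [t1 [a1 b1]] := IH1 q1 r1.
  by exists t1; split => // e e' h; rewrite (b1 e e').
Qed.

(** The N zeros occupy the slots of the quantified point of X; y comes next, and the level [T] has
    index N + N. *)
Definition env N (y : nat -> R) (T : R) := rcons (nseq N 0 ++ mkseq y N) T.

Lemma env_y N y T i : (i < N)%N -> (env N y T)`_(N + i) = y i.
Proof.
move=> iN; rewrite /env nth_rcons size_cat size_nseq size_mkseq ltn_add2l iN.
by rewrite nth_cat size_nseq ltnNge leq_addr /= addKn nth_mkseq.
Qed.

Lemma env_T N y T : (env N y T)`_(N + N) = T.
Proof. by rewrite /env nth_rcons size_cat size_nseq size_mkseq ltnn eqxx. Qed.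

(** The level is singled out as the polynomial variable, with coefficients that are functions of y,
    because the sign for small levels is read off the lowest coefficients. *)
Lemma term_poly N (t : GRing.term R) : GRing.rterm t -> exists p : {poly A},
  coefs_in (anal N) p /\ forall y T, GRing.eval (env N y T) t = p.[fun=> T] y.
Proof.
have ancst c : anal N (fun=> c : R) := anal_cst N c.
have coefC c : coefs_in (anal N) ((fun=> c : R) : A)%:P.
  by move=> i; rewrite coefC; case: eqP => _; exact: ancst.
elim: t => //=.
- move=> i _; have [iN|Ni] := ltnP i N.
    exists 0; split; first by move=> j; rewrite coef0; exact: ancst.
    by move=> y T; rewrite horner0 /env nth_rcons size_cat size_nseq size_mkseq ltn_addr // nth_cat size_nseq iN nth_nseq iN.
  have [iN2|Ni2] := ltnP i (N + N).
    exists (coord (i - N)%N)%:P; split.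
      move=> j; rewrite poly.coefC; case: eqP => _; last exact: ancst.
      by apply: anal_proj; rewrite ltn_subLR.
    move=> y T; rewrite hornerC -{1}(subnKC Ni) env_y //.
    by rewrite ltn_subLR.
  have [->|iNN] := eqVneq i (N + N)%N.
    exists 'X; split; last by move=> y T; rewrite hornerX env_T.
    by move=> j; rewrite coefX; case: eqP => _; exact: ancst.
  exists 0; split; first by move=> j; rewrite coef0; exact: ancst.
  move=> y T; rewrite horner0 nth_default // /env size_rcons size_cat size_nseq size_mkseq.
  by rewrite ltn_neqAle eq_sym iNN.
- by move=> c _; exists ((fun=> c) : A)%:P; split => // y T; rewrite hornerC.
- by move=> n _; exists ((fun=> n%:R) : A)%:P; split => // y T; rewrite hornerC.
- move=> t1 IH1 t2 IH2 /andP[/IH1[p [hp ep]] /IH2[q [hq eq]]]; exists (p + q); split.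
    by apply: coefs_inD => // a b; exact: anal_add.
  by move=> y T; rewrite ep eq hornerD.
- move=> t1 IH1 /IH1[p [hp ep]]; exists (- p); split.
    by apply: coefs_inN => // a; exact: anal_opp.
  by move=> y T; rewrite ep hornerN.
- move=> t1 IH1 n /IH1[p [hp ep]]; exists (p *+ n); split.
    move=> i; rewrite coefMn; elim: n => [|n IH]; first exact: ancst.
    by rewrite mulrS; apply: anal_add.
  move=> y T; rewrite ep hornerMn; elim: n => [|n IH]; first by rewrite !mulr0n.
  by rewrite !mulrS IH.
- move=> t1 IH1 t2 IH2 /andP[/IH1[p [hp ep]] /IH2[q [hq eq]]]; exists (p * q); split.
    apply: coefs_inM => //; first exact: ancst.
      by move=> a b; exact: anal_add.
    by move=> a b; exact: anal_mul.
  by move=> y T; rewrite ep eq hornerM.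
- move=> t1 IH1 n /IH1[p [hp ep]]; exists (p ^+ n); split; last first.
    by move=> y T; rewrite ep horner_exp exp_at.
  elim: n => [|n IH]; first by rewrite expr0; exact: coefC.
  rewrite exprS; apply: coefs_inM => //; first exact: ancst.
    by move=> a b; exact: anal_add.
  by move=> a b; exact: anal_mul.
Qed.

(* The distance to X is not compared directly: its sublevel sets are described
   by the signs of finitely many polynomials in the level T. *)
Lemma distance_signs N (X : set 'rV[R]_N) : semialgebraic X ->
  exists ps : seq {poly A}, (forall p, p \in ps -> coefs_in (anal N) p) /\
  forall (y : nat -> R) T1 T2,
    (forall p, p \in ps -> Num.sg (p.[fun=> T1] y) = Num.sg (p.[fun=> T2] y)) ->
    (exists2 x, X x & \sum_(i < N) (x 0 i - y i) ^+ 2 < T1) ->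
    exists2 x, X x & \sum_(i < N) (x 0 i - y i) ^+ 2 < T2.
Proof.
move=> [S XE].
pose ev (v : nat -> R) (p : mpoly.mpoly N R) := mpoly.meval (fun i : 'I_N => v i) p.
pose P (v : nat -> R) := has (fun pq : seq (mpoly.mpoly N R) * seq (mpoly.mpoly N R) =>
     all (fun p => ev v p == 0) pq.1 && all (fun q => 0 < ev v q) pq.2) S /\
   \sum_(i < N) (v i - v (N + i)%N) ^+ 2 < v (N + N)%N.
have tev p : term_fun (fun e => ev (nth 0 e) p).
  by apply: (@term_meval N p (fun i e => e`_i)) => i; exact: term_var.
have dP : definable (fun e => P (nth 0 e)).
  apply: definable_and.
    apply: (@definable_has _ S (fun pq e => all (fun p => ev (nth 0 e) p == 0) pq.1 && all (fun q => 0 < ev (nth 0 e) q) pq.2)) => pq.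
    apply: (definable_iff (P := fun e => all (fun p => ev (nth 0 e) p == 0) pq.1 /\ all (fun q => 0 < ev (nth 0 e) q) pq.2)); last first.
      by move=> e; split => /andP.
    apply: definable_and.
      apply: (@definable_all _ pq.1 (fun p e => ev (nth 0 e) p == 0)) => p.
      by apply: (definable_iff (definable_eq0 (tev p))) => e; split => /eqP.
    apply: (@definable_all _ pq.2 (fun p e => 0 < ev (nth 0 e) p)) => p.
    by apply: definable_lt => //; exact: term_const.
  apply: definable_lt; last exact: term_var.
  apply: (@term_sum _ (index_enum 'I_N) (fun i e => (e`_i - e`_(N + i)) ^+ 2)) => i.
  by apply: term_exp; apply: term_add; [exact: term_var|apply: term_opp; exact: term_var].
have [ts [rts hts]] := elim_sign (definable_exn N dP).
have ht t : exists p : {poly A}, t \in ts -> coefs_in (anal N) p /\ forall y T, GRing.eval (env N y T) t = p.[fun=> T] y.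
  have [/rts/(@term_poly N)[p hp]|] := boolP (t \in ts); first by exists p.
  by exists 0.
have [p hp] := choice ht.
have main y T : (exists z, P (fun i => if (i < N)%N then z i else (env N y T)`_i)) <->
    exists2 x, X x & \sum_(i < N) (x 0 i - y i) ^+ 2 < T.
  have hev (x : 'rV[R]_N) (v : nat -> R) q : (forall i : 'I_N, v i = x 0 i) -> ev v q = peval q x.
    by move=> h; apply: mpoly.meval_eq => i.
  split => [[z [h1 h2]]|[x Xx hx]].
    exists (\row_i z i).
      rewrite XE /=; move: h1; congr is_true; apply: eq_has => pq.
      congr (_ && _); apply: eq_all => q; rewrite (hev (\row_i z i)) // => i;
        by rewrite ltn_ord mxE.
    move: h2; rewrite ltnNge leq_addr /= env_T; congr is_true; congr (_ < _).
    apply: eq_bigr => i _; rewrite ltn_ord ltnNge leq_addr /= env_y // mxE.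
    by [].
  exists (fun i => if insub i is Some j then x 0 j else 0); split.
    move: Xx; rewrite XE /=; congr is_true; apply: eq_has => pq.
    congr (_ && _); apply: eq_all => q; rewrite (hev x) // => i;
        by rewrite ltn_ord valK.
  rewrite ltnNge leq_addr /= env_T; move: hx; congr is_true; congr (_ < _).
  by apply: eq_bigr => i _; rewrite ltn_ord ltnNge leq_addr /= env_y // valK.
exists [seq p t | t <- ts]; split.
  by move=> _ /mapP[t tts ->]; have [] := hp t tts.
move=> y T1 T2 hs /main h1; apply/main; apply: hts h1 => t tts.
by have [_ h] := hp t tts; rewrite !h; apply: hs; exact: map_f.
Qed.

End QuantifierElimination.

(** * Existence of a Lojasiewicz exponent *)

Section EuclideanNorm.
Context {R : realType}.

Definition pt N (x : 'rV[R]_N) : nat -> R := fun i => if insub i is Some j then x 0 j else 0.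

Lemma ptE N (x : 'rV[R]_N) (i : 'I_N) : pt x i = x 0 i.
Proof. by rewrite /pt valK. Qed.

Lemma pt0 N : pt (0 : 'rV[R]_N) = fun=> 0.
Proof. by apply/funext => i; rewrite /pt; case: insubP => // j _ _; rewrite mxE. Qed.

Lemma enorm_ge0 N (x : 'rV[R]_N) : 0 <= enorm x.
Proof. exact: sqrtr_ge0. Qed.

Lemma enorm_coord N (x : 'rV[R]_N) i : `|x 0 i| <= enorm x.
Proof.
rewrite -sqrtr_sqr; apply: ler_wsqrtr; rewrite (bigD1 i) //= lerDl.
by apply: sumr_ge0 => j _; exact: sqr_ge0.
Qed.

Lemma enorm_le N (x : 'rV[R]_N) d : 0 <= d -> (forall i, `|x 0 i| <= d) -> enorm x <= N%:R * d.
Proof.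
move=> d0 h; rewrite -[leRHS]ger0_norm ?mulr_ge0 // -sqrtr_sqr; apply: ler_wsqrtr.
apply: (@le_trans _ _ (\sum_(i < N) d ^+ 2)).
  apply: ler_sum => i _; rewrite -[leLHS]ger0_norm ?sqr_ge0 // normrX.
  by apply: lerXn2r; rewrite ?nnegrE.
rewrite sumr_const card_ord exprMn -[leLHS]mulr_natl ler_wpM2r ?sqr_ge0 //.
by rewrite -natrX ler_nat; case: N {x h} => // N; rewrite expnS leq_pmulr // expn_gt0.
Qed.

Lemma enorm_eq0 N (x : 'rV[R]_N) : (enorm x == 0) = (x == 0).
Proof.
apply/eqP/eqP => [h|->]; last first.
  by apply/eqP; rewrite eq_le enorm_ge0 andbT -[leRHS](mulr0 N%:R); apply: enorm_le => // i; rewrite mxE normr0.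
apply/rowP => i; rewrite mxE; apply/eqP; rewrite -normr_le0 -h; exact: enorm_coord.
Qed.

Lemma enorm0 N : enorm (0 : 'rV[R]_N) = 0.
Proof. by apply/eqP; rewrite enorm_eq0. Qed.

Lemma nbhs_rowP N (a : 'rV[R]_N) (U : set 'rV[R]_N) : nbhs a U <->
  exists2 e, 0 < e & forall x : 'rV[R]_N, (forall i, `|x 0 i - a 0 i| < e) -> U x.
Proof.
split=> [/nbhs_ballP[e /= e0 h]|[e e0 h]].
  exists e => // x hx; apply: h; split => // i j; rewrite (ord1 i) /ball /= distrC; exact: hx.
apply/nbhs_ballP; exists e => //= x hx; apply: h => i.
by have [_ /(_ 0 i)] := hx; rewrite /ball /= distrC.
Qed.

Lemma nbhs0_rowP N (U : set 'rV[R]_N) : nbhs (0 : 'rV[R]_N) U <->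
  exists2 e, 0 < e & forall x : 'rV[R]_N, (forall i, `|x 0 i| < e) -> U x.
Proof.
by rewrite nbhs_rowP; split => -[e e0 h]; exists e => // x hx; apply: h => i;
  have := hx i; rewrite mxE subr0.
Qed.

End EuclideanNorm.

Section Lojasiewicz.
Context {R : realType}.
Local Notation A := ((nat -> R) -> R).

(** For small T the coefficient of index a outweighs all later ones together. *)
Lemma sign_stable (c : nat -> R) n a T B : (a < n)%N -> (forall i, (i < a)%N -> c i = 0) ->
  (forall i, `|c i| <= B) -> 0 < T <= 1 -> n%:R * B * T < `|c a| ->
  Num.sg (\sum_(i < n) c i * T ^+ i) = Num.sg (c a).
Proof.
move=> an c0 hB /andP[T0 T1] hT.
have B0 : 0 <= B by exact: le_trans (hB 0%N).
have -> : \sum_(i < n) c i * T ^+ i = T ^+ a * (c a + \sum_(a.+1 <= i < n) c i * T ^+ (i - a)).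
  rewrite -(big_mkord xpredT (fun i => c i * T ^+ i)) (big_cat_nat (n := a)) ?(ltnW an) //=.
  rewrite big_nat big1 ?add0r; last by move=> i /andP[_ ia]; rewrite c0 // mul0r.
  rewrite big_ltn // mulrDr mulrC; congr (_ + _); rewrite mulr_sumr !big_nat.
  apply: eq_bigr => i /andP[ai _]; rewrite mulrCA -exprD subnKC //; exact: ltnW.
rewrite sgrM gtr0_sg ?exprn_gt0 // mul1r.
set s := \sum_(_ <= i < n) _.
have hs : `|s| < `|c a|.
  apply: le_lt_trans hT; apply: (le_trans (ler_norm_sum _ _ _)).
  apply: (@le_trans _ _ (\sum_(a.+1 <= i < n) B * T)).
    rewrite big_nat [leRHS]big_nat; apply: ler_sum => i /andP[ai _].
    rewrite normrM; apply: ler_pM => //; rewrite normrX (gtr0_norm T0).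
    rewrite -[leRHS]expr1; apply: ler_wiXn2l => //; first exact: ltW.
    by rewrite subn_gt0.
  rewrite sumr_const_nat -[leLHS]mulr_natl -mulrA ler_wpM2r ?mulr_ge0 ?(ltW T0) //.
  by rewrite ler_nat leq_subr.
move: hs; have [cp|cn|<-] := ltgtP 0 (c a); last by rewrite normr0 normr_lt0.
  by rewrite (gtr0_norm cp) ltr_norml => /andP[h1 h2]; rewrite !gtr0_sg //; lra.
by rewrite (ltr0_norm cn) ltr_norml => /andP[h1 h2]; rewrite !ltr0_sg //; lra.
Qed.

Section Signs.
Context (T : Type) (U : set_system T) {UU : UltraFilter U}
  (r : T -> R) (r_gt0 : \forall u \near U, 0 < r u)
  (r_lim : forall e : R, 0 < e -> \forall u \near U, r u < e).
Local Notation flat := (@flat R T U r).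

Lemma near_coefs_bounded N (x : T -> nat -> R) (p : {poly A}) : infinitesimal U N x ->
  coefs_in (anal N) p -> exists B, 0 <= B /\ \forall u \near U,
    forall y : nat -> R, (forall i, (i < N)%N -> `|y i - x u i| <= r u) -> forall i, `|p`_i y| <= B.
Proof.
move=> hx hp.
have [rho [rho0 hr]] : exists rho, 0 < rho /\ forall i, (i < size p)%N ->
    exists B, forall z, pd N (fun=> rho) z -> `|p`_i z| <= B.
  apply: (@fin_min _ (fun i rho => exists B, forall z, pd N (fun=> rho) z -> `|p`_i z| <= B)).
    move=> i rho rho' /andP[_ le] [B h]; exists B => z hz; apply: h => j /hz /le_trans; exact.
  by move=> i _; have /anal_bounded[rho [C [p0 _ h]]] := hp i; exists rho; split => //; exists C.
have hr' i : exists B, 0 <= B /\ forall z, pd N (fun=> rho) z -> `|p`_i z| <= B.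
  have [/hr[B h]|h] := ltnP i (size p).
    by exists `|B|; split => // z /h /le_trans; apply; exact: ler_norm.
  by exists 0; split => // z _; rewrite nth_default // normr0.
have [B hB] := choice hr'.
have B0 i : 0 <= B i by have [] := hB i.
exists (\sum_(i < size p) B i); split; first exact: sumr_ge0.
have n2 := pd_near (UU := UU) r_lim hx rho0.
near=> u => y hy i.
have N2 : forall y : nat -> R, (forall i, (i < N)%N -> `|y i - x u i| <= r u) ->
  pd N (fun=> rho) y by near: u.
have [ip|ip] := ltnP i (size p); last by rewrite nth_default // normr0 sumr_ge0.
have [_ h] := hB i; apply: (le_trans (h y (N2 y hy))).
by rewrite (bigD1 (Ordinal ip)) //= lerDl sumr_ge0.
Unshelve. all: by end_near. Qed.

(** The points y are those that the approximation produces: close to [x u], with flat coefficients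
    turned into exact zeros. *)
Definition constant_sign N (x : T -> nat -> R) (p : {poly A}) s u :=
  forall y : nat -> R, (forall i, (i < N)%N -> `|y i - x u i| <= r u ^+ s.+1) ->
    (forall i, flat (fun u => p`_i (x u)) -> p`_i y = 0) ->
    forall T1 T2, 0 < T1 < r u ^+ s.+1 -> 0 < T2 < r u ^+ s.+1 ->
      Num.sg (p.[fun=> T1] y) = Num.sg (p.[fun=> T2] y).

(** The first coefficient that is not flat exceeds r^tau at [x u] and, by its Lipschitz bound, is
    still dominant at y, where the earlier ones vanish. It decides the sign at all levels below
    r^(tau + 1). *)
Lemma constant_sign_poly N (x : T -> nat -> R) (p : {poly A}) : infinitesimal U N x ->
  coefs_in (anal N) p -> exists s, \forall u \near U, constant_sign N x p s u.
Proof.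
move=> hx hp.
have [allf|] := pselect (forall i, flat (fun u => p`_i (x u))).
  exists 0%N; near=> u => y _ hy T1 T2 _ _.
  suff h T0 : p.[fun=> T0] y = 0 by rewrite !h.
  by rewrite horner_at big1 // => i _; rewrite hy // mul0r.
move=> /existsNP nf.
have exi : exists i, `[< ~ flat (fun u => p`_i (x u)) >].
  by have [i hi] := nf; exists i; apply/asboolP.
case: (ex_minnP exi) => a /asboolP na mina.
have fl i : (i < a)%N -> flat (fun u => p`_i (x u)).
  move=> ia; apply: contrapT => h; have := mina i; rewrite leqNgt ia => /(_ _)/negP.
  by apply => //; apply/asboolP.
have an : (a < size p)%N.
  rewrite ltnNge; apply: contra_notN na => h; rewrite nth_default //; exact: flat0.
have [tau htau] := not_flat (UU := UU) na.
have [rho [K [p0 K0 lip]]] := anal_lip (hp a).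
have [B [B0 hB]] := near_coefs_bounded hx hp.
pose KK := K + (size p)%:R * B + 1.
have nB : 0 <= (size p)%:R * B by rewrite mulr_ge0.
have KK0 : 0 < KK by rewrite /KK; lra.
have n1 := pd_near (UU := UU) r_lim hx p0.
have n2 : \forall u \near U, r u < KK^-1 by apply: r_lim; rewrite invr_gt0.
have n3 := r_lim ltr01.
exists tau; near=> u => y hy hflat.
have r0 : 0 < r u by near: u.
have r1 : r u < 1 by near: u.
have rK : KK * r u < 1.
  have : r u < KK^-1 by near: u.
  by rewrite -[KK^-1]mul1r ltr_pdivlMr // mulrC.
have rle k : r u ^+ k.+1 <= r u.
  by rewrite exprS ler_piMr ?(ltW r0) // exprn_ile1 // ltW.
have hy1 i : (i < N)%N -> `|y i - x u i| <= r u.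
  by move=> iN; apply: le_trans (hy i iN) (rle _).
have N1 : forall y : nat -> R, (forall i, (i < N)%N -> `|y i - x u i| <= r u) ->
  pd N (fun=> rho) y by near: u.
have pdx : pd N (fun=> rho) (x u) by apply: N1 => i _; rewrite subrr normr0 ltW.
have hca : r u ^+ tau < `|p`_a (x u)| by near: u.
have hBu : forall y : nat -> R, (forall i, (i < N)%N -> `|y i - x u i| <= r u) -> forall i, `|p`_i y| <= B.
  by near: u.
have rs0 : 0 <= r u ^+ tau.+1 by rewrite exprn_ge0 // ltW.
have hl := lip _ _ _ (N1 _ hy1) pdx hy rs0.
have hc : (size p)%:R * B * r u ^+ tau.+1 < `|p`_a y|.
  have h1 : (K + (size p)%:R * B) * r u ^+ tau.+1 < r u ^+ tau.
    rewrite exprS mulrA -[ltRHS]mul1r ltr_pM2r ?exprn_gt0 //; apply: le_lt_trans rK.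
    by rewrite ler_wpM2r ?(ltW r0) // /KK; lra.
  have := ler_normD (p`_a (x u) - p`_a y) (p`_a y); rewrite subrK distrC.
  by move: h1; rewrite mulrDl; lra.
suff h T0 : 0 < T0 < r u ^+ tau.+1 -> Num.sg (p.[fun=> T0] y) = Num.sg (p`_a y).
  by move=> T1 T2 h1 h2; rewrite !h.
move=> /andP[T00 T0r]; rewrite horner_at.
apply: (@sign_stable (fun i => p`_i y) (size p) a T0 B) => //.
- by move=> i /fl; exact: hflat.
- exact: hBu.
- by rewrite T00 (ltW (lt_le_trans T0r (le_trans (rle _) (ltW r1)))).
apply: le_lt_trans hc; rewrite ler_wpM2l //; exact: ltW.
Unshelve. all: by end_near. Qed.

Lemma constant_sign_seq N (x : T -> nat -> R) (ps : seq {poly A}) : infinitesimal U N x ->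
  (forall p, p \in ps -> coefs_in (anal N) p) ->
  exists s, \forall u \near U, forall p, p \in ps -> constant_sign N x p s u.
Proof.
move=> hx; elim: ps => [|p ps IH] h; first by exists 0%N; apply: filterE => u.
have [|s hs] := IH; first by move=> q qps; apply: h; rewrite inE qps orbT.
have [s' hs'] := constant_sign_poly hx (h p (mem_head _ _)).
have n3 := r_lim ltr01.
have mono k k' q u : (k <= k')%N -> 0 < r u -> r u < 1 -> constant_sign N x q k u -> constant_sign N x q k' u.
  move=> kk' r0 r1 hq y hy hf T1 T2 /andP[a1 a2] /andP[b1 b2].
  have le : r u ^+ k'.+1 <= r u ^+ k.+1 by apply: ler_wiXn2l => //; exact: ltW.
  apply: hq => //; first by move=> i /hy /le_trans; apply.
    by rewrite a1 (lt_le_trans a2).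
  by rewrite b1 (lt_le_trans b2).
exists (maxn s s'); near=> u => q.
have r0 : 0 < r u by near: u.
have r1 : r u < 1 by near: u.
rewrite inE => /orP[/eqP ->|qps].
  by apply: (mono s') => //; [exact: leq_maxr|near: u].
apply: (mono s) => //; first exact: leq_maxl.
have : forall p, p \in ps -> constant_sign N x p s u by near: u.
exact.
Unshelve. all: by end_near. Qed.

End Signs.

(** Otherwise g is flat along points x_u of X tending to 0. The approximation gives zeros y of g
    much closer to x_u than |x_u|; the signs put y at distance less than any d from X, which is
    closed, so y is in X. Isolation of the zero gives y = 0, and then |x_u| = |x_u - y| is too
    small. *)
Theorem lojasiewicz_exists N (X : set 'rV[R]_N) (g : A) : closed X -> semialgebraic X ->
  anal N g -> (exists2 e, 0 < e & forall x, X x -> (forall i, `|x 0 i| < e) ->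
    g (pt x) = 0 -> x = 0) ->
  exists s e, 0 < e /\ forall x, X x -> enorm x < e -> enorm x ^+ s.+1 <= `|g (pt x)|.
Proof.
move=> clX saX hg [e0 e00 iso]; apply: contrapT => H.
have Hx s : exists x, [/\ X x, enorm x < s.+1%:R^-1 & `|g (pt x)| < enorm x ^+ s.+1].
  apply: contrapT => h; apply: H; exists s, s.+1%:R^-1; split; first by rewrite invr_gt0.
  move=> x Xx hx; rewrite leNgt; apply/negP => hgx; apply: h; by exists x.
have [x hx] := choice Hx.
have Xx u : X (x u) by have [] := hx u.
pose r u := enorm (x u).
have r0 u : 0 < r u.
  rewrite lt_def enorm_ge0 andbT; apply/negP => /eqP h.
  by have [_ _] := hx u; rewrite -/(r u) h expr0n /= normr_lt0.
have [U [UU oU]] := ultraFilterLemma (F := \oo) (eventually_filter).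
have near_oo (P : nat -> Prop) : (\forall u \near \oo, P u) -> \forall u \near U, P u by exact: oU.
have r_gt0 : \forall u \near U, 0 < r u by apply: filterE.
have r_lim e : 0 < e -> \forall u \near U, r u < e.
  move=> ee0; apply: near_oo; near=> u.
  have [_ h _] := hx u; apply: lt_trans h _.
  near: u; exact: (near_infty_natSinv_lt (PosNum ee0)).
have hinf : infinitesimal U N (fun u => pt (x u)).
  move=> e ee0; apply: filterS (r_lim e ee0) => u hu i iN.
  by rewrite -[i]/(val (Ordinal iN)) ptE; apply: le_trans (enorm_coord _ _) (ltW hu).
have [ps [hps hsign]] := distance_signs saX.
have gflat : flat U r (fun u => g (pt (x u))).
  move=> s; have h1 := r_lim 1 ltr01.
  have h2 : \forall u \near U, (s <= u)%N by apply: near_oo; exists s.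
  near=> u; have [_ _ h] := hx u; apply: (le_trans (ltW h)).
  apply: ler_wiXn2l; first exact: enorm_ge0.
    by apply: ltW; near: u.
  by apply: leqW; near: u.
pose fl (f : A) := flat U r (fun u => f (pt (x u))).
(* Besides g, the flat coefficients of the sign polynomials have to vanish exactly, as
   [constant_sign] demands. *)
pose fs : seq A := g :: [seq f <- flatten [seq polyseq p | p <- ps] | `[< fl f >]].
have hfs f : f \in fs -> anal N f /\ fl f.
  rewrite inE mem_filter => /orP[/eqP -> //|/andP[/asboolP hf]].
  move=> /flattenP[_ /mapP[p pps ->] /(nthP 0)[i _ fE]].
  by split => //; rewrite -fE; exact: hps.
have [s hs] := constant_sign_seq (UU := UU) r_gt0 r_lim hinf hps.
have happ := approximate_zeros (UU := UU) r_gt0 r_lim hinf hfs s.+3.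
have [rho [rho0 gdep]] := anal_dep hg.
have npd := pd_near (UU := UU) r_lim hinf rho0.
have n1 := r_lim 1 ltr01.
have n2 : \forall u \near U, r u < (2 * N%:R + 1)^-1 by apply: r_lim; rewrite invr_gt0 ltr_wpDl // mulr_ge0.
have n3 : \forall u \near U, r u < e0 / 2 by apply: r_lim; lra.
have [u [y]] : exists u, exists y : nat -> R,
  [/\ r u < 1, (2 * N%:R + 1) * r u < 1, r u < e0 / 2,
   (forall p, p \in ps -> constant_sign U r N (fun u => pt (x u)) p s u) &
   [/\ forall i, (i < N)%N -> `|y i - pt (x u) i| <= r u ^+ s.+3,
     forall f, f \in fs -> f y = 0 & pd N (fun=> rho) y]].
  apply: (@filter_ex _ U); near=> u.
  have r1 : r u < 1 by near: u.
  have [y h1 h2] : exists2 y : nat -> R,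
    (forall i, (i < N)%N -> `|y i - pt (x u) i| <= r u ^+ s.+3) &
    forall f, f \in fs -> f y = 0 by near: u.
  have N2 : forall y : nat -> R, (forall i, (i < N)%N -> `|y i - pt (x u) i| <= r u) ->
    pd N (fun=> rho) y by near: u.
  exists y; split => //; last split => //.
  - have : r u < (2 * N%:R + 1)^-1 by near: u.
    by rewrite -[X in _ < X]mul1r ltr_pdivlMr ?ltr_wpDl ?mulr_ge0 // mulrC.
  - by near: u.
  - by near: u.
  apply: N2 => i iN; apply: le_trans (h1 i iN) _.
  by rewrite exprS ler_piMr ?(ltW (r0 u)) // exprn_ile1 // ltW.
move=> [r1 rN re hsgn [hy hf pdy]].
have rr0 := r0 u.
pose Y : 'rV[R]_N := \row_i y i.
have yY i : (i < N)%N -> y i = pt Y i by move=> iN; rewrite -[i]/(val (Ordinal iN)) ptE mxE.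
have gY : g (pt Y) = 0.
  by rewrite -(gdep _ _ pdy yY) hf // mem_head.
have r2 : r u ^+ s.+3 <= r u * r u.
  rewrite -expr2; apply: ler_wiXn2l => //; exact: ltW.
have N0 : 0 <= N%:R :> R by [].
have Nr : N%:R * r u < 1.
  by move: rN; rewrite mulrDl -mulrA; have := mulr_ge0 N0 (ltW rr0); lra.
have XY : X Y.
  apply: clX => B /nbhs_rowP[d d0 hB].
  have sgn T1 T2 : 0 < T1 < r u ^+ s.+1 -> 0 < T2 < r u ^+ s.+1 ->
      forall p, p \in ps -> Num.sg (p.[fun=> T1] y) = Num.sg (p.[fun=> T2] y).
    move=> h1 h2 p pps; apply: (hsgn p pps) h1 h2.
      move=> i iN; apply: le_trans (hy i iN) _; apply: ler_wiXn2l; [exact: ltW|exact: ltW|].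
      by rewrite ltnS 2?leqW.
    move=> i hi; have [ip|ip] := ltnP i (size p); last by rewrite nth_default.
    apply: hf; rewrite inE mem_filter; apply/orP; right; apply/andP; split.
      exact/asboolP.
    by apply/flattenP; exists (polyseq p); [apply/mapP; exists p|exact: mem_nth].
  (* The point [x u] of X witnesses this level at y, and constancy of the signs carries it down to
     every smaller positive level, in particular one at most d^2. *)
  pose T1 := r u ^+ s.+1 / 2.
  have rs0 : 0 < r u ^+ s.+1 by rewrite exprn_gt0.
  have hT1 : 0 < T1 < r u ^+ s.+1 by rewrite /T1; apply/andP; split; lra.
  have start : exists2 z, X z & \sum_(i < N) (z 0 i - y i) ^+ 2 < T1.
    exists (x u) => //; apply: (@le_lt_trans _ _ (\sum_(i < N) r u ^+ s.+3)).
      apply: ler_sum => i _; rewrite -sqrrN opprB -[leLHS]ger0_norm ?sqr_ge0 // normrX.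
      have := hy i (ltn_ord i); rewrite ptE => h.
      apply: (@le_trans _ _ ((r u ^+ s.+3) ^+ 2)).
        by apply: lerXn2r; rewrite ?nnegrE ?exprn_ge0 // ltW.
      rewrite -exprM; apply: ler_wiXn2l; [exact: ltW|exact: ltW|].
      by rewrite muln2 -addnn leq_addr.
    rewrite sumr_const card_ord -[ltLHS]mulr_natl /T1.
    have h : r u ^+ s.+3 <= r u ^+ s.+1 * r u.
      by rewrite -exprSr; apply: ler_wiXn2l => //; exact: ltW.
    have := ler_wpM2l N0 h; set a := r u ^+ s.+1 in rs0 *; nra.
  pose T2 := Num.min T1 (d ^+ 2).
  have hT2 : 0 < T2 < r u ^+ s.+1.
    rewrite lt_min exprn_gt0 // !andbT gt_min; have /andP[-> ->] := hT1.
    by [].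
  have [z Xz hz] := hsign y _ _ (sgn _ _ hT1 hT2) start.
  exists z; split => //; apply: hB => i; rewrite mxE.
  have : (z 0 i - y i) ^+ 2 < d ^+ 2.
    apply: lt_le_trans (_ : T2 <= _); last by rewrite ge_min lexx orbT.
    apply: le_lt_trans hz; rewrite (bigD1 i) //= lerDl.
    by apply: sumr_ge0 => j _; exact: sqr_ge0.
  rewrite -[X in X < _ -> _]ger0_norm ?sqr_ge0 // normrX ltr_pXn2r ?nnegrE //.
  exact: ltW.
have Y0 : Y = 0.
  apply: (iso Y XY _ gY) => i; rewrite mxE.
  have h1 := hy i (ltn_ord i); rewrite ptE in h1.
  have h2 := enorm_coord (x u) i; rewrite -/(r u) in h2.
  have := ler_normD (y i - x u 0 i) (x u 0 i); rewrite subrK; nra.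
have : enorm (x u) <= N%:R * r u ^+ s.+3.
  apply: enorm_le; first by rewrite exprn_ge0 // ltW.
  move=> i; have := hy i (ltn_ord i); rewrite ptE.
  have -> : y i = Y 0 i by rewrite mxE.
  by rewrite Y0 mxE sub0r normrN.
rewrite -/(r u) => h; have := ler_wpM2l N0 r2.
by nra.
Unshelve. all: by end_near. Qed.

End Lojasiewicz.

(** * Power series indexed by multi-indices *)

Section CountableSums.
Context {R : realType} (I : countType).
Implicit Types (v : I -> R).

(** Multi-indices are enumerated by their codes, so that the sums over them in the definition of
    analyticity become ordinary series. *)
Lemma esum_pickle (v : I -> \bar R) :
  \esum_(e in [set: I]) v e = \esum_(k in [set: nat]) (if pickle_inv k is Some e then v e else 0%E).
Proof.
transitivity (\esum_(k in (@pickle I) @` [set: I]) (if pickle_inv k is Some e then v e else 0%E)).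
  rewrite esum_image; last by move=> x y _ _; exact: (pcan_inj pickleK).
  by apply: eq_esum => e _; rewrite pickleK_inv.
rewrite esum_mkcond; apply: eq_esum => k _; case E : (pickle_inv k) => [e|]; last by case: ifP.
rewrite ifT //; apply/mem_set; exists e => //.
by have := @pickle_invK I k; rewrite E.
Qed.

Lemma setT_xpredT : (fun x : nat => is_true (xpredT x)) = [set: nat].
Proof. by apply/seteqP; split. Qed.

Lemma eseries_rs (u : nat -> R) C : absb u C ->
  \big[+%E/0%E]_(0 <= i <oo) (u i)%:E = (rs u)%:E.
Proof.
move=> /absb_cvg h; rewrite /rs -EFin_lim //; congr (limn _); apply/funext => n.
by rewrite /= sumEFin.
Qed.

Lemma absb_esum v C : absb (fun k => if pickle_inv k is Some e then v e else 0) C ->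
  summable [set: I] (fun e => (v e)%:E) /\
  (\esum_(e in [set: I]) (fun e => (v e)%:E)^\+ e - \esum_(e in [set: I]) (fun e => (v e)%:E)^\- e)%E =
  (rs (fun k => if pickle_inv k is Some e then v e else 0))%:E.
Proof.
set u := fun k => _ => hu.
have hu' : absb (fun k => `|u k|) C by move=> n; under eq_bigr do rewrite normr_id.
have su : summable [set: nat] (fun k => (u k)%:E).
  rewrite /summable -nneseries_esumT // (eseries_rs hu'); exact: ltry.
split.
  rewrite /summable esum_pickle; move: su; rewrite /summable; congr (is_true (_ < _)%E).
  by apply: eq_esum => k _; rewrite /u; case: pickle_inv => [e|] //; rewrite /= normr0.
rewrite !esum_pickle -(eseries_rs hu); have := @summable_eseries_esum R (fun k => (u k)%:E) xpredT.
rewrite setT_xpredT => /(_ su) ->; congr (_ - _)%E; apply: eq_esum => k _.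
  by rewrite funeposE /u; case: pickle_inv => [e|]; rewrite ?funeposE // maxxx.
by rewrite funenegE /u; case: pickle_inv => [e|]; rewrite ?funenegE // oppe0 maxxx.
Qed.

Lemma summable_absb v : summable [set: I] (fun e => (v e)%:E) ->
  exists C, absb (fun k => if pickle_inv k is Some e then v e else 0) C.
Proof.
rewrite /summable esum_pickle; set s := \esum_(_ in _) _ => hs.
have s0 : (0 <= s)%E by apply: esum_ge0 => k _; case: pickle_inv.
have fs : s \is a fin_num by rewrite ge0_fin_numE.
exists (fine s) => n; rewrite -lee_fin fineK //.
rewrite /s -nneseries_esumT; last by move=> k; case: pickle_inv.
apply: (@le_trans _ _ (\sum_(0 <= i < n) (if pickle_inv i is Some e then `|(v e)%:E| else 0)%E)%E).
  rewrite -sumEFin; apply: lee_sum => i _; case: pickle_inv => [e|] //.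
  by rewrite normr0.
by apply: nneseries_lim_ge => k _; case: pickle_inv.
Qed.

End CountableSums.

Section AnalyticConversion.
Context {R : realType}.
Implicit Types (g : (nat -> R) -> R) (N : nat).

Definition mono N (e : {ffun 'I_N -> nat}) (z : nat -> R) := \prod_(i < N) z i ^+ e i.

Definition nmono N k (z : nat -> R) : R :=
  if pickle_inv k is Some e then @mono N e z else 0.

Lemma An_mono N rho (e : {ffun 'I_N -> nat}) : 0 < rho ->
  An N (fun=> rho) (mono e (fun=> rho)) (mono e).
Proof.
move=> p; rewrite /mono.
suff H (s : seq 'I_N) : An N (fun=> rho) (\prod_(i <- s) rho ^+ e i) (fun z => \prod_(i <- s) z i ^+ e i).
  exact: H.
elim: s => [|i s IH].
  rewrite big_nil; apply: (An_ext (f := fun=> 1)); last by move=> x _; rewrite big_nil.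
  by have := An_cst (fun=> rho) N 1; rewrite normr1.
rewrite big_cons; apply: (An_ext (f := fun z => z i ^+ e i * \prod_(j <- s) z j ^+ e j)).
  by apply: An_mul => //; apply: An_exp => //; exact: An_proj.
by move=> x _; rewrite big_cons.
Qed.

Lemma mono_pd N rho (e : {ffun 'I_N -> nat}) z : 0 < rho -> pd N (fun=> rho) z ->
  `|mono e z| <= mono e (fun=> rho).
Proof. by move=> p hz; exact: An_bound (An_mono e p) hz. Qed.

Lemma analytic_anal N (f : 'rV[R]_N -> R) : analytic_fun_at f 0 ->
  exists g, anal N g /\ exists2 e, 0 < e & forall x : 'rV[R]_N,
    (forall i, `|x 0 i| < e) -> f x = g (pt x).
Proof.
move=> [c /nbhs0_rowP[e e0 h]].
have r0 : 0 < e / 2 by lra.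
pose rho := e / 2.
(* Convergence at the corner (rho, ..., rho) of the polydisc bounds all terms on the whole
   polydisc. *)
pose C k := if pickle_inv k is Some d then `|c d| * mono d (fun=> rho) else 0.
have [D hD] : exists D, absb C D.
  have [|+ _] := h (\row_i rho).
    by move=> i; rewrite mxE ger0_norm // /rho; lra.
  move=> /(@summable_absb R _ (fun d => c d * _))[D hD]; exists D.
  apply: (absb_le hD) => // k; rewrite /C; case: pickle_inv => [d|//].
  rewrite !normrM normr_id ler_wpM2l // /mono !normr_prod le_eqVlt; apply/orP; left.
  by apply/eqP; apply: eq_bigr => i _; rewrite !mxE subr0.
exists (fun z => rs (fun k => if pickle_inv k is Some d then c d * mono d z else 0)).
split.
  exists rho, D; split => //; apply: (@An_sumn _ _ (fun=> r0) N C) => // k.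
  rewrite /C; case: pickle_inv => [d|]; last exact: An_0.
  by apply: An_mul => //; [exact: An_cst|exact: An_mono].
exists rho => // x hx.
have hxe i : `|x 0 i| < e by apply: lt_trans (hx i) _; rewrite /rho; lra.
have [s1 s2] := h x hxe.
have E (d : {ffun 'I_N -> nat}) : c d * \prod_(i < N) (x - 0) 0 i ^+ d i = c d * mono d (pt x).
  by congr (_ * _); apply: eq_bigr => i _; rewrite ptE subr0.
have [Cx hCx] := summable_absb s1.
have [_ s3] := absb_esum hCx.
have : (f x)%:E = (rs (fun k => if pickle_inv k is Some d then c d * \prod_(i < N) (x - 0) 0 i ^+ d i else 0))%:E.
  by rewrite s2 -s3.
case=> ->; congr rs; apply/funext => k; case: pickle_inv => [d|//]; exact: E.
Qed.

(* Regroups a nested expansion into an expansion over multi-indices. *)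
Definition multi_expansion N rho C g := exists c : nat -> R,
  absb (fun k => c k * nmono N k (fun=> rho)) C /\
  forall z, pd N (fun=> rho) z -> g z = rs (fun k => c k * nmono N k z).

Lemma multi_expansion_mono N rho c (e : {ffun 'I_N -> nat}) : 0 < rho ->
  multi_expansion N rho (`|c| * mono e (fun=> rho)) (fun z => c * mono e z).
Proof.
move=> p.
have m0 : 0 <= mono e (fun=> rho) by apply: prodr_ge0 => i _; rewrite exprn_ge0 // ltW.
exists (fun k => if k == pickle e then c else 0); split.
  have := @absb_fin _ (fun k => (if k == pickle e then c else 0) * nmono N k (fun=> rho)) (pickle e).+1.
  rewrite big_nat_recr //= eqxx big_nat big1 ?add0r; last first.
    by move=> i /andP[_ ie]; rewrite ltn_eqF // mul0r normr0.
  rewrite normrM /nmono pickleK_inv [`|mono _ _|]ger0_norm //; apply => i ei.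
  by rewrite gtn_eqF // mul0r.
move=> z _; rewrite (@rs_fin _ _ (pickle e).+1); last first.
  by move=> i ei; rewrite gtn_eqF // mul0r.
rewrite big_nat_recr //= eqxx big_nat big1 ?add0r; last first.
  by move=> i /andP[_ ie]; rewrite ltn_eqF // mul0r.
by rewrite /nmono pickleK_inv.
Qed.

Lemma nmono_pd N rho k z : 0 < rho -> pd N (fun=> rho) z ->
  `|nmono N k z| <= nmono N k (fun=> rho).
Proof.
by move=> p hz; rewrite /nmono; case: pickle_inv => [e|]; [exact: mono_pd|rewrite normr0].
Qed.

Lemma multi_expansion_sum N rho (C : nat -> R) (g : nat -> (nat -> R) -> R) D : 0 < rho ->
  (forall k, multi_expansion N rho (C k) (g k)) -> absb C D ->
  multi_expansion N rho D (fun z => rs (fun k => g k z)).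
Proof.
move=> p h hC; have [c hc] := choice h.
have h1 k : absb (fun l => c k l * nmono N l (fun=> rho)) (C k) by have [] := hc k.
have [hcol hrow _] := rs_exch h1 hC.
(* At a number that codes no multi-index the monomial is 0 and nothing bounds the column, so its
   coefficient is set to 0. *)
pose cc l := if pickle_inv l is Some e then
  (fun _ : {ffun 'I_N -> nat} => rs (fun k => c k l)) e else 0.
have m0 (e : {ffun 'I_N -> nat}) : 0 < mono e (fun=> rho) by apply: prodr_gt0 => i _; rewrite exprn_gt0.
have hcl l (e : {ffun 'I_N -> nat}) : pickle_inv l = Some e -> absb (fun k => c k l) ((mono e (fun=> rho))^-1 * D).
  move=> El; have me0 : 0 < mono e (fun=> rho) by exact: (m0 e).
  have := absbZ (mono e (fun=> rho))^-1 (hcol l); rewrite gtr0_norm; last by rewrite invr_gt0.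
  move=> hE; apply: (absb_le hE) => // k; rewrite /nmono El mulrC mulfK //.
  by rewrite gt_eqF.
exists cc; split.
  apply: (absb_le hrow) => // l; rewrite /cc /nmono; case El : (pickle_inv l) => [e|]; last by rewrite mulr0 normr0.
  rewrite mulrC -(rsZ _ (hcl l e El)); rewrite [leRHS](_ : _ = `|rs (fun k => mono e (fun=> rho) * c k l)|) //.
  by congr `|rs _|; apply/funext => k; rewrite mulrC.
move=> z hz.
have h2 k : absb (fun l => c k l * nmono N l z) (C k).
  apply: (absb_le (h1 k)) => // l; rewrite normrM [leRHS]normrM ler_wpM2l //.
  by apply: le_trans (ler_norm _); exact: nmono_pd.
have [_ _ e3] := rs_exch h2 hC.
transitivity (rs (fun k => rs (fun l => c k l * nmono N l z))).
  by congr rs; apply/funext => k; have [_ ->] := hc k.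
rewrite e3; congr rs; apply/funext => l; rewrite /cc /nmono.
case El : (pickle_inv l) => [e|].
  rewrite mulrC -(rsZ _ (hcl l e El)); congr rs; apply/funext => k; exact: mulrC.
rewrite mulr0; transitivity (\sum_(0 <= k < 0) (c k l * 0)); last by rewrite big_geq.
by apply: rs_fin => i _; rewrite mulr0.
Qed.

Lemma multi_expansion_ext N rho C g g' : multi_expansion N rho C g ->
  (forall z, pd N (fun=> rho) z -> g z = g' z) -> multi_expansion N rho C g'.
Proof. by move=> [c [h1 h2]] h; exists c; split => // z hz; rewrite -h // h2. Qed.

(** The monomial factor is what makes the induction close: expanding in one variable only raises an
    exponent of [e]. *)
Lemma An_multi_expansion N rho n C g (e : {ffun 'I_N -> nat}) : 0 < rho -> (n <= N)%N ->
  An n (fun=> rho) C g ->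
  multi_expansion N rho (C * mono e (fun=> rho)) (fun z => g z * mono e z).
Proof.
move=> p; have m0 (d : {ffun 'I_N -> nat}) : 0 <= mono d (fun=> rho).
  by apply: prodr_ge0 => i _; rewrite exprn_ge0 // ltW.
elim: n C g e => [|n IH] C g e.
  move=> _ [c [hc gc]]; have [d [h1 h2]] := multi_expansion_mono c e p.
  exists d; split; last by move=> z hz; rewrite gc h2.
  by move=> k; apply: le_trans (h1 k) _; rewrite ler_wpM2r.
move=> nN /AnS[a [M [h1 h2 h3]]].
pose shift j : {ffun 'I_N -> nat} := [ffun i => (e i + (i == Ordinal nN) * j)%N].
have shE j z : mono (shift j) z = mono e z * z n ^+ j.
  rewrite /mono (bigD1 (Ordinal nN)) //= ffunE eqxx mul1n exprD.
  rewrite [in RHS](bigD1 (Ordinal nN)) //= mulrAC; congr (_ * _ * _); apply: eq_bigr => i ne.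
  by rewrite ffunE (negbTE ne) mul0n addn0.
have H : multi_expansion N rho (C * mono e (fun=> rho)) (fun z => rs (fun j => a j z * mono (shift j) z)).
  apply: (@multi_expansion_sum _ _ (fun j => M j * mono (shift j) (fun=> rho))) => //.
    by move=> j; apply: IH => //; exact: ltnW.
  have := absbZ (mono e (fun=> rho)) h2; rewrite ger0_norm // mulrC => hE.
  by apply: (absb_le hE) => // j; rewrite shE mulrCA.
apply: (multi_expansion_ext H) => z hz.
have hz' : pd n.+1 (fun=> rho) z by move=> i iN; apply: hz; exact: (leq_trans iN nN).
rewrite h3 // mulrC -(rsZ _ (An_term h1 h2 hz')); congr rs; apply/funext => j.
by rewrite shE mulrCA.
Qed.

Lemma anal_analytic N g (a : 'rV[R]_N) : anal N g ->
  analytic_fun_at (fun x => g (pt (x - a))) a.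
Proof.
move=> [rho [C [p hg]]].
have [c [h1 h2]] := An_multi_expansion [ffun=> 0%N] p (leqnn N) hg.
have m1 z : @mono N [ffun=> 0%N] z = 1 by rewrite /mono big1 // => i _; rewrite ffunE expr0.
exists (fun e => c (pickle e)); apply/nbhs_rowP; exists rho => // x hx.
have hz : pd N (fun=> rho) (pt (x - a)).
  by move=> i iN; rewrite -[i]/(val (Ordinal iN)) ptE !mxE ltW.
have hb : absb (fun k => if pickle_inv k is Some e then
    c (pickle e) * \prod_(i < N) (x - a) 0 i ^+ (e : {ffun 'I_N -> nat}) i else 0) (C * @mono N [ffun=> 0%N] (fun=> rho)).
  apply: (absb_le h1) => // k; rewrite /nmono; have := @pickle_invK {ffun 'I_N -> nat} k.
  case: pickle_inv => [e /= ->|_]; last by rewrite mulr0.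
  rewrite normrM [leRHS]normrM ler_wpM2l //; apply: le_trans (ler_norm _).
  rewrite (_ : \prod_(i < N) _ = mono e (pt (x - a))); first exact: mono_pd.
  by apply: eq_bigr => i _; rewrite ptE.
have [s1 s2] := absb_esum hb; split => //=.
rewrite s2; congr EFin; have := h2 _ hz; rewrite m1 mulr1 => ->; congr rs; apply/funext => k.
rewrite /nmono; have := @pickle_invK {ffun 'I_N -> nat} k.
case: pickle_inv => [e /= ->|_]; last by rewrite mulr0.
by congr (_ * _); apply: eq_bigr => i _; rewrite ptE.
Qed.

End AnalyticConversion.

(** * Polynomial functions *)

Section PolynomialFunctions.
Context {R : realType}.
Local Notation A := ((nat -> R) -> R).
Implicit Types (f g : A) (z : nat -> R).

(** A closure of functions rather than formal polynomials, so that changing the number of variables,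
    substitution and analyticity follow by induction; [polyf_mpoly] returns to formal
    polynomials. *)
Inductive polyf (n : nat) : A -> Prop :=
| polyf_cst c : polyf n (fun=> c)
| polyf_coord i : (i < n)%N -> polyf n (fun z => z i)
| polyf_add f g : polyf n f -> polyf n g -> polyf n (fun z => f z + g z)
| polyf_mul f g : polyf n f -> polyf n g -> polyf n (fun z => f z * g z).

Lemma polyf_opp n f : polyf n f -> polyf n (fun z => - f z).
Proof.
move=> h; rewrite (_ : (fun _ => _) = fun z => (-1) * f z); last first.
  by apply/funext => z; rewrite mulN1r.
by apply: polyf_mul => //; exact: polyf_cst.
Qed.

Lemma polyf_sum n (I : Type) (s : seq I) (f : I -> A) :
  (forall i, polyf n (f i)) -> polyf n (fun z => \sum_(i <- s) f i z).
Proof.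
move=> h; elim: s => [|i s IH].
  by rewrite (_ : (fun _ => _) = fun=> 0); [exact: polyf_cst|apply/funext => z; rewrite big_nil].
rewrite (_ : (fun _ => _) = fun z => f i z + \sum_(i <- s) f i z); first exact: polyf_add.
by apply/funext => z; rewrite big_cons.
Qed.

Lemma polyf_prod n (I : Type) (s : seq I) (f : I -> A) :
  (forall i, polyf n (f i)) -> polyf n (fun z => \prod_(i <- s) f i z).
Proof.
move=> h; elim: s => [|i s IH].
  by rewrite (_ : (fun _ => _) = fun=> 1); [exact: polyf_cst|apply/funext => z; rewrite big_nil].
rewrite (_ : (fun _ => _) = fun z => f i z * \prod_(i <- s) f i z); first exact: polyf_mul.
by apply/funext => z; rewrite big_cons.
Qed.

Lemma polyf_exp n f k : polyf n f -> polyf n (fun z => f z ^+ k).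
Proof.
move=> h; elim: k => [|k IH].
  rewrite (_ : (fun _ => _) = fun=> 1); [exact: polyf_cst|by apply/funext => z; rewrite expr0].
rewrite (_ : (fun _ => _) = fun z => f z * f z ^+ k); first exact: polyf_mul.
by apply/funext => z; rewrite exprS.
Qed.

Lemma polyf_le n m f : (n <= m)%N -> polyf n f -> polyf m f.
Proof.
move=> nm; elim => [c|i ni|f' g _ h1 _ h2|f' g _ h1 _ h2].
- exact: polyf_cst.
- by apply: polyf_coord; exact: leq_trans nm.
- exact: polyf_add.
- exact: polyf_mul.
Qed.

Lemma polyf_dep n f z z' : polyf n f -> (forall i, (i < n)%N -> z i = z' i) -> f z = f z'.
Proof. by move=> h hz; elim: h => [c|i /hz ->|f' g _ -> _ ->|f' g _ -> _ ->]. Qed.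

Lemma polyf_line n f z w : polyf n f ->
  exists q : {poly R}, forall t, f (fun i => z i + t * w i) = q.[t].
Proof.
elim => [c|i _|f' g _ [p hp] _ [q hq]|f' g _ [p hp] _ [q hq]].
- by exists c%:P => t; rewrite hornerC.
- by exists ((z i)%:P + (w i) *: 'X) => t; rewrite !hornerE mulrC.
- by exists (p + q) => t; rewrite hornerD hp hq.
- by exists (p * q) => t; rewrite hornerM hp hq.
Qed.

Lemma poly_nonroot (p : {poly R}) e : p != 0 -> 0 < e -> exists t, 0 < t < e /\ p.[t] != 0.
Proof.
move=> p0 e0; apply: contrapT => H.
pose s := [seq e / (i.+2)%:R | i <- iota 0 (size p)].
have : (size s < size p)%N.
  apply: max_poly_roots => //.
    apply/allP => _ /mapP[i _ ->]; apply/eqP; apply: contrapT => /eqP h; apply: H.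
    exists (e / i.+2%:R); split => //; rewrite divr_gt0 //= ltr_pdivrMr // ltr_pMr //.
    by rewrite ltr1n.
  rewrite map_inj_uniq ?iota_uniq // => i j /(mulfI (lt0r_neq0 e0))/invr_inj/eqP.
  by rewrite eqr_nat => /eqP[].
by rewrite size_map size_iota ltnn.
Qed.

(** On the line joining [z1] to [z2] both functions are nonzero polynomials in one parameter, and so
    is their product. *)
Lemma polyf_nonzero2 n f g z1 z2 : polyf n f -> polyf n g -> f z1 != 0 -> g z2 != 0 ->
  exists z, f z != 0 /\ g z != 0.
Proof.
move=> hf hg f1 g2.
have [p hp] := polyf_line z1 (fun i => z2 i - z1 i) hf.
have [q hq] := polyf_line z1 (fun i => z2 i - z1 i) hg.
have p0 : p != 0.
  apply: contraNneq f1 => p0; have := hp 0; rewrite p0 horner0 => <-.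
  by apply/eqP; congr f; apply/funext => i; rewrite mul0r addr0.
have q0 : q != 0.
  apply: contraNneq g2 => q0; have := hq 1; rewrite q0 horner0 => <-.
  by apply/eqP; congr g; apply/funext => i; rewrite mul1r addrC subrK.
have pq0 : p * q != 0 by rewrite mulf_neq0.
have [t [_]] := poly_nonroot pq0 ltr01.
rewrite hornerM mulf_eq0 negb_or => /andP[h1 h2].
by exists (fun i => z1 i + t * (z2 i - z1 i)); rewrite hp hq.
Qed.

Lemma polyf_subst n m f (l : nat -> A) : polyf n f -> (forall i, (i < n)%N -> polyf m (l i)) ->
  polyf m (fun z => f (fun i => l i z)).
Proof.
move=> h hl; elim: h => [c|i /hl//|f' g _ h1 _ h2|f' g _ h1 _ h2].
- exact: polyf_cst.
- exact: polyf_add.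
- exact: polyf_mul.
Qed.

Lemma polyf_anal N n f (l : nat -> A) : polyf n f -> (forall i, (i < n)%N -> anal N (l i)) ->
  anal N (fun z => f (fun i => l i z)).
Proof.
move=> h hl; elim: h => [c|i /hl//|f' g _ h1 _ h2|f' g _ h1 _ h2].
- exact: anal_cst.
- exact: anal_add.
- exact: anal_mul.
Qed.

Lemma polyf_horner n (P : {poly A}) : coefs_in (polyf n) P -> polyf n.+1 P.[coord n].
Proof.
move=> hP; rewrite (_ : P.[_] = fun z => \sum_(i < size P) P`_i z * z n ^+ i); last first.
  by apply/funext => z; rewrite horner_at.
apply: (@polyf_sum _ _ (index_enum 'I_(size P)) (fun i z => P`_i z * z n ^+ i)) => i.
apply: polyf_mul; first by apply: (polyf_le (leqnSn n)); exact: hP.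
by apply: polyf_exp; exact: polyf_coord.
Qed.

Lemma coefs_in_polyfD n (p q : {poly A}) :
  coefs_in (polyf n) p -> coefs_in (polyf n) q -> coefs_in (polyf n) (p + q).
Proof. by move=> hp hq; apply: coefs_inD => // a b; exact: polyf_add. Qed.

Lemma coefs_in_polyfM n (p q : {poly A}) :
  coefs_in (polyf n) p -> coefs_in (polyf n) q -> coefs_in (polyf n) (p * q).
Proof.
move=> hp hq; apply: coefs_inM => //; first exact: polyf_cst.
  by move=> a b; exact: polyf_add.
by move=> a b; exact: polyf_mul.
Qed.

Lemma polyf_poly n f : polyf n.+1 f ->
  exists P : {poly A}, coefs_in (polyf n) P /\ forall z, f z = P.[coord n] z.
Proof.
elim => [c|i|f' g _ [p [hp ep]] _ [q [hq eq]]|f' g _ [p [hp ep]] _ [q [hq eq]]].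
- exists ((fun=> c) : A)%:P; split; last by move=> z; rewrite hornerC.
  by move=> i; rewrite coefC; case: eqP => _; exact: polyf_cst.
- rewrite ltnS leq_eqVlt => /orP[/eqP ->|ni].
    exists 'X; split; last by move=> z; rewrite hornerX.
    by move=> j; rewrite coefX; case: eqP => _; exact: polyf_cst.
  exists ((fun z => z i) : A)%:P; split; last by move=> z; rewrite hornerC.
  by move=> j; rewrite coefC; case: eqP => _; [exact: polyf_coord|exact: polyf_cst].
- exists (p + q); split; first exact: coefs_in_polyfD.
  by move=> z; rewrite ep eq hornerD.
- exists (p * q); split; first exact: coefs_in_polyfM.
  by move=> z; rewrite ep eq hornerM.
Qed.

Lemma mpoly_polyf N n (p : mpoly.mpoly N R) (s : 'I_N -> nat) : (forall i, (s i < n)%N) ->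
  polyf n (fun z => mpoly.meval (fun i => z (s i)) p).
Proof.
move=> hs; rewrite (_ : (fun _ => _) = fun z => \sum_(m <- mpoly.msupp p)
    mpoly.mcoeff m p * \prod_(i <- index_enum 'I_N) z (s i) ^+ mpoly.fun_of_multinom m i); last first.
  by apply/funext => z; rewrite mpoly.mevalE.
apply: polyf_sum => m; apply: polyf_mul; first exact: polyf_cst.
by apply: polyf_prod => i; apply: polyf_exp; exact: polyf_coord.
Qed.

Definition supported N (B : pred 'I_N) (p : mpoly.mpoly N R) :=
  forall m, m \in mpoly.msupp p -> forall i, ~~ B i -> mpoly.fun_of_multinom m i = 0%N.

Lemma polyf_mpoly N n f (B : pred 'I_N) (v : nat -> 'I_N) : polyf n f ->
  (forall k, (k < n)%N -> B (v k)) ->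
  exists p : mpoly.mpoly N R, supported B p /\
    forall z (x : 'I_N -> R), (forall k, (k < n)%N -> z k = x (v k)) -> f z = mpoly.meval x p.
Proof.
move=> h hB; elim: h => [c|k kn|f' g _ [p [hp ep]] _ [q [hq eq]]|f' g _ [p [hp ep]] _ [q [hq eq]]].
- exists (mpoly.mpolyC N c); split; last by move=> z x _; rewrite mpoly.mevalC.
  move=> m; rewrite mpoly.msuppC; case: ifP => _; first by [].
  rewrite mem_seq1 => /eqP em i _; rewrite em; exact: mpoly.mnm0E.
- exists (mpoly.mpolyX R (mpoly.mnm1 (v k))); split; last first.
    by move=> z x h; rewrite mpoly.mevalXU h.
  move=> m; rewrite mpoly.msuppX inE => /eqP -> i; rewrite mpoly.mnm1E.
  by move=> Bi; case: eqP Bi => // <-; rewrite hB.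
- exists (p + q); split; last by move=> z x h; rewrite mpoly.mevalD (ep _ _ h) (eq _ _ h).
  move=> m /mpoly.msuppD_le; rewrite mem_cat => /orP[]; [exact: hp|exact: hq].
- exists (p * q); split; last by move=> z x h; rewrite mpoly.mevalM (ep _ _ h) (eq _ _ h).
  move=> m /mpoly.msuppM_le /allpairsP[[m1 m2] /= [h1 h2 ->]] i Bi.
  by rewrite mpoly.mnmDE (hp _ h1) ?(hq _ h2).
Qed.

End PolynomialFunctions.

(** * Triangular systems *)

Section Tower.
Context {R : realType} (T : Type) (U : set_system T) {UU : UltraFilter U}
  (x : T -> nat -> R).
Local Notation A := ((nat -> R) -> R).

Definition zae (f : A) := \forall u \near U, f (x u) = 0.

Lemma not_zae f : ~ zae f -> \forall u \near U, f (x u) != 0.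
Proof.
move=> h; have [//|] := in_ultra_setVsetC [set u | f (x u) = 0] UU.
by apply: filterS => u /= /eqP.
Qed.

Lemma nonzero_not_zae f : (\forall u \near U, f (x u) != 0) -> ~ zae f.
Proof.
move=> h1 h2; have [u] : exists u, f (x u) != 0 /\ f (x u) = 0.
  by apply: (@filter_ex _ U); apply: filterI.
by move=> [/eqP].
Qed.

Lemma zae_prime f g : zae (f * g) -> zae f \/ zae g.
Proof.
move=> h; have [|hf] := pselect (zae f); first by left.
have [|hg] := pselect (zae g); first by right.
exfalso; apply: (nonzero_not_zae (f := f * g)) h.
have := not_zae hf; have := not_zae hg; apply: filterS2 => u h1 h2.
by rewrite mul_at mulf_neq0.
Qed.

Lemma zae_eq f g : (forall z, f z = g z) -> zae f -> zae g.
Proof. by move=> h; apply: filterS => u <-. Qed.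

(** The first d coordinates are algebraically independent along the ultrafilter and each later one
    is algebraic over them, like a transcendence basis of a function field. *)
Context (d N : nat)
  (indep : forall f, polyf d f -> zae f -> forall z, f z = 0)
  (dep : forall j, (d <= j < N)%N -> exists P : {poly A},
    [/\ coefs_in (polyf d) P, zae P.[coord j] & exists k z, P`_k z != 0]).

(** Variables are eliminated from the last one down. At each stage [euclid] gives an analogue of the
    minimal polynomial of the current coordinate, and the coefficients of the remainders are handed
    to the stage below. [c] collects the leading coefficients by which the pseudo-divisions
    multiply. *)
Lemma tower j (ps : seq A) : (d <= j <= N)%N ->
  (forall p, p \in ps -> polyf j p /\ zae p) ->
  exists (g : nat -> {poly A}) (c : A),
    [/\ polyf j c, ~ zae c,
        forall i, (d <= i < j)%N -> [/\ coefs_in (polyf i) (g i), zae (g i).[coord i] &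
          ~ zae (g i)^`().[coord i]] &
        forall z, (forall i, (d <= i < j)%N -> (g i).[coord i] z = 0) -> c z != 0 ->
          forall p, p \in ps -> p z = 0].
Proof.
elim: j ps => [|j IH] ps.
  rewrite leqn0 andbT => /eqP d0 hps.
  exists (fun=> 0), (fun=> 1); split; first exact: polyf_cst.
  - by apply: nonzero_not_zae; apply: filterE => u; exact: oner_neq0.
  - by move=> i; rewrite ltn0 andbF.
  move=> z _ _ p /hps[h1 h2]; apply: indep => //; exact: polyf_le h1.
rewrite leq_eqVlt => /andP[/orP[/eqP dj|dj] jN] hps.
  exists (fun=> 0), (fun=> 1); split; first exact: polyf_cst.
  - by apply: nonzero_not_zae; apply: filterE => u; exact: oner_neq0.
  - by move=> i; rewrite dj ltnS; case: ltnP => //.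
  by move=> z _ _ p /hps[h1 h2]; apply: indep => //; rewrite dj.
rewrite ltnS in dj.
have djN : (d <= j < N)%N by rewrite dj.
have hP p : exists P : {poly A}, p \in ps -> coefs_in (polyf j) P /\ forall z, p z = P.[coord j] z.
  have [/hps[/polyf_poly[P hP] _]|] := boolP (p \in ps); first by exists P.
  by exists 0.
have [D hD] := choice hP.
have [E [hE zE [k0 [z0 Ek]]]] := dep djN.
have all_ok P : P \in E :: [seq D p | p <- ps] -> coefs_in (polyf j) P /\ zae P.[coord j].
  rewrite inE => /orP[/eqP ->|/mapP[p pps ->]].
    by split => // i; apply: (polyf_le dj); exact: hE.
  have [h1 h2] := hD p pps; split => //; have [_ h3] := hps p pps.
  exact: zae_eq h3.
have euc : (forall p, p \in E :: [seq D p | p <- ps] -> forall i, zae p`_i) \/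
  exists P, [/\ coefs_in (polyf j) P, zae P.[coord j], ~ zae (P^`()).[coord j], ~ zae (lead_coef P) &
    forall p, p \in E :: [seq D p | p <- ps] -> exists k q r, [/\ coefs_in (polyf j) q, coefs_in (polyf j) r,
      forall i, zae r`_i & lead_coef P ^+ k *: p = q * P + r]].
  apply: (@euclid A (polyf j) (polyf j.+1) zae (coord j)) => //.
  - exact: polyf_cst.
  - exact: polyf_cst.
  - by move=> a b; exact: polyf_add.
  - by move=> a; exact: polyf_opp.
  - by move=> a b; exact: polyf_mul.
  - by move=> a; exact: polyf_le.
  - exact: polyf_coord.
  - by move=> a b; exact: polyf_add.
  - by move=> a b; exact: polyf_mul.
  - exact: filterE.
  - move=> a b; rewrite /zae; apply: filterS2 => u h1 h2.
    by rewrite add_at h1 h2 addr0.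
  - by move=> a b _; apply: filterS => u h1; rewrite mul_at h1 mulr0.
  - by move=> a b _ _; exact: zae_prime.
  - move=> n; apply: nonzero_not_zae; apply: filterE => u.
    have -> : (n.+1%:R : A) (x u) = n.+1%:R.
      by rewrite -[n.+1]card_ord -!sumr_const sum_at.
    by rewrite pnatr_eq0.
case: euc => [case1|[P [cP zP zP' zl hdiv]]].
  (* The relation [E] over the first d coordinates excludes the case without [P]: by independence
     all its coefficients would be identically 0. *)
  exfalso; have zz := indep (hE k0) (case1 _ (mem_head _ _) k0).
  by move: Ek; rewrite zz eqxx.
have hdiv' p : exists r : {poly A}, p \in ps ->
    [/\ coefs_in (polyf j) r, forall i, zae r`_i &
      forall z, P.[coord j] z = 0 -> lead_coef P z != 0 -> (forall i, r`_i z = 0) -> p z = 0].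
  have [pps|_] := boolP (p \in ps); last by exists 0.
  have [|k [q [r [h1 h2 h3 h4]]]] := hdiv (D p); first by rewrite inE map_f ?orbT.
  exists r => _; split => // z Pz lz rz.
  have := congr1 (fun q : {poly A} => q.[coord j] z) h4.
  rewrite hornerZ hornerD hornerM add_at !mul_at exp_at Pz mulr0 add0r.
  rewrite (horner_at r) big1 => [/eqP|i _]; last by rewrite rz mul0r.
  rewrite mulf_eq0 expf_eq0 (negbTE lz) andbF /= => /eqP e0.
  by have [_ ->] := hD p pps.
have [r hr] := choice hdiv'.
have jN' : (d <= j <= N)%N by rewrite dj ltnW.
have [|g [c [c1 c2 c3 c4]]] := IH (flatten [seq polyseq (r p) | p <- ps]) jN'.
  move=> f /flattenP[_ /mapP[p pps ->] /(nthP 0)[i _ <-]].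
  by have [h1 h2 _] := hr p pps; split; [exact: h1|exact: h2].
exists (fun i => if i == j then P else g i), (fun z => c z * lead_coef P z); split.
- by apply: polyf_mul; [exact: polyf_le c1|apply: (polyf_le (leqnSn j)); exact: cP].
- by move=> /(@zae_prime c (lead_coef P))[].
- move=> i /andP[di]; rewrite ltnS leq_eqVlt => /orP[/eqP ->|ij]; first by rewrite eqxx.
  by rewrite ltn_eqF //; apply: c3; rewrite di.
move=> z hz; rewrite mulf_eq0 negb_or => /andP[cz lz] p pps.
have [_ _] := hr p pps; apply => //.
  by have := hz j; rewrite eqxx dj ltnSn => /(_ isT).
move=> i; have [ir|ir] := ltnP i (size (r p)); last by rewrite nth_default.
apply: (c4 z) => //.
  move=> k /andP[dk kj]; have := hz k; rewrite ltn_eqF // dk ltnS (ltnW kj).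
  by move=> /(_ isT).
by apply/flattenP; exists (polyseq (r p)); [apply/mapP; exists p|exact: mem_nth].
Qed.

End Tower.

(** * Local inversion of triangular maps *)

Section Triangular.
Context {R : realType}.
Local Notation A := ((nat -> R) -> R).
Implicit Types (p : {poly A}) (z : nat -> R).

Definition eval_coefs p z : {poly R} := \poly_(i < size p) p`_i z.

Lemma eval_coefsE p z i : (eval_coefs p z)`_i = p`_i z.
Proof. by rewrite coef_poly; case: ltnP => // h; rewrite nth_default. Qed.

Lemma eval_coefs_horner p z i : (eval_coefs p z).[z i] = p.[coord i] z.
Proof. by rewrite horner_at horner_poly. Qed.

Lemma natmul_at (f : A) n z : (f *+ n) z = f z *+ n.
Proof. by elim: n => [|n IH]; rewrite ?mulr0n // !mulrS add_at IH. Qed.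

Lemma eval_coefs_nderivn p z n : eval_coefs p^`N(n) z = (eval_coefs p z)^`N(n).
Proof.
by apply/polyP => i; rewrite eval_coefsE !coef_nderivn natmul_at eval_coefsE.
Qed.

Lemma eval_coefs_deriv p z : eval_coefs p^`() z = (eval_coefs p z)^`().
Proof. by apply/polyP => i; rewrite eval_coefsE !coef_deriv natmul_at eval_coefsE. Qed.

Lemma eval_coefs_dep j p z z' : coefs_in (polyf j) p -> (forall i, (i < j)%N -> z i = z' i) ->
  eval_coefs p z = eval_coefs p z'.
Proof.
by move=> hp h; apply/polyP => i; rewrite !eval_coefsE; apply: polyf_dep h; exact: hp.
Qed.

Lemma eval_coefs_setc j p z t : coefs_in (polyf j) p ->
  (eval_coefs p z).[t] = p.[coord j] (setc j z t).
Proof.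
move=> hp; rewrite -eval_coefs_horner {2}/setc eqxx; congr (_.[t]).
by apply: eval_coefs_dep hp _ => i ij; rewrite /setc ltn_eqF.
Qed.

Lemma tri_dep j p z z' : coefs_in (polyf j) p -> (forall i, (i < j.+1)%N -> z i = z' i) ->
  p.[coord j] z = p.[coord j] z'.
Proof. by move=> hp; apply: polyf_dep; exact: polyf_horner. Qed.

Context (N : nat) (g : nat -> {poly A}) (hg : forall i, (i < N)%N -> coefs_in (polyf i) (g i)).

(** Once the earlier coordinates agree, [g i] is a polynomial in one variable that takes the same
    value twice, and Rolle's theorem would give a zero of its derivative inside the box. *)
Lemma triangular_inj al e z z' :
  (forall i w, (i < N)%N -> (forall l, (l < N)%N -> `|w l - al l| < e) -> (g i)^`().[coord i] w != 0) ->
  (forall l, (l < N)%N -> `|z l - al l| < e) -> (forall l, (l < N)%N -> `|z' l - al l| < e) ->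
  (forall i, (i < N)%N -> (g i).[coord i] z = (g i).[coord i] z') ->
  forall i, (i < N)%N -> z i = z' i.
Proof.
move=> hder hz hz' hzz' i; have [n] := ubnP i; elim: n i => // n IH i; rewrite ltnS => ilen iN.
have IH' l : (l < i)%N -> z l = z' l.
  by move=> li; apply: IH; [exact: leq_trans li _|exact: ltn_trans iN].
have eq1 : eval_coefs (g i) z = eval_coefs (g i) z' by apply: eval_coefs_dep (hg iN) IH'.
have eq2 : (eval_coefs (g i) z).[z i] = (eval_coefs (g i) z).[z' i].
  by rewrite {2}eq1 !eval_coefs_horner hzz'.
have main u v : u < v -> `|u - al i| < e -> `|v - al i| < e ->
    (eval_coefs (g i) z).[u] != (eval_coefs (g i) z).[v].
  move=> uv hu hv; apply/eqP => /(polyrcf.poly_rolle uv)[c].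
  rewrite in_itv /= => /andP[uc cv] /eqP; rewrite -eval_coefs_deriv (@eval_coefs_setc i).
    apply/negP; apply: hder => // l lN; rewrite /setc; case: eqP => [->|_]; last exact: hz.
    by move: hu hv; rewrite !ltr_norml => /andP[? ?] /andP[? ?]; apply/andP; split; lra.
  by apply: (coefs_in_deriv (S := polyf i)); [exact: polyf_cst|move=> a b; exact: polyf_add|exact: hg].
by have [||//] := ltgtP (z i) (z' i) => h; [have := main _ _ h (hz _ iN) (hz' _ iN)
  |have := main _ _ h (hz' _ iN) (hz _ iN)]; rewrite eq2 eqxx.
Qed.

(** One coordinate is solved for at a time: with the earlier ones substituted, the equation is a
    polynomial in the increment of coordinate j whose linear coefficient is nonzero at the base
    point, as [anal_ift] requires. *)
Lemma triangular_inverse (al : nat -> R) j : (j <= N)%N ->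
  (forall i, (i < N)%N -> (g i)^`().[coord i] al != 0) ->
  exists ps : nat -> A, (forall i, (i < j)%N -> anal N (ps i) /\ ps i (fun=> 0) = 0) /\
    exists2 rho, 0 < rho & forall y, pd N (fun=> rho) y -> forall i, (i < j)%N ->
      (g i).[coord i] (fun l => al l + ps l y) = (g i).[coord i] al + y i.
Proof.
move=> + hder; elim: j => [_|j IH jN].
  by exists (fun=> fun=> 0); split => //; exists 1.
have [ps [hps [rho p0 hrho]]] := IH (ltnW jN).
pose w y := setc j (fun l => al l + ps l y) (al j).
(* Taylor coefficients of [g j] in the increment at [al j], with the prescribed value subtracted
   from the constant one. *)
pose c k : A := fun y => (g j)^`N(k).[coord j] (w y) - (if k == 0%N then (g j).[coord j] al + y j else 0).
have hgk k : coefs_in (polyf j) (g j)^`N(k).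
  by apply: (coefs_in_nderivn (S := polyf j)); [exact: polyf_cst|move=> a b; exact: polyf_add|exact: hg].
have w0 k : (g j)^`N(k).[coord j] (w (fun=> 0)) = (g j)^`N(k).[coord j] al.
  apply: (tri_dep (hgk k)) => i; rewrite ltnS leq_eqVlt /w /setc => /orP[/eqP ->|ij].
    by rewrite eqxx.
  by rewrite ltn_eqF //; have [_ ->] := hps i ij; rewrite addr0.
have [||||ph [h1 h2 [rho' p' h3]]] := @anal_ift R N (size (g j)).+2 c.
- by [].
- move=> k; apply: anal_sub; last first.
    case: (k == 0)%N; last exact: anal_cst.
    by apply: anal_add; [exact: anal_cst|exact: anal_proj].
  apply: (polyf_anal (n := j.+1) (l := fun i y => w y i)); first exact: polyf_horner.
  move=> i; rewrite ltnS leq_eqVlt /w /setc => /orP[/eqP ->|ij].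
    by rewrite eqxx; exact: anal_cst.
  rewrite ltn_eqF //; apply: anal_add; first exact: anal_cst.
  by have [] := hps i ij.
- by rewrite /c /= w0 nderivn0 addr0 subrr.
- by rewrite /c subr0 w0 nderivn1; exact: hder.
exists (fun i => if i == j then ph else ps i); split.
  move=> i; rewrite ltnS leq_eqVlt => /orP[/eqP ->|ij]; first by rewrite eqxx.
  by rewrite ltn_eqF //; exact: hps.
exists (Num.min rho rho'); first by rewrite lt_min p0.
move=> y hy i; have hy1 : pd N (fun=> rho) y.
  by move=> l /hy /le_trans; apply; rewrite ge_min lexx.
have hy2 : pd N (fun=> rho') y.
  by move=> l /hy /le_trans; apply; rewrite ge_min lexx orbT.
rewrite ltnS leq_eqVlt => /orP[/eqP ->|ij]; last first.
  rewrite -hrho //; apply: (tri_dep (hg (ltn_trans ij jN))) => l li.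
  by rewrite ltn_eqF // (leq_trans li).
have := h3 y hy2; rewrite big_nat_recl // /c /= expr0 mulr1 nderivn0 => /eqP.
under eq_bigr do rewrite subr0.
rewrite addrAC subr_eq0 => /eqP <-.
transitivity (eval_coefs (g j) (w y)).[al j + ph y].
  rewrite (eval_coefs_setc _ _ (hg jN)); apply: (tri_dep (hg jN)) => l.
  by rewrite /w /setc; case: (l =P j) => [->|].
rewrite (@nderiv_taylor_wide _ (size (g j)).+2); last 2 first.
- exact: mulrC.
- by apply: leq_trans (size_poly _ _) _; rewrite !leqW.
have wj : w y j = al j by rewrite /w /setc eqxx.
rewrite big_ord_recl nderivn0 expr0 mulr1; congr (_ + _).
  by rewrite -[in RHS]eval_coefs_horner wj.
rewrite big_mkord; apply: eq_bigr => i' _; rewrite -eval_coefs_nderivn; congr (_ * _).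
by rewrite -[in RHS]eval_coefs_horner wj.
Qed.

Lemma anal_translate (f : A) : anal N f -> exists2 rho, 0 < rho &
  forall b : nat -> R, pd N (fun=> rho) b -> anal N (fun z => f (fun i => b i + z i)).
Proof.
move=> [r [C [p h]]]; have p2 : 0 < r / 2 by lra.
exists (r / 2) => // b hb; exists (r / 2), C; split => //.
apply: (@An_comp _ N N (fun=> r) (fun=> r / 2) C f (fun i z => b i + z i)) => // i iN.
have r0 : forall l : nat, 0 < (fun=> r / 2) l by [].
have h1 : An N (fun=> r / 2) (`|b i| + r / 2) (fun z => b i + z i).
  by apply: An_add => //; [exact: An_cst|exact: (An_proj r0)].
apply: (An_le h1).
by have := hb i iN; clear -p2; lra.
Qed.

End Triangular.

(** * Submanifolds of semialgebraic sets *)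

Section Manifold.
Context {R : realType} (N : nat).
Local Notation A := ((nat -> R) -> R).
Implicit Types (s : seq 'I_N) (x : 'rV[R]_N) (z : nat -> R).

(* The coordinates of x read in the order s. *)
Definition hat s x : nat -> R := fun i => nth 0 [seq x 0 j | j <- s] i.
Definition unhat s z : 'rV[R]_N := \row_j z (index j s).

Lemma hat_nth s x i j0 : (i < size s)%N -> hat s x i = x 0 (nth j0 s i).
Proof. by move=> h; rewrite /hat (nth_map j0). Qed.

Lemma hat_index s x j : j \in s -> hat s x (index j s) = x 0 j.
Proof. by move=> h; rewrite (hat_nth _ j) ?index_mem // nth_index. Qed.

Lemma polyf_continuous s n (f : A) : polyf n f -> continuous (fun x => f (hat s x)).
Proof.
elim => [c|i _|f1 f2 _ h1 _ h2|f1 f2 _ h1 _ h2] x.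
- exact: (@cst_continuous _ _ c x).
- have [h|h] := ltnP i (size s); last first.
    rewrite (_ : (fun _ => _) = fun=> 0); first exact: (@cst_continuous _ _ 0 x).
    by apply/funext => y; rewrite /hat nth_default // size_map.
  have [j0 _] : exists j : 'I_N, j \in s.
    by case: s h => // j s' _; exists j; exact: mem_head.
  rewrite (_ : (fun _ => _) = fun y : 'rV[R]_N => y 0 (nth j0 s i)); first exact: coord_continuous.
  by apply/funext => y; rewrite (hat_nth _ j0).
- exact: (cvgD (h1 x) (h2 x)).
- exact: (cvgM (h1 x) (h2 x)).
Qed.

Lemma polyf_near_lt s n (f : A) x e : polyf n f -> f (hat s x) < e ->
  \forall y \near x, f (hat s y) < e.
Proof.
move=> hf he; exact: (@cvgr_lt R _ (nbhs x) _ (fun y => f (hat s y)) (f (hat s x)) (polyf_continuous hf (x:=x)) e he). Qed.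

Lemma polyf_near_neq0 s n (f : A) x : polyf n f -> f (hat s x) != 0 ->
  \forall y \near x, f (hat s y) != 0.
Proof.
move=> hf he; exact: (@cvgr_neq0 R R _ (nbhs x) _ (fun y => f (hat s y)) (f (hat s x)) (polyf_continuous hf (x:=x)) he). Qed.

Context (s : seq 'I_N) (us : uniq s) (ss : size s = N).

Lemma mem_order j : j \in s.
Proof.
have [||_ ->] := @uniq_min_size _ s (index_enum 'I_N) us.
- by move=> i _; exact: mem_index_enum.
- by rewrite ss /index_enum -enumT size_enum_ord.
- exact: mem_index_enum.
Qed.

Lemma hatK x : unhat s (hat s x) = x.
Proof. by apply/rowP => j; rewrite mxE hat_index ?mem_order. Qed.

Lemma unhatK z i : (i < N)%N -> hat s (unhat s z) i = z i.
Proof.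
move=> iN; rewrite (hat_nth _ (Ordinal iN)) ?ss // mxE index_uniq ?ss //.
Qed.

Lemma unhat_ext z z' : (forall i, (i < N)%N -> z i = z' i) -> unhat s z = unhat s z'.
Proof. by move=> h; apply/rowP => j; rewrite !mxE h // -[X in (_ < X)%N]ss index_mem mem_order. Qed.

Lemma polyf_analytic n (f : A) a : polyf n f -> (n <= N)%N -> analytic_fun_at (fun x => f (hat s x)) a.
Proof.
move=> hf nN.
pose l i : A := fun z => hat s a i + (if nth None [seq Some j | j <- s] i is Some j then z (val j) else 0).
have an : anal N (fun z => f (fun i => l i z)).
  apply: (polyf_anal hf) => i iN; apply: anal_add; first exact: anal_cst.
  case: (nth _ _ _) => [j|]; [exact: (anal_proj (ltn_ord j))|exact: anal_cst].
have := anal_analytic a an; congr analytic_fun_at; apply/funext => x.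
apply: (polyf_dep hf) => i iN; have iN' := leq_trans iN nN.
rewrite /l (nth_map (Ordinal iN')) ?ss // !(hat_nth _ (Ordinal iN')) ?ss // ptE !mxE.
by rewrite addrCA subrr addr0.
Qed.

Context (d : nat) (g : nat -> {poly A})
  (hg : forall i, (d <= i < N)%N -> coefs_in (polyf i) (g i)) (a0 : 'rV[R]_N) (e : R)
  (hder : forall i w, (d <= i < N)%N -> (forall l, (l < N)%N -> `|w l - hat s a0 l| < e) ->
    (g i)^`().[coord i] w != 0).

(** The chart at a has the components g_i - g_i(a), the coordinates themselves serving as the first
    d of them. It is triangular with nonvanishing diagonal derivatives, hence injective on the box
    and with an analytic local inverse; on the set, its last N - d components are 0. *)
Lemma triangular_manifold : analytic_submanifold d
  [set x | (forall l, (l < N)%N -> `|hat s x l - hat s a0 l| < e) /\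
    forall i, (d <= i < N)%N -> (g i).[coord i] (hat s x) = 0].
Proof.
move=> a [ha1 ha2].
pose g' i := if (i < d)%N then 'X else g i.
have hg' i : (i < N)%N -> coefs_in (polyf i) (g' i).
  move=> iN; rewrite /g'; case: ltnP => h; last by apply: hg; rewrite h.
  by move=> k; rewrite coefX; case: eqP => _; exact: polyf_cst.
have hder' i w : (i < N)%N -> (forall l, (l < N)%N -> `|w l - hat s a0 l| < e) ->
    (g' i)^`().[coord i] w != 0.
  move=> iN hw; rewrite /g'; case: ltnP => h; last by apply: hder; rewrite ?h.
  by rewrite derivX hornerC; exact: oner_neq0.
have [ps [ps1 [rho p0 ps2]]] := triangular_inverse hg' (leqnn N) (fun i iN => hder' i _ iN ha1).
have [r1 r10 hr1] : exists2 r, 0 < r & forall l (y : nat -> R), (l < N)%N -> pd N (fun=> r) y ->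
    `|hat s a l + ps l y - hat s a0 l| < e.
  have [l r r' /andP[_ h] hl y lN hy|l lN|r [r0 hr]] := @fin_min R (fun l r => forall y, (l < N)%N -> pd N (fun=> r) y ->
    `|hat s a l + ps l y - hat s a0 l| < e) N.
  - by apply: hl => // i /hy /le_trans; apply.
  - have [h1 h2] := ps1 l lN.
    pose dd := (e - `|hat s a l - hat s a0 l|) / 2.
    have dd0 : 0 < dd by have := ha1 l lN; rewrite /dd; move=> ?; lra.
    have [r [r0 hr]] := anal_small h1 h2 dd0.
    exists r; split => // y _ hy; have := An_bound hr hy; have := ha1 l lN; rewrite /dd.
    have := ler_normD (hat s a l - hat s a0 l) (ps l y); rewrite addrAC.
    move=> *; lra.
  by exists r => // l y lN; exact: hr.
have [r2 r20 hr2] : exists2 r, 0 < r & forall l, (l < N)%N -> forall b, pd N (fun=> r) b ->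
    anal N (fun z => ps l (fun i => b i + z i)).
  have [l r r' /andP[_ h] hl lN b hb|l lN|r [r0 hr]] := @fin_min R (fun l r => (l < N)%N -> forall b, pd N (fun=> r) b ->
    anal N (fun z => ps l (fun i => b i + z i))) N.
  - by apply: hl => // i /hb /le_trans; apply.
  - have [h1 _] := ps1 l lN.
    by have [r r0 hr] := anal_translate h1; exists r; split.
  by exists r => // l lN; exact: hr.
pose r := Num.min rho (Num.min r1 r2).
have r0 : 0 < r by rewrite !lt_min p0 r10.
pose ph x : 'rV[R]_N := \row_i ((g' i).[coord i] (hat s x) - (g' i).[coord i] (hat s a)).
pose W := [set y : 'rV[R]_N | forall i, `|y 0 i| < r].
pose B := [set x : 'rV[R]_N | forall l, (l < N)%N -> `|hat s x l - hat s a0 l| < e].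
pose psi (y : 'rV[R]_N) := unhat s (fun l => hat s a l + ps l (pt y)).
have hatpsi y l : (l < N)%N -> hat s (psi y) l = hat s a l + ps l (pt y) by move=> lN; exact: unhatK.
have Wpd y : W y -> pd N (fun=> r) (pt y).
  by move=> hy l lN; rewrite -[l]/(val (Ordinal lN)) ptE ltW.
have Wpd' y : W y -> [/\ pd N (fun=> rho) (pt y), pd N (fun=> r1) (pt y) & pd N (fun=> r2) (pt y)].
  by move=> /Wpd h; split => l /h /le_trans; apply; rewrite /r !ge_min lexx ?orbT.
have phpsi y : W y -> ph (psi y) = y.
  move=> /Wpd'[hy _ _]; apply/rowP => i; rewrite mxE.
  have := ps2 _ hy i (ltn_ord i); rewrite ptE => h.
  rewrite (tri_dep (z' := fun l => hat s a l + ps l (pt y)) (hg' _ (ltn_ord i))) ?h.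
    by rewrite addrC addKr.
  by move=> l li; rewrite hatpsi // (leq_trans li).
have Bpsi y : W y -> B (psi y).
  by move=> /Wpd'[_ hy _] l lN; rewrite hatpsi //; exact: hr1.
have psiph x : B x -> W (ph x) -> psi (ph x) = x.
  move=> Bx Wx; have BB := Bpsi _ Wx.
  rewrite -[RHS]hatK -[LHS]hatK; apply: unhat_ext => i iN.
  apply: (triangular_inj hg' hder' BB Bx) => // l lN.
  have /(congr1 (fun u : 'rV[R]_N => u 0 (Ordinal lN))) := phpsi _ Wx.
  by rewrite !mxE => /(congr1 (fun t => t + (g' l).[coord l] (hat s a))); rewrite !subrK.
have nearph x i c : `|ph x 0 i| < c -> \forall y \near x, `|ph y 0 i| < c.
  have hf : polyf i.+1 (fun z => (g' i).[coord i] z - (g' i).[coord i] (hat s a)).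
    by apply: polyf_add; [apply: polyf_horner; exact: hg'|exact: polyf_cst].
  rewrite ltr_norml => /andP[h1 h2].
  have h1' : - ph x 0 i < c by rewrite ltrNl.
  rewrite !mxE in h1' h2.
  have := polyf_near_lt (x := x) (s := s) hf h2; have := polyf_near_lt (x := x) (s := s) (polyf_opp hf) h1'.
  by apply: filterS2 => y u1 u2; rewrite ltr_norml !mxE u2 andbT ltrNl.
have oB : open B.
  rewrite openE => x Bx.
  have : \forall y \near x, forall l : 'I_N, `|hat s y l - hat s a0 l| < e.
    apply: (@filter_forall _ _ (fun (l : 'I_N) (y : 'rV[R]_N) => `|hat s y l - hat s a0 l| < e) (nbhs x) _) => l.
    have := Bx l (ltn_ord l); rewrite ltr_norml => /andP[h1 h2].
    have h1' : - (hat s x l - hat s a0 l) < e by rewrite ltrNl.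
    have hf : polyf N (fun z => z l - hat s a0 l).
      by apply: polyf_add; [exact: polyf_coord|exact: polyf_cst].
    have := polyf_near_lt (x := x) (s := s) hf h2; have := polyf_near_lt (x := x) (s := s) (polyf_opp hf) h1'.
    by apply: filterS2 => y u1 u2; rewrite ltr_norml u2 andbT ltrNl.
  by apply: filterS => y hy l lN; exact: (hy (Ordinal lN)).
have oW : open W.
  rewrite openE => y Wy; apply/nbhs_rowP.
  pose m := \big[Num.min/1]_i (r - `|y 0 i|).
  have [mu mu0 hmu] : exists2 mu, 0 < mu & forall i, mu <= r - `|y 0 i|.
    exists m; first by rewrite /m; elim/big_ind: _ => [|u v u0 v0|i _]; [|rewrite lt_min u0|rewrite subr_gt0; exact: Wy].
    by move=> i; rewrite /m (bigD1 i) //= ge_min lexx.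
  exists mu => // x hx i.
  have := hx i; have := hmu i; have := ler_normD (x 0 i - y 0 i) (y 0 i); rewrite subrK.
  move=> *; lra.
exists (B `&` [set x | W (ph x)]), W, ph, psi; split.
- split; last exact: oW.
    rewrite openE => x [Bx Wx].
    apply: filterI; first by move: oB; rewrite openE; exact.
    apply: (@filter_forall _ _ (fun (i : 'I_N) (y : 'rV[R]_N) => `|ph y 0 i| < r) (nbhs x) _) => i.
    by apply: nearph; exact: Wx.
  split; first exact: ha1.
  by move=> i; rewrite mxE subrr normr0.
- split => [x _ i|y Wy i].
    rewrite (_ : (fun _ => _) = fun x => (fun z => (g' i).[coord i] z - (g' i).[coord i] (hat s a)) (hat s x)).
      apply: (@polyf_analytic i.+1 (fun z => (g' i).[coord i] z - (g' i).[coord i] (hat s a))) => //; apply: polyf_add; last exact: polyf_cst.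
      by apply: polyf_horner; exact: hg'.
    by apply/funext => x'; rewrite mxE.
  have iN : (index i s < N)%N by rewrite -[X in (_ < X)%N]ss index_mem mem_order.
  have [_ _ hy] := Wpd' _ Wy.
  have an := anal_add (anal_cst N (hat s a (index i s))) (hr2 _ iN _ hy).
  have := anal_analytic y an; congr analytic_fun_at; apply/funext => x; rewrite mxE.
  have [rr [_ hrr]] := anal_dep (ps1 _ iN).1.
  congr (_ + _); congr (ps _ _); apply/funext => l.
  have [lN|lN] := ltnP l N; last by rewrite /pt insubN ?addr0 // -leqNgt.
  by rewrite -[l]/(val (Ordinal lN)) !ptE !mxE addrCA subrr addr0.
- by move=> x [Bx Wx]; split => //; exact: psiph.
- by move=> y Wy; split; [split; [exact: Bpsi|rewrite /= phpsi]|exact: phpsi].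
apply/seteqP; split.
  move=> _ [x [[_ gx] [Bx Wx]] <-]; split => // i di.
  rewrite mxE /g' ltnNge di /= gx ?di ?ltn_ord // ha2 ?di ?ltn_ord //.
  by rewrite subrr.
move=> y [Wy hy]; exists (psi y); last exact: phpsi.
split; last by split; [exact: Bpsi|rewrite /= phpsi].
split; first exact: Bpsi.
move=> i /andP[di iN].
have /(congr1 (fun u : 'rV[R]_N => u 0 (Ordinal iN))) := phpsi _ Wy.
rewrite mxE (hy (Ordinal iN) di) /g' /= ltnNge di /=.
by rewrite (ha2 i) ?di // subr0.
Qed.

End Manifold.

(** * From algebraically independent coordinates to submanifolds of X *)

Section Independence.
Context {R : realType} (N : nat) (X W : set 'rV[R]_N).
Local Notation A := ((nat -> R) -> R).
Implicit Types (s t : seq 'I_N).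

Definition independent t := forall f : A, polyf (size t) f -> (exists z, f z != 0) ->
  exists x, [/\ X x, W x & f (hat t x) != 0].

Lemma near_has (T : Type) (U : set_system T) {UU : UltraFilter U} (I : eqType) (S : seq I)
    (P : T -> pred I) :
  (\forall u \near U, has (P u) S) -> exists2 i, i \in S & \forall u \near U, P u i.
Proof.
elim: S => [|i S IH] h.
  by exfalso; have [u] := @filter_ex _ U _ _ h.
have [h1|h1] := in_ultra_setVsetC [set u | P u i] UU.
  by exists i => //; exact: mem_head.
have [|k kS hk] := IH; last by exists k => //; rewrite inE kS orbT.
by apply: filterS2 h h1 => u /= /orP[|].
Qed.

Lemma hat_cat t t' (x : 'rV[R]_N) i : (i < size t)%N -> hat (t ++ t') x i = hat t x i.
Proof. by move=> h; rewrite /hat map_cat nth_cat size_map h. Qed.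

Context (saX : semialgebraic X) (oW : open W).

(** One of the basic pieces of X belongs to the ultrafilter, and [tower] replaces its equations by a
    triangular system. Near a point where the system is nondegenerate and the strict inequalities
    hold, all zeros of the system lie in X. *)
Lemma independent_manifold t t' : uniq (t ++ t') -> size (t ++ t') = N -> independent t ->
  (forall j, (size t <= j < N)%N -> exists P : {poly A}, [/\ coefs_in (polyf (size t)) P,
    forall x, X x -> W x -> P.[coord j] (hat (t ++ t') x) = 0 & exists k z, P`_k z != 0]) ->
  exists G, [/\ G !=set0, G `<=` X `&` W & analytic_submanifold (size t) G].
Proof.
set s := t ++ t'; set d := size t => us ss ind dep.
have dN : (d <= N)%N by rewrite -[X in (_ <= X)%N]ss size_cat leq_addr.
have hats (f : A) x : polyf d f -> f (hat s x) = f (hat t x).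
  by move=> hf; apply: (polyf_dep hf) => i it; exact: hat_cat.
pose F : set_system 'rV[R]_N := [set S | exists f : A, [/\ polyf d f, exists z, f z != 0 &
  forall x, X x -> W x -> f (hat s x) != 0 -> S x]].
(* Independence makes the sets of [F] nonempty; intersections are covered because two nonzero
   polynomials are nonzero at a common point. *)
have FF : ProperFilter F.
  apply: Build_ProperFilter_ex.
    move=> S [f [hf f0 h]]; have [x [Xx Wx fx]] := ind f hf f0.
    by exists x; apply: h => //; rewrite hats.
  split.
  - exists (fun=> 1); split => //; first exact: polyf_cst.
    by exists (fun=> 0); exact: oner_neq0.
  - move=> S1 S2 [f1 [hf1 [z1 f10] h1]] [f2 [hf2 [z2 f20] h2]].
    exists (fun z => f1 z * f2 z); split; first exact: polyf_mul.
      have [z [a b]] := polyf_nonzero2 hf1 hf2 f10 f20.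
      by exists z; rewrite mulf_neq0.
    by move=> x Xx Wx; rewrite mulf_eq0 negb_or => /andP[a b]; split; [exact: h1|exact: h2].
  - move=> S1 S2 S12 [f [hf f0 h]]; exists f; split => // x Xx Wx fx.
    by apply: S12; exact: h.
(* A point of X `&` W moving along U is generic for the coordinates in t. *)
have [U [UU FU]] := ultraFilterLemma FF.
have UX : \forall x \near U, X x.
  by apply: FU; exists (fun=> 1); split => //; [exact: polyf_cst|exists (fun=> 0); exact: oner_neq0].
have UW : \forall x \near U, W x.
  by apply: FU; exists (fun=> 1); split => //; [exact: polyf_cst|exists (fun=> 0); exact: oner_neq0].
have [S eX] := saX.
have [pq pqS hpq] : exists2 pq, pq \in S & \forall x \near U,
    all (fun p => peval p x == 0) pq.1 && all (fun q => 0 < peval q x) pq.2.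
  by apply: near_has; move: UX; rewrite eX.
pose pf p : A := fun z => mpoly.meval (fun i : 'I_N => z (index i s)) p.
have ixN (i : 'I_N) : (index i s < N)%N by rewrite -[X in (_ < X)%N]ss index_mem mem_order.
have hpf p : polyf N (pf p) by apply: (@mpoly_polyf R N N p (fun i => index i s)).
have pfE p x : pf p (hat s x) = peval p x.
  by rewrite /pf /peval; apply: mpoly.meval_eq => i; rewrite hat_index // mem_order.
have [||||g [c [c1 c2 c3 c4]]] := @tower R 'rV[R]_N U UU (hat s) d N _ _ N [seq pf p | p <- pq.1].
- move=> f hf fz z; apply: contrapT => /eqP f0.
  have h : \forall x \near U, f (hat s x) != 0 by apply: FU; exists f; split => //; exists z.
  by apply: (nonzero_not_zae (x := hat s) h fz).
- move=> j /dep[P [h1 h2 h3]]; exists P; split => //.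
  by apply: filterS2 UX UW => x; exact: h2.
- by rewrite dN leqnn.
- move=> _ /mapP[p ppq ->]; split; first exact: hpf.
  by apply: filterS hpq => x /andP[/allP h _]; rewrite pfE; apply/eqP; exact: h.
have near_g : \forall x \near U, forall i : 'I_N, (d <= i)%N ->
    (g i).[coord i] (hat s x) = 0 /\ (g i)^`().[coord i] (hat s x) != 0.
  apply: (@filter_forall _ _ (fun (i : 'I_N) (x : 'rV[R]_N) => (d <= i)%N ->
    (g i).[coord i] (hat s x) = 0 /\ (g i)^`().[coord i] (hat s x) != 0) U _) => i.
  have [di|di] := leqP d i; last by apply: filterE => x.
  have [_ h1 /not_zae h2] := c3 i (introT andP (conj di (ltn_ord i))).
  by apply: filterS2 h1 h2.
have [a [[Xa Wa] [/andP[_ qa] [ca ga]]]] : exists a, (X a /\ W a) /\ ((all (fun p => peval p a == 0) pq.1 && all (fun q => 0 < peval q a) pq.2) /\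
    (c (hat s a) != 0 /\ forall i : 'I_N, (d <= i)%N ->
    (g i).[coord i] (hat s a) = 0 /\ (g i)^`().[coord i] (hat s a) != 0)).
  apply: (@filter_ex _ U); apply: filterI; first exact: filterI.
  by apply: filterI => //; apply: filterI => //; exact: not_zae.
have nq : \forall x \near a, all (fun q => 0 < peval q x) pq.2.
  elim: (pq.2) qa => [|q l IH] /=; first by move=> _; apply: filterE.
  move=> /andP[q0 /IH l0].
  have nq0 : \forall x \near a, 0 < peval q x.
    have h : - pf q (hat s a) < 0 by rewrite oppr_lt0 pfE.
    have := polyf_near_lt (polyf_opp (hpf q)) h.
    by apply: filterS => x; rewrite oppr_lt0 pfE.
  by apply: filterS2 nq0 l0 => x -> ->.
have ng : \forall x \near a, forall i : 'I_N, (d <= i)%N -> (g i)^`().[coord i] (hat s x) != 0.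
  apply: (@filter_forall _ _ (fun (i : 'I_N) (x : 'rV[R]_N) => (d <= i)%N ->
    (g i)^`().[coord i] (hat s x) != 0) (nbhs a) _) => i.
  have [di|di] := leqP d i; last by apply: filterE => x.
  have [ci _ _] := c3 i (introT andP (conj di (ltn_ord i))).
  have cd : coefs_in (polyf i) (g i)^`().
    by apply: (coefs_in_deriv (S := polyf i)) => //; [exact: polyf_cst|move=> u v; exact: polyf_add].
  have := polyf_near_neq0 (polyf_horner cd) (ga i di).2.
  by apply: filterS.
have nc := polyf_near_neq0 c1 ca.
have nW : \forall x \near a, W x by move: oW; rewrite openE; exact.
have /nbhs_rowP[e e0 he] : nbhs a [set x | [/\ W x, all (fun q => 0 < peval q x) pq.2, c (hat s x) != 0 &
    forall i : 'I_N, (d <= i)%N -> (g i)^`().[coord i] (hat s x) != 0]].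
  apply: (@filterS3 _ (nbhs a) _ _ _ _ _ _ (filterI nW nq) nc ng).
  by move=> x [? ?] ? ?; split.
have box x : (forall l, (l < N)%N -> `|hat s x l - hat s a l| < e) -> forall i, `|x 0 i - a 0 i| < e.
  by move=> h i; have := h _ (ixN i); rewrite !hat_index // mem_order.
exists [set x | (forall l, (l < N)%N -> `|hat s x l - hat s a l| < e) /\
    forall i, (d <= i < N)%N -> (g i).[coord i] (hat s x) = 0]; split.
- exists a; split; first by move=> l _; rewrite subrr normr0.
  by move=> i /andP[di iN]; have [] := ga (Ordinal iN) di.
- move=> x [h1 h2]; have [Wx qx cx _] := he _ (box _ h1); split => //.
  rewrite eX /=; apply/hasP; exists pq => //; rewrite qx andbT.
  apply/allP => p ppq; rewrite -pfE; apply/eqP; apply: (c4 (hat s x)) => //.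
  by apply: map_f.
apply: triangular_manifold => //.
  by move=> i /c3[].
move=> i w /andP[di iN] hw.
have hx : forall i, `|unhat s w 0 i - a 0 i| < e.
  by apply: box => l lN; rewrite unhatK //; exact: hw.
have [_ _ _ h] := he _ hx; have := h (Ordinal iN) di.
have [ci _ _] := c3 i (introT andP (conj di iN)).
have cd : coefs_in (polyf i) (g i)^`().
  by apply: (coefs_in_deriv (S := polyf i)) => //; [exact: polyf_cst|move=> u v; exact: polyf_add].
rewrite -(tri_dep (z := hat s (unhat s w)) cd) // => l li; rewrite unhatK //.
exact: leq_trans li iN.
Qed.

(** If [v] were independent, a largest independent family t would have more than n members. All
    other coordinates are algebraic over t by maximality, so [independent_manifold] gives a
    submanifold of forbidden dimension. *)
Lemma dependent_coordinates n (v : seq 'I_N) :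
  (forall d G, (n < d <= N)%N -> G !=set0 -> G `<=` X `&` W -> ~ analytic_submanifold d G) ->
  uniq v -> size v = n.+1 ->
  exists f : A, [/\ polyf n.+1 f, exists z, f z != 0 &
    forall x, X x -> W x -> f (hat v x) = 0].
Proof.
move=> hG uv sv; apply: contrapT => hv.
have iv : independent v.
  move=> f; rewrite sv => hf f0; apply: contrapT => h; apply: hv; exists f; split => // x Xx Wx.
  by apply: contrapT => /eqP fx; apply: h; exists x.
pose P k := `[< exists t, [/\ uniq t, independent t & size t = k] >].
have exP : exists k, P k by exists n.+1; apply/asboolP; exists v.
have boundP k : P k -> (k <= N)%N.
  move=> /asboolP[t [ut _ <-]]; rewrite -[X in (_ <= X)%N]card_ord.
  by rewrite -(card_uniqP ut) max_card.
case: (ex_maxnP exP boundP) => k /asboolP[t [ut it st]] maxk.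
have nk : (n < k)%N by apply: maxk; apply/asboolP; exists v.
pose t' := [seq j <- enum 'I_N | j \notin t].
have us : uniq (t ++ t').
  rewrite cat_uniq ut filter_uniq ?enum_uniq // andbT.
  by apply/hasPn => j; rewrite mem_filter => /andP[].
have ss : size (t ++ t') = N.
  rewrite -(card_uniqP us) -[RHS]card_ord; apply: eq_card => j.
  by rewrite mem_cat mem_filter mem_enum inE andbT; case: (j \in t).
have [|G [G0 GX]] := independent_manifold us ss it; last first.
  by rewrite st; apply: hG => //; rewrite nk boundP //; apply/asboolP; exists t.
move=> j /andP[tj jN].
pose j' := nth (Ordinal jN) (t ++ t') j.
have jt : j' \notin t.
  have : j' \in t'.
    rewrite /j' nth_cat ltnNge tj /=; apply: mem_nth.
    by rewrite ltn_subLR // -size_cat ss.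
  by rewrite mem_filter => /andP[].
have : ~ independent (rcons t j').
  move=> h; have : P k.+1 by apply/asboolP; exists (rcons t j'); rewrite rcons_uniq jt ut size_rcons st.
  by move/maxk; rewrite ltnn.
move=> /existsNP[f /not_implyP[hf /not_implyP[[z0 f0] hx]]].
rewrite size_rcons in hf; have [Q [hQ eQ]] := polyf_poly hf.
exists Q; split => //.
  move=> x Xx Wx; transitivity (f (hat (rcons t j') x)); last first.
    by apply: contrapT => /eqP h; apply: hx; exists x.
  have hr : hat (rcons t j') x (size t) = hat (t ++ t') x j.
    rewrite (hat_nth _ j') ?size_rcons // nth_rcons ltnn eqxx.
    by rewrite (hat_nth _ (Ordinal jN)) ?ss.
  rewrite eQ !horner_at; apply: eq_bigr => i _.
  rewrite /coord hr; congr (_ * _); apply: (polyf_dep (hQ i)) => l lt.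
  by rewrite hat_cat // -cats1 hat_cat.
apply: contrapT => h; move: f0; rewrite eQ horner_at big1 ?eqxx // => i _.
have -> : Q`_i z0 = 0 by apply: contrapT => /eqP q; apply: h; exists i, z0.
by rewrite mul0r.
Qed.

End Independence.

(** * Algebraic relations and Hilbert functions *)

Section DimensionRelations.
Context {R : realType} (N n : nat) (X : set 'rV[R]_N).
Local Notation A := ((nat -> R) -> R).

(** For each d > n some neighbourhood S of 0 is such that V within S contains no d-dimensional
    submanifold; finitely many d allow a common neighbourhood. *)
Lemma dim0_relations : semialgebraic X -> has_dim0 X n ->
  exists W, nbhs (0 : 'rV[R]_N) W /\ forall v : seq 'I_N, uniq v -> size v = n.+1 ->
    exists p : mpoly.mpoly N R, [/\ p != 0, supported (mem v) p &
      forall x, X x -> W x -> peval p x = 0].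
Proof.
move=> saX [[V [_ V0 [U U0 XUV]] dV] _].
have hd (d : 'I_N.+1) : exists S : set 'rV[R]_N, nbhs (0 : 'rV[R]_N) S /\ ((n < d)%N ->
    forall G, G !=set0 -> G `<=` V `&` S -> ~ analytic_submanifold d G).
  have [nd|nd] := ltnP n d; last by exists setT; split => //; exact: filterT.
  have /asboolPn/existsNP[S /not_implyP[S0 hS]] : ~~ `[< forall S : set 'rV[R]_N, nbhs (0 : 'rV[R]_N) S ->
     exists G : set 'rV[R]_N, [/\ G !=set0, G `<=` V `&` S & analytic_submanifold d G] >].
    apply/negP => h; move: nd; rewrite ltnNge => /negP; apply; rewrite -dV.
    exact: (@leq_bigmax_cond _ (fun d : 'I_N.+1 => `[< forall S : set 'rV[R]_N, nbhs (0 : 'rV[R]_N) S ->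
     exists G : set 'rV[R]_N, [/\ G !=set0, G `<=` V `&` S & analytic_submanifold d G] >]) (fun d => d : nat)).
  by exists S; split => // _ G G0 GS aG; apply: hS; exists G.
have [S hS] := choice hd.
pose W0 := U `&` [set x | forall d, S d x].
have nW0 : nbhs (0 : 'rV[R]_N) W0.
  apply: filterI => //.
  by apply: (@filter_forall _ _ (fun d x => S d x) (nbhs (0 : 'rV[R]_N)) _) => d; have [] := hS d.
exists (interior W0); split; first by apply: nbhs_interior.
move=> v uv sv.
have [|f [hf [z fz] fX]] := dependent_coordinates saX (@open_interior _ W0) _ uv sv.
  move=> d G /andP[nd dN] G0 GX aG.
  have dN' : (d < N.+1)%N by [].
  have [_ h] := hS (Ordinal dN'); apply: (h nd G G0) aG => x /GX[Xx /interior_subset[Ux Sx]].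
  by split; [apply: XUV; split|exact: Sx].
have [i0 _] : exists i : 'I_N, i \in v by case: v sv {uv fX} => // i v' _; exists i; exact: mem_head.
have [p [sp hp]] := polyf_mpoly (N := N) (B := mem v) (v := nth i0 v) hf (fun k kn => @mem_nth _ i0 v k (eq_ind_r (fun m => k < m)%N kn sv)).
exists p; split => //.
  apply: contraNneq fz => p0; rewrite (hp z (fun i => z (index i v))).
    by rewrite p0 mpoly.meval0.
  by move=> k kn; rewrite index_uniq // sv.
move=> x Xx Wx; rewrite /peval -(hp (hat v x)); first exact: fX.
by move=> k kn; rewrite (hat_nth _ i0) // sv.
Qed.

End DimensionRelations.

(** * Growth of the space of polynomials of bounded degree on a set with such relations *)

Section HilbertBound.
Context {R : realType} (N n : nat) (Z : set 'rV[R]_N).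
Local Notation M := (mpoly.multinom N).
Local Notation fom := mpoly.fun_of_multinom.

Definition evm (m : M) (x : 'rV[R]_N) : R := peval (mpoly.mpolyX R m) x.

Lemma evmD m m' x : evm (mpoly.mnm_add m m') x = evm m x * evm m' x.
Proof. by rewrite /evm /peval mpoly.mpolyXD mpoly.mevalM. Qed.

Lemma peval_evm (p : mpoly.mpoly N R) x :
  peval p x = \sum_(m <- mpoly.msupp p) mpoly.mcoeff m p * evm m x.
Proof.
rewrite /peval {1}[p]mpoly.mpolyE; elim: (mpoly.msupp p) => [|m s IH].
  by rewrite !big_nil mpoly.meval0.
by rewrite !big_cons mpoly.mevalD IH mpoly.mevalZ.
Qed.

(* Exponents below K are read in u.1, the others (at most n of them) in u.2. *)
Definition candidate K Q (u : {ffun 'I_N -> 'I_K.+1} * {ffun 'I_n -> 'I_Q.+1}) : M :=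
  mpoly.Multinom [tuple (if (u.1 i < K)%N then val (u.1 i) else
    nth 0%N [seq val (u.2 j) | j <- enum 'I_n] (index i (enum [pred l | u.1 l == K :> nat]))) | i < N].

Lemma candidateP K Q (m : M) : (mpoly.mdeg m <= Q)%N -> (#|[pred i | (K <= fom m i)%N]| <= n)%N ->
  exists u, @candidate K Q u = m.
Proof.
move=> mQ mn; pose t : {ffun 'I_N -> 'I_K.+1} := [ffun i => inord (minn (fom m i) K)].
have tE i : t i = minn (fom m i) K :> nat by rewrite ffunE inordK // ltnS geq_minr.
set S := [pred l | t l == K :> nat].
have SE : S =i [pred i | (K <= fom m i)%N].
  by move=> i; rewrite !inE tE; lia.
pose h : {ffun 'I_n -> 'I_Q.+1} := [ffun j : 'I_n => inord (nth 0%N [seq fom m i | i <- enum S] j)].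
exists (t, h); apply/mpoly.mnmP => i.
rewrite /candidate /mpoly.fun_of_multinom tnth_mktuple /= -/(fom m i).
have miQ l : (fom m l <= Q)%N.
  by apply: leq_trans mQ; rewrite mpoly.mdegE (bigD1 l) //= leq_addr.
rewrite -/S; case: ltnP => h1; first by move: h1; rewrite tE; lia.
have iS : i \in S by rewrite inE tE; move: h1; rewrite tE; lia.
have ix : (index i (enum S) < size (enum S))%N by rewrite index_mem mem_enum.
have ixn : (index i (enum S) < n)%N by apply: leq_trans ix _; rewrite -cardE (eq_card SE).
rewrite (nth_map (Ordinal ixn)) ?size_enum_ord // (nth_ord_enum _ (Ordinal ixn)) ffunE /=.
by rewrite (nth_map i) // nth_index ?mem_enum // inordK // ltnS.
Qed.

Context (rel : forall v : seq 'I_N, uniq v -> size v = n.+1 ->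
    exists p : mpoly.mpoly N R, [/\ p != 0, supported (mem v) p &
      forall x, Z x -> peval p x = 0]).

(** [K] bounds the exponents of the leading monomials of the relations. If n + 1 exponents of a
    monomial reach [K], the leading monomial of the relation between those variables divides it, and
    it is rewritten by smaller monomials, which have no larger degree. The monomials left over have
    at most n exponents from [K] on. *)
Lemma hilbert_bound : exists C, forall Q, exists (T : finType) (b : T -> M),
  #|{: T}| = (C * Q.+1 ^ n)%N /\
  forall p : mpoly.mpoly N R, (forall m, m \in mpoly.msupp p -> (mpoly.mdeg m <= Q)%N) -> exists c : T -> R,
    forall x, Z x -> peval p x = \sum_t c t * evm (b t) x.
Proof.
have h (v : n.+1.-tuple 'I_N) : exists p : mpoly.mpoly N R, uniq v -> [/\ p != 0, supported (mem v) p &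
      forall x, Z x -> peval p x = 0].
  have [uv|] := boolP (uniq v); last by exists 0.
  by have [p hp] := rel uv (size_tuple v); exists p.
have [P hP] := choice h.
pose K := (\sum_v mpoly.mdeg (mpoly.mlead (P v)))%N.
have hK v i : (fom (mpoly.mlead (P v)) i <= K)%N.
  apply: (@leq_trans (mpoly.mdeg (mpoly.mlead (P v)))).
    by rewrite mpoly.mdegE (bigD1 i) //= leq_addr.
  by rewrite /K (bigD1 v) //= leq_addr.
exists (K.+1 ^ N)%N => Q; exists ({ffun 'I_N -> 'I_K.+1} * {ffun 'I_n -> 'I_Q.+1})%type, (@candidate K Q).
split; first by rewrite card_prod !card_ffun !card_ord.
have mon (m : M) : (mpoly.mdeg m <= Q)%N -> exists c, forall x, Z x ->
    evm m x = \sum_u c u * evm (@candidate K Q u) x.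
  elim/(well_founded_ind (@mpoly.ltom_wf N)): m => m IH mQ.
  have [mn|mn] := leqP #|[pred i | (K <= fom m i)%N]| n.
    have [u hu] := candidateP mQ mn; exists (fun u' => (u' == u)%:R) => x _.
    rewrite (bigD1 u) //= eqxx mul1r hu big1 ?addr0 // => i /negbTE ->.
    by rewrite mul0r.
  pose v := take n.+1 (enum [pred i | (K <= fom m i)%N]).
  have sv : size v == n.+1 by rewrite size_takel // -cardE.
  have uv : uniq v by rewrite take_uniq // enum_uniq.
  have [p0 sp pZ] := hP (Tuple sv) uv.
  set p := P (Tuple sv) in p0 sp pZ *; set mu := mpoly.mlead p.
  have mup : mu \in mpoly.msupp p by exact: mpoly.mlead_supp.
  have mum : mpoly.lem mu m.
    apply/mpoly.mnm_lepP => i; have [iv|iv] := boolP (i \in v).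
      by move: (mem_take iv); rewrite mem_enum inE; apply: leq_trans; exact: hK.
    by rewrite (sp _ mup).
  pose r := mpoly.mnm_sub m mu.
  have rm : mpoly.mnm_add r mu = m by exact: mpoly.submK.
  have hc m' : exists c : _ -> R, m' \in mpoly.msupp p -> m' != mu -> forall x, Z x ->
      evm (mpoly.mnm_add r m') x = \sum_u c u * evm (@candidate K Q u) x.
    have [m'p|_] := boolP (m' \in mpoly.msupp p); last by exists (fun=> 0).
    have [->|m'mu] := eqVneq m' mu; first by exists (fun=> 0).
    have lt : (mpoly.mnm_add r m' < m)%O.
      rewrite -[X in (_ < X)%O]rm mpoly.ltmc_add2r lt_neqAle m'mu /=.
      exact: mpoly.msupp_le_mlead.
    have [|c hc] := IH _ lt; last by exists c.
    by apply: leq_trans mQ; apply: mpoly.lemc_mdeg; exact: ltW.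
  have [c hc'] := choice hc.
  exists (fun u => - (mpoly.mcoeff mu p)^-1 * \sum_(m' <- mpoly.msupp p | m' != mu) mpoly.mcoeff m' p * c m' u) => x Zx.
  have := pZ x Zx; rewrite peval_evm (bigD1_seq mu) //=.
  move=> /eqP; rewrite addrC addr_eq0 => /eqP e0.
  have lc : mpoly.mcoeff mu p != 0 by rewrite mpoly.mleadc_eq0.
  rewrite -rm evmD.
  have -> : evm mu x = - (mpoly.mcoeff mu p)^-1 * \sum_(m' <- mpoly.msupp p | m' != mu) mpoly.mcoeff m' p * evm m' x.
    by rewrite e0 mulrNN mulrA mulVf // mul1r.
  under eq_bigr do rewrite -mulrA; rewrite -big_distrr /= mulrCA; congr (_ * _).
  under [RHS]eq_bigr do rewrite mulr_suml; rewrite exchange_big /= mulr_sumr big_seq_cond [RHS]big_seq_cond.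
  apply: eq_bigr => m' /andP[m'p m'mu]; rewrite mulrCA -evmD hc' // mulr_sumr.
  by apply: eq_bigr => u _; rewrite mulrA.
move=> p pQ.
have hc m : exists c : _ -> R, m \in mpoly.msupp p -> forall x, Z x ->
    evm m x = \sum_u c u * evm (@candidate K Q u) x.
  have [mp|_] := boolP (m \in mpoly.msupp p); last by exists (fun=> 0).
  by have [|c hc] := mon m; [exact: pQ|exists c].
have [c hc'] := choice hc.
exists (fun u => \sum_(m <- mpoly.msupp p) mpoly.mcoeff m p * c m u) => x Zx.
under eq_bigr do rewrite mulr_suml; rewrite exchange_big /= peval_evm big_seq [RHS]big_seq.
apply: eq_bigr => m mp; rewrite hc' // mulr_sumr.
by apply: eq_bigr => u _; rewrite mulrA.
Qed.

End HilbertBound.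

(** * Taylor polynomials *)

Section Taylor.
Context {R : realType} (N : nat).
Local Notation A := ((nat -> R) -> R).
Local Notation multi := {ffun 'I_N -> nat}.

Definition deg (e : multi) := (\sum_i e i)%N.

Lemma deg_fin Q : exists M, forall e : multi, (deg e <= Q)%N -> (pickle e < M)%N.
Proof.
pose up (t : {ffun 'I_N -> 'I_Q.+1}) : multi := [ffun i => val (t i)].
exists (\max_t (pickle (up t))).+1 => e eQ; rewrite ltnS.
have -> : e = up [ffun i => inord (e i)].
  apply/ffunP => i; rewrite !ffunE /= inordK // ltnS; apply: leq_trans eQ.
  by rewrite /deg (bigD1 i) //= leq_addr.
exact: (@leq_bigmax _ (fun t => pickle (up t))).
Qed.

Lemma mono_deg (e : multi) (d rho : R) Q z : 0 < rho -> 0 <= d <= rho -> (Q <= deg e)%N ->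
  pd N (fun=> d) z -> `|mono e z| <= (d / rho) ^+ Q * mono e (fun=> rho).
Proof.
move=> p /andP[d0 dr] Qe hz.
have q01 : 0 <= d / rho <= 1 by rewrite divr_ge0 ?(ltW p) //= ler_pdivrMr // mul1r.
have m0 : 0 <= mono e (fun=> rho) by apply: prodr_ge0 => i _; rewrite exprn_ge0 // ltW.
apply: (@le_trans _ _ ((d / rho) ^+ deg e * mono e (fun=> rho))); last first.
  rewrite ler_wpM2r //; case/andP: q01 => q0 q1.
  exact: ler_wiXn2l.
rewrite /deg -prodrXr /mono -big_split normr_prod /=; apply: ler_prod => i _.
rewrite normr_ge0 normrX -exprMn divfK ?gt_eqF //.
by rewrite lerXn2r ?nnegrE // hz.
Qed.

(** On the polydisc of radius d the terms of degree above Q gain a factor (d / rho)^(Q + 1). *)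
Lemma taylor (f : A) Q : anal N f -> exists (p : mpoly.mpoly N R) K r,
  [/\ 0 < r, 0 <= K, forall m, m \in mpoly.msupp p -> (mpoly.mdeg m <= Q)%N &
    forall d z, 0 <= d <= r -> pd N (fun=> d) z ->
      `|f z - mpoly.meval (fun i => z (val i)) p| <= K * d ^+ Q.+1].
Proof.
move=> [rho [C0 [p0 hf]]].
pose e0 : multi := [ffun=> 0%N].
have m1 (z : nat -> R) : mono e0 z = 1 by rewrite /mono big1 // => i _; rewrite ffunE expr0.
have [c [hc fc]] := An_multi_expansion e0 p0 (leqnn N) hf.
rewrite m1 mulr1 in hc.
have [M hM] := deg_fin Q.
pose low k := if pickle_inv k is Some e then (deg (e : multi) <= Q)%N else false.
have lowM k : low k -> (k < M)%N.
  rewrite /low; have := @pickle_invK multi k; case: pickle_inv => [e /= <-|//].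
  exact: hM.
pose mn (e : multi) := mpoly.Multinom [tuple e i | i < N].
have mnE (e : multi) i : mpoly.fun_of_multinom (mn e) i = e i.
  by rewrite /mpoly.fun_of_multinom /mn tnth_mktuple.
pose tm k : mpoly.mpoly N R := if pickle_inv k is Some e then
  (if (deg (e : multi) <= Q)%N then c k *: mpoly.mpolyX R (mn e) else 0) else 0.
exists (\sum_(0 <= k < M) tm k), (C0 * (rho^-1) ^+ Q.+1), rho.
have C00 := An_ge0 hf; split => //.
- by rewrite mulr_ge0 // exprn_ge0 // invr_ge0 ltW.
- elim: M {hM lowM} => [|M IH] m; first by rewrite big_geq // mpoly.msupp0.
  rewrite big_nat_recr //= => /mpoly.msuppD_le; rewrite mem_cat => /orP[/IH//|].
  rewrite /tm; case: pickle_inv => [e|]; last by rewrite mpoly.msupp0.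
  case: ifP => h; last by rewrite mpoly.msupp0.
  move=> /mpoly.msuppZ_le; rewrite mpoly.msuppX mem_seq1 => /eqP ->.
  by rewrite mpoly.mdegE; under eq_bigr do rewrite mnE.
move=> d z /andP[d0 dr] hz.
have hz' : pd N (fun=> rho) z by move=> i /hz /le_trans; apply.
have tmE : mpoly.meval (fun i => z (val i)) (\sum_(0 <= k < M) tm k) =
    rs (fun k => if low k then c k * nmono N k z else 0).
  rewrite (@rs_fin _ _ M) => [|k]; last by rewrite leqNgt; case: ifP => // /lowM ->.
  elim: M {hM lowM} => [|M IH]; first by rewrite !big_geq // mpoly.meval0.
  rewrite !big_nat_recr //= mpoly.mevalD IH; congr (_ + _).
  rewrite /tm /low /nmono; case: pickle_inv => [e|]; last by rewrite mpoly.meval0.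
  case: ifP => h; last by rewrite mpoly.meval0.
  rewrite mpoly.mevalZ mpoly.mevalX; congr (_ * _).
  by apply: eq_bigr => i _; rewrite mnE.
rewrite -[f z]mulr1 -(m1 z) fc // tmE.
have hz2 : absb (fun k => c k * nmono N k z) C0.
  apply: (absb_le hc) => // k; rewrite normrM [leRHS]normrM ler_wpM2l //.
  by apply: le_trans (ler_norm _); exact: nmono_pd.
have hl : absb (fun k => if low k then c k * nmono N k z else 0) C0.
  by apply: (absb_le hz2) => // k; case: ifP => // _; rewrite normr0.
have hh : absb (fun k => if low k then 0 else c k * nmono N k z) (C0 * (rho^-1) ^+ Q.+1 * d ^+ Q.+1).
  apply: (absb_le (absbZ ((d / rho) ^+ Q.+1) hc)).
    move=> k; case: ifP => h; first by rewrite normr0.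
    rewrite [leRHS]normrM normrX ger0_norm ?divr_ge0 ?(ltW p0) // [leRHS]mulrC !normrM -mulrA ler_wpM2l //.
    move: h; rewrite /low /nmono; case: pickle_inv => [e /negbT|_]; last by rewrite normr0 mul0r.
    rewrite -ltnNge => h; rewrite [leRHS]mulrC [`|mono e (fun=> rho)|]ger0_norm; last first.
      by apply: prodr_ge0 => i _; rewrite exprn_ge0 // ltW.
    by apply: mono_deg => //; rewrite d0.
  rewrite ger0_norm ?exprn_ge0 ?divr_ge0 ?(ltW p0) // exprMn mulrC -!mulrA ler_wpM2l //.
  by rewrite mulrC.
have -> : (fun k => c k * nmono N k z) = fun k => (if low k then c k * nmono N k z else 0) +
    (if low k then 0 else c k * nmono N k z).
  by apply/funext => k; case: ifP; rewrite ?addr0 ?add0r.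
by rewrite (rsD hl hh) addrC addKr; exact: rs_le.
Qed.

End Taylor.

(** * Limit directions *)

Section PolynomialContinuity.
Context {R : realType}.
Local Notation A := ((nat -> R) -> R).

Lemma polyf_cont n (f : A) z e : polyf n f -> 0 < e -> exists2 del, 0 < del &
  forall z', (forall i, (i < n)%N -> `|z' i - z i| <= del) -> `|f z' - f z| <= e.
Proof.
move=> hf e0.
have an : anal n (fun y => f (fun i => z i + y i) - f z).
  apply: anal_sub; last exact: anal_cst.
  apply: (polyf_anal hf (l := fun i y => z i + y i)) => i ni.
  by apply: anal_add; [exact: anal_cst|exact: anal_proj].
have [|rho [p0 h]] := anal_small an _ e0.
  apply/eqP; rewrite subr_eq0; apply/eqP; congr f; apply/funext => i.
  by rewrite addr0.
exists rho => // z' hz'.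
have := An_bound h (x := fun i => z' i - z i) hz'.
by congr (`|f _ - _| <= _); apply/funext => i; rewrite addrC subrK.
Qed.

Lemma linear_dependence (J T : finType) (c : J -> T -> R) : (#|T| < #|J|)%N ->
  exists a : J -> R, (exists j, a j != 0) /\ forall t, \sum_j a j * c j t = 0.
Proof.
move=> TJ; pose C := \matrix_(i < #|J|, t < #|T|) c (enum_val i) (enum_val t).
have : kermx C != 0.
  rewrite kermx_eq0; apply/negP => /eqP h.
  by have := rank_leq_col C; rewrite h leqNgt TJ.
move=> /rowV0Pn[v /sub_kermxP vC v0].
exists (fun j => v 0 (enum_rank j)); split.
  have /rV0Pn[i vi] := v0; exists (enum_val i); by rewrite enum_valK.
move=> t; have /rowP/(_ (enum_rank t)) := vC; rewrite !mxE => h; rewrite -[RHS]h.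
rewrite [RHS](reindex (@enum_rank J)) /=; last by apply: onW_bij; exact: enum_rank_bij.
by apply: eq_bigr => j _; rewrite mxE !enum_rankK.
Qed.

End PolynomialContinuity.

(** * Counting forms on the limit directions *)

Section Counting.
Context {R : realType} (N m : nat) (X : set 'rV[R]_N) (F : 'rV[R]_N -> 'rV[R]_m).
Local Notation A := ((nat -> R) -> R).

Definition limit_direction (u : 'rV[R]_m) := u != 0 /\ forall e, 0 < e -> exists x,
  [/\ X x, forall i, `|x 0 i| < e, F x != 0 &
      forall i, `|F x 0 i / enorm (F x) - u 0 i| < e].

Definition form j (f : A) := polyf m f /\ forall t z, f (fun i => t * z i) = t ^+ j * f z.

(** Linear independence of the evaluations at the points [u l] on forms of degree j, expressed by a
    dual basis. *)
Definition dual_forms j h (u : 'I_h -> 'rV[R]_m) := exists p : 'I_h -> A,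
  (forall l, form j (p l)) /\ forall l l', p l (pt (u l')) = (l == l')%:R.

Context (n k : nat) (nk : (n <= k)%N) (W : set 'rV[R]_N) (W0 : nbhs (0 : 'rV[R]_N) W)
  (rel : forall v : seq 'I_N, uniq v -> size v = n.+1 ->
    exists p : mpoly.mpoly N R, [/\ p != 0, supported (mem v) p &
      forall x, X x -> W x -> peval p x = 0])
  (f : 'I_m -> A) (anf : forall i, anal N (f i)) (f0 : forall i, f i (fun=> 0) = 0)
  (e0 : R) (e0_gt0 : 0 < e0)
  (Ff : forall x, X x -> (forall i, `|x 0 i| < e0) -> forall i, F x 0 i = f i (pt x))
  (s : nat) (loj : forall x, X x -> (forall i, `|x 0 i| < e0) ->
    enorm x ^+ s.+1 <= \sum_i (F x 0 i) ^+ 2).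

Lemma germ_small del : 0 < del -> exists2 e, 0 < e & forall x, X x ->
  (forall i, `|x 0 i| < e) -> enorm (F x) <= del.
Proof.
move=> del0; pose del' := del / m.+1%:R.
have del'0 : 0 < del' by rewrite divr_gt0.
have hi (i : 'I_m) : exists r, 0 < r /\ An N (fun=> r) del' (f i) by exact: anal_small.
have [r hr] := choice hi.
pose r0 := \big[Num.min/e0]_i r i.
exists r0; first by rewrite /r0; elim/big_ind: _ => [//|u v u0 v0|i _]; [rewrite lt_min u0|have [] := hr i].
move=> x Xx hx; apply: (@le_trans _ _ (m%:R * del')).
  apply: enorm_le => [|i]; first exact: ltW.
  have r0e : r0 <= e0.
    rewrite /r0; elim: (index_enum _) => [|i' l IH]; first by rewrite big_nil.
    by rewrite big_cons ge_min IH orbT.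
  rewrite Ff //; last by move=> l; exact: lt_le_trans (hx l) r0e.
  have [_ h] := hr i; apply: (An_bound h) => l lN.
  rewrite -[l]/(val (Ordinal lN)) ptE; apply: le_trans (ltW (hx _)) _.
  by rewrite /r0 (bigD1 i) //= ge_min lexx.
rewrite /del' mulrCA ler_piMr ?(ltW del0) // ler_pdivrMr // mul1r ler_nat; exact: leqnSn.
Qed.

(** If all degrees from E to 2E - 1 had dual forms for e^k limit directions, the Taylor polynomials
    of their composites with F would be linearly dependent on X near 0. The same combination of the
    composites is then O(|x|^(Q + 1)), hence O(|F|^(2E)), negligible against its part of lowest
    degree E + i0 < 2E; along a limit direction that part isolates a nonzero coefficient. *)
Lemma few_independent_directions : exists e j, [/\ (0 < e)%N, (k.+1 * e <= j)%N &
  forall u : 'I_(e ^ k) -> 'rV[R]_m, (forall l, limit_direction (u l)) -> ~ dual_forms j u].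
Proof.
have relZ (v : seq 'I_N) : uniq v -> size v = n.+1 -> exists p : mpoly.mpoly N R,
    [/\ p != 0, supported (mem v) p & forall x, (X `&` W) x -> peval p x = 0].
  by move=> uv sv; have [p [h1 h2 h3]] := rel uv sv; exists p; split => // x [Xx Wx]; exact: h3.
have [C hC] := hilbert_bound relZ.
(* With this e, C ((s + 1) (k + 1) e)^n = (e - 1) e^n < e e^k as n <= k, so the E e^k forms
   outnumber the monomials of [hilbert_bound]. *)
pose e := (C * (s.+1 * k.+1) ^ n).+1.
pose E := (k.+1 * e)%N.
have E0 : (0 < E)%N by rewrite muln_gt0.
exists e; apply: contrapT => /forallNP nj.
have hj (i : 'I_E) : exists u : 'I_(e ^ k) -> 'rV[R]_m, exists p : 'I_(e ^ k) -> A,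
    [/\ forall l, limit_direction (u l), forall l, form (E + i) (p l) &
        forall l l', p l (pt (u l')) = (l == l')%:R].
  apply: contrapT => h; apply: (nj (E + i)%N); split => //; first exact: leq_addr.
  by move=> u hu [p [h1 h2]]; apply: h; exists u, p.
have [u hu] := choice hj; have [p hp] := choice hu.
(* Chosen so that |x|^(Q + 1) = (|x|^(s + 1))^E, which is at most |F|^(2E) by [loj]. *)
pose Q := (s.+1 * E).-1.
have QE : Q.+1 = (s.+1 * E)%N by rewrite prednK // muln_gt0.
pose J := ('I_E * 'I_(e ^ k))%type.
pose fl i : A := if insub i is Some i' then f i' else fun=> 0.
have anfl i : anal N (fl i).
  by rewrite /fl; case: insubP => [i' _ _|_]; [exact: anf|exact: anal_cst].
have hT (ij : J) : exists t : mpoly.mpoly N R * (R * R), [/\ 0 < t.2.2, 0 <= t.2.1,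
    forall mm, mm \in mpoly.msupp t.1 -> (mpoly.mdeg mm <= Q)%N &
    forall d z, 0 <= d <= t.2.2 -> pd N (fun=> d) z ->
      `|p ij.1 ij.2 (fun i => fl i z) - mpoly.meval (fun i => z (val i)) t.1| <= t.2.1 * d ^+ Q.+1].
  have [_ /(_ ij.2)[hpol _] _] := hp ij.1.
  have an : anal N (fun z => p ij.1 ij.2 (fun i => fl i z)) by apply: (polyf_anal hpol) => i _.
  by have [t [K [r h]]] := taylor Q an; exists (t, (K, r)).
have [t ht] := choice hT.
have [T [b [cardT hb]]] := hC Q.
have hc (ij : J) : exists c : T -> R, forall x, (X `&` W) x ->
    peval (t ij).1 x = \sum_t c t * evm (b t) x.
  by apply: hb; have [] := ht ij.
have [c hc'] := choice hc.
have [|a [[ij0 aij0] ac]] := @linear_dependence R J T c.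
  rewrite cardT card_prod !card_ord QE /E mulnA expnMn mulnA.
  apply: (@leq_ltn_trans (C * (s.+1 * k.+1) ^ n * e ^ k)%N).
    by rewrite leq_mul2l leq_pexp2l // orbT.
  rewrite ltn_pmul2r ?expn_gt0 //.
  by apply: (@leq_trans e) => //; rewrite leq_pmull.
have exi : exists i : 'I_E, [exists l, a (i, l) != 0].
  by exists ij0.1; apply/existsP; exists ij0.2; rewrite -surjective_pairing.
have [i1 hi1] := exi.
have [i0 /existsP[l0 a0] mini] := @arg_minnP _ i1 (fun i => [exists l, a (i, l) != 0]) val hi1.
have az (i : 'I_E) l : (i < i0)%N -> a (i, l) = 0.
  move=> ii0; apply: contrapT => /eqP h; have := mini i; rewrite leqNgt ii0 => H.
  by apply: notF; apply: H; apply/existsP; exists l.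
have [hD hform hdual] := hp i0.
(* The combination divided by |F|^(E + i0): the extra coordinate [w m] stands for |F|, the others
   for F / |F|. This polynomial is continuous at w m = 0, where only the degree E + i0 survives and
   the dual basis selects [a (i0, l0)]. *)
pose Psi : A := fun w => \sum_(ij : J) (if (i0 <= ij.1)%N then a ij * w m ^+ (ij.1 - i0) else 0) * p ij.1 ij.2 w.
have pPsi : polyf m.+1 Psi.
  apply: (@polyf_sum R m.+1 J (index_enum J) (fun (ij : J) w => (if (i0 <= ij.1)%N then a ij * w m ^+ (ij.1 - i0) else 0) * p ij.1 ij.2 w)) => ij.
  apply: polyf_mul; last by apply: (polyf_le (leqnSn m)); have [_ /(_ ij.2)[]] := hp ij.1.
  case: leqP => _; last exact: polyf_cst.
  by apply: polyf_mul; [exact: polyf_cst|apply: polyf_exp; exact: polyf_coord].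
pose w0 := setc m (pt (u i0 l0)) 0.
have Psi0 : Psi w0 = a (i0, l0).
  have pw (i : 'I_E) l : p i l w0 = p i l (pt (u i0 l0)).
    have [_ /(_ l)[hpol _] _] := hp i; apply: (polyf_dep hpol) => i' im.
    by rewrite /w0 /setc ltn_eqF.
  rewrite /Psi (bigD1 (i0, l0)) //= leqnn subnn expr0 mulr1 pw hdual eqxx mulr1.
  rewrite big1 ?addr0 // => -[i l] /= ne; rewrite pw.
  case: ltngtP => ii; last 1 first.
  - have -> : i = i0 by apply/val_inj.
    rewrite subnn expr0 mulr1 hdual; case: eqP => [ll|]; last by rewrite mulr0.
    by move: ne; rewrite -ll (_ : i = i0) ?eqxx //; apply/val_inj.
  - by rewrite {1}/w0 /setc eqxx expr0n gtn_eqF ?subn_gt0 // mulr0 mul0r.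
  - by rewrite mul0r.
pose Kt := \sum_(ij : J) `|a ij| * (t ij).2.1.
have Kt0 : 0 <= Kt.
  by apply: sumr_ge0 => ij _; rewrite mulr_ge0 //; have [] := ht ij.
have [u0 hu0] := hD l0.
(* The estimates end in |a (i0, l0)| <= (1 + Kt) eps, which this choice makes absurd. *)
pose eps := `|a (i0, l0)| / (Kt + 2).
have eps0 : 0 < eps by rewrite divr_gt0 ?normr_gt0 //; lra.
have [del del0 hdel] := polyf_cont w0 pPsi eps0.
pose tau0 := Num.min 1 (Num.min del eps).
have tau00 : 0 < tau0 by rewrite !lt_min ltr01 del0.
have [e1 e10 he1] := germ_small tau00.
have [e2 e20 he2] := (nbhs0_rowP W).1 W0.
pose rr := \big[Num.min/1]_(ij : J) (t ij).2.2.
have rr0 : 0 < rr.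
  by rewrite /rr; elim/big_ind: _ => [//|x y x0 y0|ij _]; [rewrite lt_min x0|have [] := ht ij].
have rrij ij : rr <= (t ij).2.2 by rewrite /rr (bigD1 ij) //= ge_min lexx.
pose e3 := rr / N.+1%:R.
have e30 : 0 < e3 by rewrite divr_gt0.
pose e4 := Num.min del (Num.min e0 (Num.min e1 (Num.min e2 e3))).
have e40 : 0 < e4 by rewrite !lt_min del0 e0_gt0 e10 e20.
have [x [Xx hx Fx0 hv]] := hu0 _ e40.
have hx' i : [/\ `|x 0 i| < e0, `|x 0 i| < e1, `|x 0 i| < e2 & `|x 0 i| < e3].
  by have := hx i; rewrite !lt_min => /and5P[_ -> -> -> ->].
pose tau := enorm (F x).
have tau_gt0 : 0 < tau by rewrite lt_neqAle enorm_ge0 eq_sym enorm_eq0 Fx0.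
have taule : tau <= tau0 by apply: he1 => // i; have [] := hx' i.
have := taule; rewrite !le_min => /and3P[tau1 taud taue].
have enx : enorm x <= rr.
  apply: (@le_trans _ _ (N%:R * e3)).
    by apply: enorm_le => [|i]; [exact: ltW|have [_ _ _ /ltW] := hx' i].
  rewrite /e3 mulrCA ler_piMr ?(ltW rr0) // ler_pdivrMr // mul1r ler_nat; exact: leqnSn.
pose w := setc m (fun i => tau^-1 * pt (F x) i) tau.
have close : `|Psi w - Psi w0| <= eps.
  apply: hdel => i; rewrite ltnS leq_eqVlt /w /w0 /setc => /orP[/eqP ->|im].
    by rewrite eqxx subr0 gtr0_norm.
  rewrite ltn_eqF // -[i]/(val (Ordinal im)) !ptE mulrC ltW //.
  by have := hv (Ordinal im); rewrite lt_min => /andP[].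
have Zx : (X `&` W) x by split => //; apply: he2 => i; have [] := hx' i.
have ptFx i : (i < m)%N -> pt (F x) i = fl i (pt x).
  move=> im; rewrite -[i]/(val (Ordinal im)) ptE /fl valK Ff // => l.
  by have [] := hx' l.
have pF (ij : J) : p ij.1 ij.2 (fun i => fl i (pt x)) = tau ^+ (E + ij.1) * p ij.1 ij.2 w.
  have [_ /(_ ij.2)[hpol hhom] _] := hp ij.1.
  rewrite -hhom; apply: (polyf_dep hpol) => i im.
  by rewrite /w /setc ltn_eqF // -ptFx // mulrA divff ?mul1r // gt_eqF.
have key : tau ^+ (E + i0) * Psi w = \sum_ij a ij * (p ij.1 ij.2 (fun i => fl i (pt x)) - peval (t ij).1 x).
  under [RHS]eq_bigr do rewrite mulrBr; rewrite big_split /= sumrN.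
  have -> : \sum_ij a ij * peval (t ij).1 x = 0.
    under eq_bigr => ij _ do rewrite hc' // mulr_sumr.
    rewrite exchange_big big1 // => t' _; under eq_bigr do rewrite mulrA.
    by rewrite -mulr_suml ac mul0r.
  rewrite subr0 mulr_sumr; apply: eq_bigr => -[i l] _; rewrite pF /=.
  case: leqP => ii; last by rewrite az // !mul0r mulr0.
  have -> : w m = tau by rewrite /w /setc eqxx.
  by rewrite !mulrA; congr (_ * _); rewrite mulrAC -exprD -addnA subnKC // mulrC.
have bnd : `|tau ^+ (E + i0) * Psi w| <= Kt * tau ^+ (2 * E).
  rewrite key; apply: le_trans (ler_norm_sum _ _ _) _.
  rewrite /Kt mulr_suml; apply: ler_sum => ij _; rewrite normrM -mulrA ler_wpM2l //.
  have [r0 K0 _ hh] := ht ij.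
  have := hh (enorm x) (pt x); rewrite enorm_ge0 (le_trans enx (rrij ij)) => /(_ isT) H.
  apply: (le_trans (y := (t ij).2.1 * enorm x ^+ Q.+1)).
    have <- : mpoly.meval (fun i => pt x (val i)) (t ij).1 = peval (t ij).1 x.
      by rewrite /peval; apply: mpoly.meval_eq => i; rewrite ptE.
    apply: H => i iN; rewrite -[i]/(val (Ordinal iN)) ptE; exact: enorm_coord.
  rewrite ler_wpM2l // QE (exprM _ s.+1 E) (exprM _ 2 E) lerXn2r ?nnegrE ?exprn_ge0 ?enorm_ge0 ?(ltW tau_gt0) //.
    apply: le_trans (loj Xx _) _; first by move=> i; have [] := hx' i.
  by rewrite /tau /enorm sqr_sqrtr // sumr_ge0 // => i _; exact: sqr_ge0.
have tE : 0 < tau ^+ (E + i0) by rewrite exprn_gt0.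
have i0E : (i0 < E)%N by [].
have bnd2 : `|Psi w| <= Kt * tau.
  move: bnd; rewrite normrM gtr0_norm // mul2n -addnn.
  rewrite (_ : (E + E = E + i0 + (E - i0))%N); last by rewrite -addnA subnKC // ltnW.
  rewrite [X in Kt * X]exprD mulrCA ler_pM2l // => h; apply: le_trans h _.
  rewrite ler_wpM2l // -[leRHS]expr1 ler_wiXn2l ?subn_gt0 //; exact: ltW.
have : `|a (i0, l0)| <= eps + Kt * eps.
  rewrite -Psi0 -[Psi w0](subrK (Psi w)); apply: le_trans (ler_normD _ _) _.
  rewrite lerD // 1?distrC //; apply: le_trans bnd2 _; exact: ler_wpM2l.
have : `|a (i0, l0)| = eps * (Kt + 2) by rewrite /eps divfK // gt_eqF //; lra.
by move=> ->; rewrite -subr_ge0; have := eps0; move: (eps) (Kt) => y z y0; lra.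
Qed.

End Counting.

(** * Polynomials avoiding the limit directions *)

Section KernelVector.
Context {R : realType} (n : nat).
Local Notation A := ((nat -> R) -> R).

(** Elimination without division: a nonzero entry of the first column serves as pivot, the 2 by 2
    minors clear that column, and the kernel vector of the smaller matrix is lifted by multiplying
    with the pivot, so that entries stay polynomial. *)
Lemma kernel_vector h (M : 'I_h.+1 -> 'I_h -> A) : (forall r l, polyf n (M r l)) ->
  exists a : 'I_h.+1 -> A, [/\ forall r, polyf n (a r), exists r z, a r z != 0 &
    forall l z, \sum_r a r z * M r l z = 0].
Proof.
elim: h M => [|h IH] M hM.
  exists (fun _ _ => 1); split; [by move=> r; exact: polyf_cst| |by case].
  by exists ord0, (fun=> 0); exact: oner_neq0.
have [[r0 [z0 M0]]|noM] := pselect (exists r z, M r ord0 z != 0).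
  pose M' r l : A := fun z => M r0 ord0 z * M (lift r0 r) (lift ord0 l) z -
    M (lift r0 r) ord0 z * M r0 (lift ord0 l) z.
  have [|a [ha [r1 [z1 a1]] az]] := IH M'.
    by move=> r l; apply: polyf_add; [exact: polyf_mul|apply/polyf_opp/polyf_mul].
  exists (fun r z => if unlift r0 r is Some r' then M r0 ord0 z * a r' z
                     else - \sum_r' a r' z * M (lift r0 r') ord0 z); split.
  - move=> r; case: unliftP => [r' _|_]; first exact: polyf_mul.
    apply: polyf_opp; apply: (@polyf_sum R n _ (index_enum _) (fun r' z => a r' z * M (lift r0 r') ord0 z)) => r'.
    exact: polyf_mul.
  - have [z [h1 h2]] := polyf_nonzero2 (hM r0 ord0) (ha r1) M0 a1.
    by exists (lift r0 r1), z; rewrite liftK mulf_neq0.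
  move=> l z; rewrite (bigD1_ord r0) //= unlift_none.
  under [X in _ + X]eq_bigr do rewrite liftK.
  rewrite mulNr; apply/eqP; rewrite addrC subr_eq0; apply/eqP.
  case: (unliftP ord0 l) => [l' ->|->]; last first.
    by rewrite mulr_suml; apply: eq_bigr => r _; ring.
  apply/eqP; rewrite -subr_eq0 mulr_suml -sumrB -[X in _ == X](az l' z); apply/eqP.
  by apply: eq_bigr => r _; rewrite /M'; ring.
have [a [ha [r1 [z1 a1]] az]] := IH (fun r l => M (lift ord0 r) (lift ord0 l)) (fun r l => hM _ _).
exists (fun r z => if unlift ord0 r is Some r' then a r' z else 0); split.
- by move=> r; case: unliftP => [r' _|_]; [exact: ha|exact: polyf_cst].
- by exists (lift ord0 r1), z1; rewrite liftK.
move=> l z; rewrite (bigD1_ord ord0) //= unlift_none mul0r add0r.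
under eq_bigr do rewrite liftK.
case: (unliftP ord0 l) => [l' ->|->]; first exact: az.
apply: big1 => r _; have -> : M (lift ord0 r) ord0 z = 0; last by rewrite mulr0.
by apply: contrapT => /eqP h0; apply: noM; exists (lift ord0 r), z.
Qed.

Lemma monomials_independent k e (b : {ffun 'I_k -> 'I_e} -> R) :
  (forall y : 'I_k -> R, \sum_g b g * \prod_c y c ^+ g c = 0) -> forall g, b g = 0.
Proof.
move=> hb g0.
(* Coefficients are compared in one variable at a time: after j steps only the multi-indices that
   agree with [g0] in the first j places remain. *)
have H j : (j <= k)%N -> forall y : 'I_k -> R,
    \sum_(g : {ffun 'I_k -> 'I_e} | [forall c : 'I_k, (c < j)%N ==> (g c == g0 c)]) b g * \prod_(c : 'I_k | (j <= c)%N) y c ^+ g c = 0.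
  elim: j => [_ y|j IH jk y].
    rewrite -[RHS](hb y); apply: eq_bigl => g; apply/forallP => c.
    by rewrite ltn0.
  pose cj := Ordinal jk.
  pose C s := \sum_(g : {ffun 'I_k -> 'I_e} | [forall c : 'I_k, (c < j)%N ==> (g c == g0 c)] && (g cj == s :> nat))
     b g * \prod_(c : 'I_k | (j < c)%N) y c ^+ g c.
  have hC t : (\poly_(s < e) C s).[t] = 0.
    rewrite horner_poly -[RHS](IH (ltnW jk) (fun c => if c == cj then t else y c)).
    rewrite (partition_big (fun g : {ffun 'I_k -> 'I_e} => g cj) xpredT) //=.
    apply: eq_bigr => s _; rewrite /C mulr_suml; apply: eq_bigr => g /andP[_ /eqP gs].
    rewrite [in RHS](bigD1 cj) //= eqxx gs mulrA mulrAC; congr (_ * _ * _).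
    apply: eq_big => c; first by rewrite ltn_neqAle andbC eq_sym.
    by move=> jc; rewrite ifN //; apply: contraTneq jc => ->; rewrite ltnn.
  have P0 : \poly_(s < e) C s = 0.
    apply: contrapT => /eqP h; have [t [_]] := poly_nonroot h ltr01.
    by rewrite hC eqxx.
  have := congr1 (fun p : {poly R} => p`_(g0 cj)) P0.
  rewrite coef_poly ltn_ord coef0 => h0; rewrite -[RHS]h0; apply: eq_bigl => g.
  apply/forallP/andP => [h|[/forallP h1 /eqP h2] c].
    split; last by have := h cj; rewrite /= ltnSn /= => /eqP ->.
    by apply/forallP => c; apply/implyP => cj'; have := h c; rewrite ltnS (ltnW cj').
  rewrite ltnS leq_eqVlt; apply/implyP => /orP[/eqP cj'|cj']; last by have := h1 c; rewrite cj'.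
  have -> : c = cj by apply/val_inj.
  by apply/eqP/val_inj.
have := H k (leqnn k) (fun=> 0); rewrite (big_pred1 g0).
  rewrite big_pred0 ?mulr1 // => c; by rewrite leqNgt ltn_ord.
move=> g; apply/forallP/eqP => [h|-> c]; last by rewrite eqxx implybT.
by apply/ffunP => c; have := h c; rewrite ltn_ord => /eqP.
Qed.

End KernelVector.

Section SpanningDirections.
Context {R : realType} (m : nat) (D : set 'rV[R]_m).
Local Notation A := ((nat -> R) -> R).

Lemma formD j (f g : A) c : form m j f -> form m j g -> form m j (fun z => f z + c * g z).
Proof.
move=> [f1 f2] [g1 g2]; split.
  by apply: polyf_add => //; apply: polyf_mul => //; exact: polyf_cst.
by move=> t z; rewrite f2 g2 mulrDr mulrCA.
Qed.

Lemma formZ j (f : A) c : form m j f -> form m j (fun z => c * f z).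
Proof.
move=> [f1 f2]; split; first by apply: polyf_mul => //; exact: polyf_cst.
by move=> t z; rewrite f2 mulrCA.
Qed.

Lemma spanning_directions j M :
  (forall u : 'I_M -> 'rV[R]_m, (forall l, D (u l)) -> ~ dual_forms j u) ->
  exists h (u : 'I_h -> 'rV[R]_m), [/\ (h < M)%N, forall l, D (u l) &
    forall f, form m j f -> (forall l, f (pt (u l)) = 0) -> forall v, D v -> f (pt v) = 0].
Proof.
move=> hM.
pose P h := exists u : 'I_h -> 'rV[R]_m, (forall l, D (u l)) /\ dual_forms j u.
have [h [hltM Ph Ph1]] : exists h, [/\ (h < M)%N, P h & ~ P h.+1].
  have nPM : ~ P M by move=> [u [h1 h2]]; exact: (hM u h1 h2).
  elim: M nPM {hM} => [|M IH] nPM.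
    exfalso; apply: nPM; exists (fun=> 0); split; first by case.
    by exists (fun _ _ => 0); split; case.
  have [h|/IH[h [h1 h2 h3]]] := pselect (P M); first by exists M.
  by exists h; split => //; exact: ltnW.
have [u [Du [p [hp dp]]]] := Ph.
exists h, u; split => // f hf fu v Dv; apply: contrapT => /eqP fv; apply: Ph1.
exists (fun i => if unlift ord0 i is Some l then u l else v); split.
  by move=> l; case: unliftP => [l' _|_].
exists (fun i => if unlift ord0 i is Some l then (fun z => p l z + (- (p l (pt v) / f (pt v))) * f z)
   else (fun z => (f (pt v))^-1 * f z)); split.
  by move=> l; case: unliftP => [l' _|_]; [exact: formD|exact: formZ].
move=> l l'; case: (unliftP ord0 l) => [i ->|->]; case: (unliftP ord0 l') => [i' ->|->].
- by rewrite fu mulr0 addr0 dp (inj_eq lift_inj).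
- by rewrite mulNr divfK // subrr [_ == _]eq_sym (negbTE (neq_lift _ _)).
- by rewrite fu mulr0 (negbTE (neq_lift _ _)).
- by rewrite mulVf // eqxx.
Qed.

End SpanningDirections.

Section ChartPolynomial.
Context {R : realType} (m k : nat) (D : set 'rV[R]_m).
Local Notation A := ((nat -> R) -> R).

Definition entry (i : 'I_m) (c : 'I_k) : nat := val (mxvec_index i c).

Lemma entry_lt i c : (entry i c < m * k)%N.
Proof. exact: ltn_ord. Qed.

Lemma pt_entry (L : 'M[R]_(m, k)) i c : pt (mxvec L) (entry i c) = L i c.
Proof. by rewrite /entry ptE mxvecE. Qed.

Lemma entry_inj i c i' c' : entry i c = entry i' c' -> i = i' /\ c = c'.
Proof.
move=> /val_inj h; pose L : 'M[R]_(m, k) := delta_mx i c.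
have := mxvecE L i' c'; rewrite -h mxvecE !mxE !eqxx /=.
by case: (i' =P i) => [->|_]; case: (c' =P c) => [->|_] //= /eqP; rewrite oner_eq0.
Qed.

Lemma entry_surj a : (a < m * k)%N -> exists i c, a = entry i c.
Proof.
move=> h; rewrite -[a]/(val (Ordinal h)).
by case/mxvec_indexP: (Ordinal h) => i c; exists i, c.
Qed.

Context (e j h : nat) (ej : (k.+1 * e <= j)%N) (he : (h < e ^ k)%N) (u : 'I_h -> 'rV[R]_m)
  (span : forall f, form m j f -> (forall l, f (pt (u l)) = 0) -> forall v, D v -> f (pt v) = 0).

(** By v L = 0, the e^k monomials in row i0 with exponents below e become forms of degree j in v
    with coefficients in the other rows. Vanishing of a combination at the h < e^k points [u l] is a
    homogeneous system with more unknowns than equations, solved polynomially by [kernel_vector]; by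
    [span] it then vanishes on [D]. *)
Lemma chart_polynomial (i0 : 'I_m) : exists q : A, [/\ polyf (m * k) q, exists z, q z != 0 &
  forall (L : 'M[R]_(m, k)) v, D v -> v 0 i0 != 0 -> v *m L = 0 -> q (pt (mxvec L)) = 0].
Proof.
pose size_of (g : {ffun 'I_k -> 'I_e}) := (\sum_c g c)%N.
have size_le g : (size_of g <= j)%N.
  apply: leq_trans ej; rewrite mulSn; apply: leq_trans (leq_addl _ _).
  rewrite -[X in (_ <= X * _)%N]card_ord -sum_nat_const; apply: leq_sum => c _.
  exact: ltnW.
(* The monomial g in row i0, where v_i0 L_(i0,c) is replaced by minus the sum of the other v_i
   L_(i,c), filled up to degree j by powers of y_i0; this uses that the exponents of g add up to at
   most j. *)
pose G (z : nat -> R) (g : {ffun 'I_k -> 'I_e}) (y : nat -> R) : R :=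
  y i0 ^+ (j - size_of g) * \prod_c (- \sum_(i | i != i0) y (val i) * z (entry i c)) ^+ g c.
have row_lt (r : 'I_h.+1) : (r < #|{: {ffun 'I_k -> 'I_e}}|)%N.
  by rewrite card_ffun !card_ord; exact: leq_trans (ltn_ord r) he.
pose row (r : 'I_h.+1) : {ffun 'I_k -> 'I_e} := enum_val (Ordinal (row_lt r)).
have row_inj : injective row by move=> r r' /enum_val_inj[] /val_inj.
have [|a [ha [r1 [z1 a1]] az]] := @kernel_vector R (m * k) h (fun r l z => G z (row r) (pt (u l))).
  move=> r l; apply: polyf_mul; first exact: polyf_cst.
  apply: (@polyf_prod R _ _ (index_enum _) (fun c z => (- \sum_(i | i != i0) pt (u l) (val i) * z (entry i c)) ^+ row r c)) => c.
  apply: polyf_exp; apply: polyf_opp.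
  rewrite (_ : (fun _ => _) = fun z => \sum_i (if i != i0 then pt (u l) (val i) else 0) * z (entry i c)).
    apply: (@polyf_sum R _ _ (index_enum _) (fun i z => (if i != i0 then pt (u l) (val i) else 0) * z (entry i c))) => i.
    by apply: polyf_mul; [exact: polyf_cst|apply: polyf_coord; exact: entry_lt].
  apply/funext => z; rewrite big_mkcond; apply: eq_bigr => i _.
  by case: ifP => _; rewrite ?mul0r.
pose inrow (n : nat) := [exists c, n == entry i0 c].
(* Row i0 is frozen at its values in [z1]: the coefficients no longer depend on that row, and one of
   them is still nonzero at [z1], so [q] is nonzero as a polynomial in the row. *)
pose fz (z : nat -> R) : nat -> R := fun n => if inrow n then z1 n else z n.
have fzE z i c : i != i0 -> fz z (entry i c) = z (entry i c).
  move=> ne; rewrite /fz; case hn : (inrow _) => //; case/existsP: hn => c' /eqP/entry_inj[h1 _].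
  by rewrite h1 eqxx in ne.
have Gfz z g y : G (fz z) g y = G z g y.
  rewrite /G; congr (_ * _); apply: eq_bigr => c _; congr ((- _) ^+ _).
  by apply: eq_bigr => i ne; rewrite fzE.
pose q : A := fun z => \sum_r a r (fz z) * \prod_c z (entry i0 c) ^+ row r c.
exists q; split.
- apply: (@polyf_sum R _ _ (index_enum _) (fun r z => a r (fz z) * \prod_c z (entry i0 c) ^+ row r c)) => r.
  apply: polyf_mul.
    apply: (polyf_subst (l := fun n z => fz z n) (ha r)) => n nmk; rewrite /fz.
    by case: (inrow n); [exact: polyf_cst|exact: polyf_coord].
  apply: (@polyf_prod R _ _ (index_enum _) (fun c z => z (entry i0 c) ^+ row r c)) => c.
  by apply: polyf_exp; apply: polyf_coord; exact: entry_lt.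
- apply: contrapT => /forallNP q0.
  have : a r1 z1 = 0; last by move/eqP; apply/negP.
  pose b g := \sum_(r | row r == g) a r z1.
  have <- : b (row r1) = a r1 z1.
    by rewrite /b (big_pred1 r1) // => r; rewrite (inj_eq row_inj).
  apply: monomials_independent => y.
  pose z : nat -> R := fun n => if [pick c | n == entry i0 c] is Some c then y c else z1 n.
  have zE c : z (entry i0 c) = y c.
    rewrite /z; case: pickP => [c' /eqP/entry_inj[_ ->]//|/(_ c)].
    by rewrite eqxx.
  have fz1 : fz z = z1.
    apply/funext => n; rewrite /fz; case hn : (inrow n) => //; rewrite /z; case: pickP => // c hc.
      by move/existsP: hn; case; exists c.
  have /negP/negPn/eqP qz := q0 z; rewrite -[RHS]qz.
  rewrite /q fz1 /b (partition_big row xpredT) //=; apply: eq_bigr => g _.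
  rewrite mulr_suml; apply: eq_bigr => r /eqP <-.
  by congr (_ * _); apply: eq_bigr => c _; rewrite zE.
move=> L v Dv v0 vL; set z := pt (mxvec L).
(* q z homogenised in degree j, row i0 being solved from v *m L = 0 *)
pose f : A := fun y => \sum_r a r (fz z) * G z (row r) y.
have hf : form m j f.
  split.
    apply: (@polyf_sum R _ _ (index_enum _) (fun r y => a r (fz z) * G z (row r) y)) => r.
    apply: polyf_mul; first exact: polyf_cst.
    apply: polyf_mul; first by apply: polyf_exp; apply: polyf_coord; exact: ltn_ord.
    apply: (@polyf_prod R _ _ (index_enum _) (fun c y => (- \sum_(i | i != i0) y (val i) * z (entry i c)) ^+ row r c)) => c.
    apply: polyf_exp; apply: polyf_opp.
    rewrite (_ : (fun _ => _) = fun y => \sum_i y (val i) * (if i != i0 then z (entry i c) else 0)).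
      apply: (@polyf_sum R _ _ (index_enum _) (fun i y => y (val i) * (if i != i0 then z (entry i c) else 0))) => i.
      by apply: polyf_mul; [apply: polyf_coord; exact: ltn_ord|exact: polyf_cst].
    apply/funext => y; rewrite big_mkcond; apply: eq_bigr => i _.
    by case: ifP => _; rewrite ?mulr0.
  move=> t y; rewrite /f mulr_sumr; apply: eq_bigr => r _; rewrite [RHS]mulrCA; congr (_ * _).
  rewrite /G exprMn -[X in _ = t ^+ X * _](subnK (size_le (row r))) exprD -!mulrA; congr (_ * _).
  rewrite [RHS]mulrCA; congr (_ * _); rewrite -prodrXr -big_split /=; apply: eq_bigr => c _.
  rewrite -exprMn mulrN mulr_sumr; congr ((- _) ^+ _); apply: eq_bigr => i _.
  by rewrite mulrA.
have : f (pt v) = 0.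
  apply: span => // l; rewrite /f -[RHS](az l (fz z)); apply: eq_bigr => r _.
  by rewrite Gfz.
suff -> : f (pt v) = v 0 i0 ^+ j * q z.
  by move=> /eqP; rewrite mulf_eq0 expf_eq0 (negbTE v0) andbF => /eqP.
rewrite /f /q mulr_sumr; apply: eq_bigr => r _; rewrite [RHS]mulrCA; congr (_ * _).
rewrite /G -{2}(subnK (size_le (row r))) exprD ptE -mulrA; congr (_ * _).
rewrite -prodrXr -big_split /=; apply: eq_bigr => c _; rewrite -exprMn; congr (_ ^+ _).
have /rowP/(_ c) := vL; rewrite !mxE (bigD1 i0) //= => /eqP; rewrite addr_eq0 => /eqP h0.
rewrite /z pt_entry h0; congr (- _); apply: eq_bigr => i _.
by rewrite ptE pt_entry.
Qed.

Lemma avoiding_polynomial : exists q : A, [/\ polyf (m * k) q, exists z, q z != 0 &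
  forall (L : 'M[R]_(m, k)) v, D v -> v != 0 -> v *m L = 0 -> q (pt (mxvec L)) = 0].
Proof.
have [q hq] := choice chart_polynomial.
have H (s : seq 'I_m) : exists q' : A, [/\ polyf (m * k) q', exists z, q' z != 0 &
    forall i z, i \in s -> q i z = 0 -> q' z = 0].
  elim: s => [|i s [q' [h1 [z z0] h3]]].
    exists (fun=> 1); split => //; first exact: polyf_cst.
    by exists (fun=> 0); exact: oner_neq0.
  have [g1 [z' g2] _] := hq i.
  exists (fun z => q i z * q' z); split; first exact: polyf_mul.
    have [z'' [a b]] := polyf_nonzero2 g1 h1 g2 z0.
    by exists z''; rewrite mulf_neq0.
  move=> i' w; rewrite inE => /orP[/eqP ->|is'] hw; first by rewrite hw mul0r.
  by rewrite (h3 i' w is' hw) mulr0.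
have [q' [h1 h2 h3]] := H (index_enum 'I_m).
exists q'; split => // L v Dv /rV0Pn[i vi] vL.
by apply: (h3 i); [exact: mem_index_enum|have [_ _ h4] := hq i; exact: h4 vL].
Qed.

End ChartPolynomial.

(** * Comparison of exponents and genericity *)

Section Exponents.
Context {R : realType} (N : nat) (X : set 'rV[R]_N).

Lemma isolated_zeroP p (H : 'rV[R]_N -> 'rV[R]_p) : isolated_zero X H <->
  [/\ X 0, H 0 = 0 & exists2 e, 0 < e & forall x, X x -> (forall i, `|x 0 i| < e) -> H x = 0 -> x = 0].
Proof.
split=> [[/set_mem[X0 H0] [V /nbhs0_rowP[e e0 he] hV]]|[X0 H0 [e e0 he]]].
  split => //; exists e => // x Xx hx Hx.
  have : (V `&` zeros_on X H) x by split; [exact: he|].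
  by rewrite hV.
split; first by apply/mem_set; split.
exists [set x : 'rV[R]_N | forall i, `|x 0 i| < e]; first by apply/nbhs0_rowP; exists e.
apply/seteqP; split => [x [hx [Xx Hx]]|_ ->]; first exact: he.
by split; [move=> i; rewrite mxE normr0|split].
Qed.

(** Any other zero has a coordinate of size at least e, hence is further than e / 2 from x, while 0
    is nearer than that. *)
Lemma edist_isolated p (H : 'rV[R]_N -> 'rV[R]_p) e x : X 0 -> H 0 = 0 -> 0 < e ->
  (forall x, X x -> (forall i, `|x 0 i| < e) -> H x = 0 -> x = 0) ->
  enorm x < e / 2 -> edist_set x (zeros_on X H) = enorm x.
Proof.
move=> X0 H0 e0 he hx.
set E := [set enorm (x - z) | z in zeros_on X H].
have E0 : E (enorm x) by exists 0; rewrite ?subr0.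
have lE : lbound E (enorm x).
  move=> _ [z [Xz Hz] <-].
  have [hz|/existsNP[i /negP hi]] := pselect (forall i, `|z 0 i| < e).
    by rewrite (he z Xz hz Hz) subr0.
  rewrite -leNgt in hi.
  have := enorm_coord (x - z) i; have := enorm_coord x i; rewrite !mxE => h1 h2.
  have := ler_normB (x 0 i) (x 0 i - z 0 i); rewrite subKr => h3.
  lra.
apply/eqP; rewrite eq_le; apply/andP; split.
  by apply: ge_inf => //; exists (enorm x).
by apply: lb_le_inf => //; exists (enorm x).
Qed.

(** Near isolated zeros both distances are |x|, so an exponent admissible for [H1] is admissible for
    [H2] with constant [C / c]. *)
Lemma lojasiewicz_exponent_le p q (H1 : 'rV[R]_N -> 'rV[R]_p) (H2 : 'rV[R]_N -> 'rV[R]_q) c e :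
  isolated_zero X H1 -> isolated_zero X H2 -> 0 < c -> 0 < e ->
  (forall x, X x -> (forall i, `|x 0 i| < e) -> enorm (H1 x) <= c * enorm (H2 x)) ->
  (lojasiewicz_exponent X H2 <= lojasiewicz_exponent X H1)%E.
Proof.
move=> /isolated_zeroP[X0 H10 [e1 e10 he1]] /isolated_zeroP[_ H20 [e2 e20 he2]] c0 e0 hle.
apply: ereal_inf_le_tmp => _ [eta [C [eps [C0 eps0 h]]] <-]; exists eta => //.
exists (C / c), (Num.min (Num.min eps e) (Num.min (e1 / 2) (e2 / 2))); split.
- exact: divr_gt0.
- by rewrite !lt_min eps0 e0 !divr_gt0.
move=> x Xx; rewrite !lt_min => /andP[/andP[h1 h2] /andP[h3 h4]].
have := h x Xx h1; rewrite (edist_isolated X0 H10 e10 he1 h3) (edist_isolated X0 H20 e20 he2 h4) => h5.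
rewrite mulrAC ler_pdivrMr // [leRHS]mulrC; apply: le_trans h5 _.
by apply: hle => // i; exact: le_lt_trans (enorm_coord _ _) h2.
Qed.

End Exponents.

(** * Linear maps that kill no limit direction *)

Section LinearMaps.
Context {R : realType} (N m k : nat) (X : set 'rV[R]_N) (F : 'rV[R]_N -> 'rV[R]_m).

Lemma enorm_mulmx (L : 'M[R]_(m, k)) : exists2 c, 0 < c & forall y, enorm (y *m L) <= c * enorm y.
Proof.
pose B := \sum_i \sum_c `|L i c|.
have B0 : 0 <= B by apply: sumr_ge0 => i _; exact: sumr_ge0.
exists (k%:R * B + 1).
  by apply: ltr_wpDl => //; rewrite mulr_ge0.
move=> y; have y0 := enorm_ge0 y.
apply: (@le_trans _ _ (k%:R * (B * enorm y))); last first.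
  by rewrite mulrDl mul1r mulrA lerDl.
apply: enorm_le => [|c]; first exact: mulr_ge0.
rewrite mxE; apply: le_trans (ler_norm_sum _ _ _) _; rewrite mulr_suml; apply: ler_sum => i _.
rewrite normrM mulrC; apply: ler_pM => //; last exact: enorm_coord.
by rewrite (bigD1 c) //= lerDl sumr_ge0.
Qed.

Lemma ultra_limit (T : Type) (U : set_system T) {UU : UltraFilter U} (y : T -> R) B :
  (forall s, `|y s| <= B) -> exists l, forall e, 0 < e -> \forall s \near U, `|y s - l| < e.
Proof.
move=> hy.
have FF : ProperFilter (y @ U) by apply: fmap_proper_filter.
have FB : (y @ U) `[- B, B]%classic.
  by apply: (@filterE _ U) => s /=; rewrite in_itv /= -ler_norml; exact: hy.
have [l [_ hl]] := @segment_compact R (- B) B _ FF FB.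
exists l => e e0; have [//|h] := in_ultra_setVsetC [set s | `|y s - l| < e] UU.
have FA : (y @ U) [set t | ~ `|t - l| < e] by [].
have NB : nbhs l [set t | `|t - l| < e].
  by apply/nbhs_ballP; exists e => // t; rewrite /ball /= distrC.
by have [t [/= h1 h2]] := hl _ _ FA NB.
Qed.

(** Otherwise |F L| / |F| tends to 0 along points of X tending to 0, and a limit of F / |F| along an
    ultrafilter is a direction killed by [L]. *)
Lemma injective_on_directions (L : 'M[R]_(m, k)) :
  (forall u, limit_direction X F u -> u *m L != 0) ->
  exists c e, [/\ 0 < c, 0 < e & forall x, X x -> (forall i, `|x 0 i| < e) ->
    enorm (F x) <= c * enorm (F x *m L)].
Proof.
move=> hL; apply: contrapT => hn.
have hs (s : nat) : exists x, [/\ X x, forall i, `|x 0 i| < s.+1%:R^-1 &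
    s.+1%:R * enorm (F x *m L) < enorm (F x)].
  apply: contrapT => h; apply: hn; exists s.+1%:R, s.+1%:R^-1; split => //.
  by move=> x Xx hx; rewrite leNgt; apply/negP => h'; apply: h; exists x.
have [x hx] := choice hs.
pose v s : 'rV[R]_m := (enorm (F (x s)))^-1 *: F (x s).
have Fx0 s : 0 < enorm (F (x s)).
  by have [_ _] := hx s; apply: le_lt_trans; rewrite mulr_ge0 // enorm_ge0.
have [U [UU oU]] := ultraFilterLemma (F := \oo) (eventually_filter).
have v1 i s : `|v s 0 i| <= 1.
  rewrite mxE normrM gtr0_norm ?invr_gt0 // mulrC ler_pdivrMr // mul1r.
  exact: enorm_coord.
have [l hl] := choice (fun i => ultra_limit (v1 i)).
pose u : 'rV[R]_m := \row_i l i.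
have near_inv (e : R) : 0 < e -> \forall s \near U, s.+1%:R^-1 < e.
  move=> e0; apply: oU; by have := near_infty_natSinv_lt (PosNum e0); apply: filterS => s.
have near_v (e : R) : 0 < e -> \forall s \near U, forall i, `|v s 0 i - u 0 i| < e.
  move=> e0; apply: (@filter_forall _ _ (fun i s => `|v s 0 i - u 0 i| < e) U _) => i.
  by rewrite mxE; exact: hl.
have Du : limit_direction X F u.
  split.
    (* If u = 0, some F / |F| has all coordinates below 1 / (m + 1), too small for a unit vector. *)
    apply/eqP => u0; have [s hv] := @filter_ex _ U _ _ (near_v m.+1%:R^-1 (ltac:(by rewrite invr_gt0))).
    have : enorm (F (x s)) <= m%:R * (m.+1%:R^-1 * enorm (F (x s))).
      apply: enorm_le => [|i]; first by rewrite mulr_ge0 // ltW.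
      have := hv i; rewrite u0 !mxE subr0 normrM gtr0_norm ?invr_gt0 // mulrC ltr_pdivrMr //.
      exact: ltW.
    rewrite mulrA -[leLHS]mul1r ler_pM2r // ler_pdivlMr // mul1r ler_nat.
    by rewrite ltnn.
  move=> e e0.
  have [s [h1 h2]] := @filter_ex _ U _ _ (filterI (near_inv e e0) (near_v e e0)).
  have [Xs hs1 _] := hx s; exists (x s); split => //.
  - by move=> i; exact: lt_trans (hs1 i) h1.
  - by rewrite -enorm_eq0 gt_eqF.
  - by move=> i; have := h2 i; rewrite !mxE mulrC.
have /eqP := hL u Du; apply; apply/rowP => c; rewrite [RHS]mxE.
apply/eqP; rewrite -normr_le0; apply/ler_addgt0Pr => e e0; rewrite add0r.
pose B := \sum_i `|L i c|.
have B0 : 0 <= B by exact: sumr_ge0.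
pose d := e / (B + 1).
have d0 : 0 < d by rewrite divr_gt0 //; lra.
have [s [h1 h2]] := @filter_ex _ U _ _ (filterI (near_inv d d0) (near_v d d0)).
have [_ _ hs3] := hx s.
have e1 : `|(v s *m L) 0 c| <= d.
  rewrite -scalemxAl mxE normrM gtr0_norm ?invr_gt0 // mulrC ler_pdivrMr //.
  apply: le_trans (enorm_coord _ _) _; apply: (@le_trans _ _ (s.+1%:R^-1 * enorm (F (x s)))).
    by rewrite mulrC ler_pdivlMr // mulrC ltW.
  by rewrite ler_pM2r // ltW.
have e2 : `|(u *m L) 0 c - (v s *m L) 0 c| <= d * B.
  rewrite !mxE -sumrB; apply: le_trans (ler_norm_sum _ _ _) _.
  rewrite /B mulr_sumr; apply: ler_sum => i _; rewrite -mulrBl normrM.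
  by rewrite ler_wpM2r // distrC ltW.
have := ler_normD ((u *m L) 0 c - (v s *m L) 0 c) ((v s *m L) 0 c); rewrite subrK => h.
have dB : d * (B + 1) = e by rewrite divfK // gt_eqF //; lra.
rewrite mulrDr mulr1 in dB.
lra.
Qed.

End LinearMaps.

(** * From a nonzero polynomial to generic matrices *)

Section Genericity.
Context {R : realType} (m k : nat).
Local Notation A := ((nat -> R) -> R).

Lemma polyf_peval M (f : A) : polyf M f ->
  exists p : mpoly.mpoly M R, forall x : 'rV[R]_M, f (pt x) = peval p x.
Proof.
case: M => [|M] hf.
  exists (mpoly.mpolyC 0 (f (fun=> 0))) => x; rewrite /peval mpoly.mevalC.
  by apply: (polyf_dep hf).
have [p [_ hp]] := polyf_mpoly (N := M.+1) (B := predT) (v := fun i => inord i) hf (fun _ _ => isT).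
exists p => x; apply: hp => i iM; rewrite -ptE; congr (pt x _).
by rewrite /= inordK.
Qed.

(** On the line from L to [L1] the polynomial is not identically 0, so points of [S] arbitrarily
    close to L avoid its zeros. Only stability under such lines is asked of [S], which covers both
    the whole space and [Delta]. *)
Lemma generic_polynomial (S : set 'M[R]_(m, k)) (P : 'M[R]_(m, k) -> Prop) (q : A) L1 :
  polyf (m * k) q -> q (pt (mxvec L1)) != 0 ->
  (forall L t, S L -> S (L + t *: (L1 - L))) ->
  (forall L, S L -> q (pt (mxvec L)) != 0 -> P L) -> generic S P.
Proof.
move=> hq q1 line hP; have [p hp] := polyf_peval hq.
exists [set L | all (fun p => peval p (mxvec L) == 0) [:: p]]; split.
- by exists [:: p].
- move=> L SL B /nbhs_ballP[e /= e0 hB].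
  have [Q hQ] := polyf_line (pt (mxvec L)) (pt (mxvec (L1 - L))) hq.
  have line_pt t : q (pt (mxvec (L + t *: (L1 - L)))) = Q.[t].
    rewrite -hQ; apply: (polyf_dep hq) => i imk.
    by rewrite -[i]/(val (Ordinal imk)) !ptE linearD linearZ /= !mxE.
  have Q0 : Q != 0.
    apply: contraNneq q1 => Q0; have := line_pt 1; rewrite Q0 horner0 scale1r addrC subrK => ->.
    by rewrite eqxx.
  pose M := \sum_i \sum_j `|(L1 - L) i j| + 1.
  have M0 : 0 < M by apply: ltr_wpDl => //; apply: sumr_ge0 => i _; exact: sumr_ge0.
  have [t [/andP[t0 te] Qt]] := poly_nonroot Q0 (divr_gt0 e0 M0).
  exists (L + t *: (L1 - L)); split; last first.
    apply: hB; split => // i j; rewrite /ball /= !mxE opprD addNKr normrN normrM gtr0_norm //.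
    have hM : `|L1 i j - L i j| < M.
      apply: (@le_lt_trans _ _ (\sum_i \sum_j `|(L1 - L) i j|)); last by rewrite ltrDl.
      rewrite (bigD1 i) //= (bigD1 j) //= !mxE -addrA lerDl addr_ge0 ?sumr_ge0 // => i' _.
      exact: sumr_ge0.
    rewrite ltr_pdivlMr // in te; apply: le_lt_trans te.
    by rewrite ler_pM2l // ltW.
  split; first exact: line.
  by rewrite /= andbT -hp line_pt; exact/negP.
- by move=> L [SL] /=; rewrite andbT -hp => /negP h; exact: hP.
Qed.

Context (hkm : (k <= m)%N).

Definition top (L : 'M[R]_(m, k)) : 'M[R]_k := \matrix_(i, c) L (widen_ord hkm i) c.

Lemma top_mul L T : top (L *m T) = top L *m T.
Proof. by apply/matrixP => i c; rewrite !mxE; apply: eq_bigr => l _; rewrite mxE. Qed.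

Lemma Delta_top L : Delta hkm L <-> top L = 1%:M.
Proof.
have split_sum (y : 'rV[R]_m) i : (y *m L) 0 i =
    \sum_(j < m | (j < k)%N) y 0 j * L j i + \sum_(j < m | (k <= j)%N) L j i * y 0 j.
  rewrite mxE (bigID (fun j : 'I_m => (j < k)%N)) /=; congr (_ + _).
  by apply: eq_big => j; [rewrite -leqNgt|move=> _; rewrite mulrC].
split => [[al h]|tL].
  apply/matrixP => i c; have := h (delta_mx 0 (widen_ord hkm i)) c.
  rewrite -rowE !mxE eqxx /= => ->; rewrite big1 ?addr0.
    by rewrite eq_sym -!(inj_eq val_inj).
  move=> j kj; rewrite mxE eqxx /=; case: eqP => [e|]; last by rewrite mulr0.
  by have := ltn_ord i; rewrite ltnNge -[val i]/(val (widen_ord hkm i)) -e kj.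
exists (fun i j => L j i) => y i; rewrite split_sum; congr (_ + _).
rewrite (bigD1 (widen_ord hkm i)) /=; last exact: ltn_ord.
have tLE j : L (widen_ord hkm j) i = (j == i)%:R by have /matrixP/(_ j i) := tL; rewrite !mxE.
rewrite tLE eqxx mulr1 big1 ?addr0 // => j /andP[jk ji].
have -> : j = widen_ord hkm (Ordinal jk) by apply/val_inj.
rewrite tLE (_ : _ == _ = false) ?mulr0 //; apply: contraNF ji => /eqP e.
by rewrite -(inj_eq val_inj) /= -e.
Qed.

(** Badness is stable under right multiplication by invertible T, so [q] may be replaced by w -> q
    (w T). With T the top block of a matrix at which both [q] and the determinant of that block are
    nonzero, the new polynomial is nonzero at this matrix times T^-1, whose top block is the
    identity. *)
Lemma polynomial_on_Delta (bad : 'M[R]_(m, k) -> Prop) (q : A) :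
  polyf (m * k) q -> (exists z, q z != 0) -> (forall L, bad L -> q (pt (mxvec L)) = 0) ->
  (forall L T, bad L -> T \in unitmx -> bad (L *m T)) ->
  exists (q1 : A) L1, [/\ polyf (m * k) q1, Delta hkm L1, q1 (pt (mxvec L1)) != 0 &
    forall L, bad L -> q1 (pt (mxvec L)) = 0].
Proof.
move=> hq [z0 q0] badq badT.
pose mat z : 'M[R]_(m, k) := \matrix_(i, c) z (entry i c).
have matK L : mat (pt (mxvec L)) = L by apply/matrixP => i c; rewrite mxE pt_entry.
have hdet : polyf (m * k) (fun z => \det (top (mat z))).
  apply: (@polyf_sum R _ _ (index_enum _) (fun (s : 'S_k) z => (-1) ^+ s * \prod_i top (mat z) i (s i))) => s.
  apply: polyf_mul; first exact: polyf_cst.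
  apply: (@polyf_prod R _ _ (index_enum _) (fun i z => top (mat z) i (s i))) => i.
  rewrite (_ : (fun _ => _) = fun z => z (entry (widen_ord hkm i) (s i))).
    by apply: polyf_coord; exact: entry_lt.
  by apply/funext => z; rewrite !mxE.
pose L0 : 'M[R]_(m, k) := \matrix_(i, c) (i == widen_ord hkm c)%:R.
have det0 : \det (top (mat (pt (mxvec L0)))) != 0.
  rewrite matK (_ : top L0 = 1%:M) ?det1 ?oner_neq0 //.
  by apply/matrixP => i c; rewrite !mxE -!(inj_eq val_inj).
have [z [qz dz]] := polyf_nonzero2 hq hdet q0 det0.
set T := top (mat z) in dz.
have uT : T \in unitmx by rewrite unitmxE unitfE.
pose q1 : A := fun w => q (pt (mxvec (mat w *m T))).
exists q1, (mat z *m invmx T); split.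
- apply: (polyf_subst (l := fun a w => pt (mxvec (mat w *m T)) a) hq) => a amk.
  have [i [c ->]] := entry_surj amk.
  rewrite (_ : (fun _ => _) = fun w => \sum_l w (entry i l) * T l c).
    apply: (@polyf_sum R _ _ (index_enum _) (fun l w => w (entry i l) * T l c)) => l.
    by apply: polyf_mul; [apply: polyf_coord; exact: entry_lt|exact: polyf_cst].
  by apply/funext => w; rewrite pt_entry mxE; apply: eq_bigr => l _; rewrite mxE.
- by apply/Delta_top; rewrite top_mul mulmxV.
- rewrite /q1 matK mulmxKV // (polyf_dep hq (z' := z)) // => a amk.
  by have [i [c ->]] := entry_surj amk; rewrite pt_entry mxE.
- by move=> L bL; rewrite /q1 matK; apply: badq; exact: badT.
Qed.

End Genericity.

Theorem theorem3p1 (R : realType) (N n m k : nat) (X : set 'rV[R]_N)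
    (F : 'rV[R]_N -> 'rV[R]_m)
    (Xclosed : closed X) (Xsemialg : semialgebraic X) (X0 : X 0)
    (X0acc : limit_point X 0)
    (F0 : F 0 = 0) (Fan : analytic_germ_on X F) (Fiso : isolated_zero X F)
    (dimX : has_dim0 X n) (hnk : (n <= k)%N) (hkm : (k <= m)%N) :
  [/\ forall L : 'M[R]_(m, k), isolated_zero X (lin_comp L F) ->
        (lojasiewicz_exponent X F <= lojasiewicz_exponent X (lin_comp L F))%E,
      generic setT (fun L : 'M[R]_(m, k) =>
        isolated_zero X (lin_comp L F) /\
        lojasiewicz_exponent X F = lojasiewicz_exponent X (lin_comp L F)) &
      generic (Delta hkm) (fun L : 'M[R]_(m, k) =>
        isolated_zero X (lin_comp L F) /\
        lojasiewicz_exponent X F = lojasiewicz_exponent X (lin_comp L F))].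
Proof.
have part1 (L : 'M[R]_(m, k)) : isolated_zero X (lin_comp L F) ->
    (lojasiewicz_exponent X F <= lojasiewicz_exponent X (lin_comp L F))%E.
  move=> isoL; have [c c0 hc] := enorm_mulmx L.
  by apply: (@lojasiewicz_exponent_le R N X k m _ _ c 1 isoL Fiso c0 ltr01) => x _ _; exact: hc.
have [_ _ [e1 e10 he1]] := (isolated_zeroP X F).1 Fiso.
have [U [G [oU U0 anG FG]]] := Fan.
have hg (i : 'I_m) : exists ge : ((nat -> R) -> R) * R, [/\ anal N ge.1, 0 < ge.2 &
    forall x : 'rV[R]_N, (forall l, `|x 0 l| < ge.2) -> G x 0 i = ge.1 (pt x)].
  have [g [h1 [e h2 h3]]] := analytic_anal (anG 0 U0 i).
  by exists (g, e).
have [ge hge] := choice hg.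
have [e2 e20 he2] : exists2 e, 0 < e & forall x : 'rV[R]_N, (forall l, `|x 0 l| < e) -> U x.
  by apply/nbhs0_rowP; apply: open_nbhs_nbhs.
pose e3 := \big[Num.min/Num.min e1 e2]_i (ge i).2.
have e30 : 0 < e3.
  rewrite /e3; elim/big_ind: _ => [|u v u0 v0|i _]; rewrite ?lt_min ?e10 ?u0 //.
  by have [] := hge i.
have e3_12 : e3 <= Num.min e1 e2.
  rewrite /e3; elim: (index_enum _) => [|i s IH]; first by rewrite big_nil.
  by rewrite big_cons ge_min IH orbT.
have Ff x : X x -> (forall l, `|x 0 l| < e3) -> forall i, F x 0 i = (ge i).1 (pt x).
  move=> Xx hx i; rewrite FG //; last first.
    by apply: he2 => l; apply: lt_le_trans (hx l) (le_trans e3_12 _); rewrite ge_min lexx orbT.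
  have [_ _ ->] // := hge i; move=> l; apply: lt_le_trans (hx l) _.
  by rewrite /e3 (bigD1 i) //= ge_min lexx.
have f0 i : (ge i).1 (fun=> 0) = 0.
  have := Ff 0 X0 _ i; rewrite pt0 F0 mxE => f0; apply/esym/f0 => l.
  by rewrite mxE normr0.
have anf i : anal N (ge i).1 by have [] := hge i.
(* The sum of squares has the zeros of F on X near 0 and brings the problem to a single germ. *)
pose g2 z := \sum_(i < m) (ge i).1 z ^+ 2.
have an2 : anal N g2 by apply: anal_sum => i _; exact: anal_exp.
have g2F x : X x -> (forall l, `|x 0 l| < e3) -> g2 (pt x) = \sum_i F x 0 i ^+ 2.
  by move=> Xx hx; apply: eq_bigr => i _; rewrite Ff.
have [|s [e4 [e40 hs]]] := lojasiewicz_exists Xclosed Xsemialg an2.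
  exists e3 => // x Xx hx; rewrite g2F // => /eqP; rewrite psumr_eq0 => [/allP h|i _]; last exact: sqr_ge0.
  apply: he1 => //.
    by move=> l; apply: lt_le_trans (hx l) (le_trans e3_12 _); rewrite ge_min lexx.
  by apply/rowP => i; have := h i (mem_index_enum i); rewrite sqrf_eq0 mxE => /eqP.
(* The division by N + 1 passes from the sup norm to the Euclidean norm. *)
pose e0 := Num.min e3 (e4 / N.+1%:R).
have e00 : 0 < e0 by rewrite lt_min e30 divr_gt0.
have e0_3 (x : 'rV[R]_N) : (forall l, `|x 0 l| < e0) -> forall l, `|x 0 l| < e3.
  by move=> h l; have := h l; rewrite lt_min => /andP[].
have loj x : X x -> (forall l, `|x 0 l| < e0) -> enorm x ^+ s.+1 <= \sum_i F x 0 i ^+ 2.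
  move=> Xx hx; have hx3 := e0_3 x hx; rewrite -g2F //.
  apply: le_trans (hs x Xx _) _; last first.
    by rewrite ger0_norm // g2F // sumr_ge0 // => i _; exact: sqr_ge0.
  apply: (@le_lt_trans _ _ (N%:R * (e4 / N.+1%:R))).
    apply: enorm_le => [|l]; first by rewrite divr_ge0 // ltW.
    by have := hx l; rewrite lt_min => /andP[_ /ltW].
  by rewrite mulrCA gtr_pMr // ltr_pdivrMr // mul1r ltr_nat.
have [W [W0 rel]] := dim0_relations Xsemialg dimX.
have [e [j [e_gt0 ej few]]] := few_independent_directions hnk W0 rel anf f0 e00
  (fun x Xx hx => Ff x Xx (e0_3 x hx)) loj.
have [h [u [he Du span]]] := spanning_directions few.
have [q [hq q0 qbad]] := avoiding_polynomial ej he span.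
(* Outside this set [injective_on_directions] applies; v L = 0 implies v L T = 0, which gives the
   stability needed to reach [Delta]. *)
pose bad (L : 'M[R]_(m, k)) := exists2 v, limit_direction X F v & v *m L = 0.
have [||q1 [L1 [hq1 DL1 q1L1 q1bad]]] := polynomial_on_Delta hkm (bad := bad) hq q0.
- by move=> L [v Dv vL]; apply: (qbad L v Dv _ vL); case: Dv.
- by move=> L T [v Dv vL] _; exists v => //; rewrite mulmxA vL mul0mx.
have good (L : 'M[R]_(m, k)) : q1 (pt (mxvec L)) != 0 -> isolated_zero X (lin_comp L F) /\
    lojasiewicz_exponent X F = lojasiewicz_exponent X (lin_comp L F).
  move=> qL; have [v Dv|c [d [c0 d0 hcd]]] := @injective_on_directions R N m k X F L.
    by apply: contraNneq qL => vL; apply/eqP/q1bad; exists v.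
  have isoL : isolated_zero X (lin_comp L F).
    apply/isolated_zeroP; split => //; first by rewrite /lin_comp F0 mul0mx.
    exists (Num.min d e1); first by rewrite lt_min d0.
    move=> x Xx hx LFx; apply: he1 => //; first by move=> l; have := hx l; rewrite lt_min => /andP[].
    apply/eqP; rewrite -enorm_eq0 eq_le enorm_ge0 andbT.
    apply: le_trans (hcd x Xx _) _; first by move=> l; have := hx l; rewrite lt_min => /andP[].
    by move: LFx; rewrite /lin_comp => ->; rewrite enorm0 mulr0.
  split => //; apply/eqP; rewrite eq_le part1 //=.
  exact: (lojasiewicz_exponent_le Fiso isoL c0 d0).
split => //.
- by apply: (generic_polynomial hq1 q1L1) => // L _; exact: good.
- apply: (generic_polynomial hq1 q1L1) => [L t|L _]; last exact: good.
  (* [Delta] is an affine subspace, so it contains the line through two of its points. *)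
  move=> /Delta_top DL; apply/Delta_top; move/Delta_top: DL1 => DL1.
  have -> : top hkm (L + t *: (L1 - L)) = top hkm L + t *: (top hkm L1 - top hkm L).
    by apply/matrixP => i c; rewrite !mxE.
  by rewrite DL DL1 subrr scaler0 addr0.
Qed.
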